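(* Let $\mathbf n=(n_k)_{k\ge0}$ be a strictly increasing sequence of positive integers with $n_0=1$, and put $$c(\mathbf n):=\sup_k\frac{n_{k+1}}{n_k}\in[1,\infty],\qquad c_\infty(\mathbf n):=\limsup_{k\to\infty}\frac{n_{k+1}}{n_k}.$$ (i) Let $c_\infty(\mathbf n)<\infty$ and $c'\ge c_\infty(\mathbf n)$. If $T$ is a power bounded operator on a complex Banach space with $\sigma(T)\cap\mathbb T\subset\{1\}$ and $$\sup_k\sup_{\eta\in\Gamma_{c'}}\|(\eta-T^{n_k})^{-1}\|<\infty,$$ then $T$ is a Ritt operator. In particular, if $n_{k+1}/n_k\to1$, $T$ is power bounded, $\sigma(T)\cap\mathbb T\subset\{1\}$ and $\sup_k\|(\zeta-T^{n_k})^{-1}\|<\infty$ for some $\zeta\in\mathbb T\setminus\{1\}$, then $T$ is a Ritt operator; and if $c(\mathbf n)\le c<\infty$, then every power bounded operator $T$ with $\sup_k\|I-T^{n_k}\|<2\sin\frac{\pi}{c+1}$ is a Ritt operator (no peripheral spectral assumption being made). (ii) Let $n_k=b^k$, where $b\ge2$ is an integer. For every closed arc $\Gamma$ contained in the interior of $\Gamma_b$ there is a normal contraction $T$ with $\sigma(T)\subset\mathbb D\cup\{1\}$ and $\sup_k\sup_{\eta\in\Gamma}\|(\eta-T^{b^k})^{-1}\|<\infty$ which is not a Ritt operator. Among power bounded operators $T$ with $\sigma(T)\subset\mathbb D\cup\{1\}$, the sharp norm threshold is $Q_b:=\max\{1,2\sin\frac{\pi}{b+1}\}$: the implication ''$\sup_k\|I-T^{b^k}\|<Q\Rightarrow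 T$ is Ritt'' holds for $Q=Q_b$ and fails for every $Q>Q_b$. Among all power bounded operators, without this spectral assumption, the sharp threshold for the same implication is $2\sin\frac{\pi}{b+1}$. (iii) If $c(\mathbf n)=\infty$, then for every closed arc $\Gamma\subset\mathbb T\setminus\{1\}$ there is a normal contraction $T$ with $\sigma(T)\subset\mathbb D\cup\{1\}$ which is not Ritt and satisfies $\sup_k\sup_{\eta\in\Gamma}\|(\eta-T^{n_k})^{-1}\|<\infty$; and for every $q>1$ there is a normal contraction $T$ with $\sigma(T)\subset\mathbb D\cup\{1\}$ which is not Ritt and satisfies $\sup_k\|I-T^{n_k}\|\le q$. (iv) $\mathbf n$ is a Ritt sampling sequence if and only if $c(\mathbf n)<\infty$; in that case, for every power bounded $T$, $$\sup_{n\ge1}n\|T^n-T^{n-1}\|\le M(T)\,c(\mathbf n)\,\sup_{k}n_k\|T^{n_k}-T^{n_k-1}\|.$$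
   Context: $\mathbb D$ is the open unit disc, $\mathbb T$ the unit circle. A bounded operator $T$ on a complex Banach space is power bounded if $M(T):=\sup_{n\ge0}\|T^n\|<\infty$, and a Ritt operator if $\sigma(T)\subset\overline{\mathbb D}$ and $\sup_{|\lambda|>1}|\lambda-1|\,\|(\lambda-T)^{-1}\|<\infty$. Finiteness of a supremum of norms of inverses includes the existence of all the inverses involved. Normal contractions are operators on Hilbert space. For $c\ge1$, $\Gamma_c:=\{e^{it}:\frac{2\pi}{c+1}\le t\le\frac{2\pi c}{c+1}\}$, so $\Gamma_1=\{-1\}$; for $b>1$ the interior of $\Gamma_b$ is $\{e^{it}:\frac{2\pi}{b+1}<t<\frac{2\pi b}{b+1}\}$. Closed arcs of $\mathbb T$ denoted $\Gamma$ without further specification have positive length. $\mathbf n$ is a Ritt sampling sequence if, for every complex Banach space $X$ and every power bounded $T\in\mathcal B(X)$, $\sup_kn_k\|T^{n_k}-T^{n_k-1}\|<\infty$ implies that $T$ is a Ritt operator. *)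

(* Defs.v *)
From HB Require Import structures.
From mathcomp Require Import all_boot all_order all_algebra.
From mathcomp Require Import complex.
From mathcomp Require Import all_classical all_reals all_analysis.

Set Implicit Arguments.
Unset Strict Implicit.
Unset Printing Implicit Defensive.

Import Order.TTheory GRing.Theory Num.Theory.
Import numFieldNormedType.Exports.

Local Open Scope classical_set_scope.
Local Open Scope ring_scope.

(* A complex Banach space is a completeNormedModType over R[i]; the library
   norm `|x| : R[i] is then a nonnegative real viewed in R[i], and Re extracts
   it. *)

Section Circle.
Context {R : realType}.

Definition expi (t : R) : R[i] := Complex (cos t) (sin t).

Definition open_disc : set R[i] := [set z | `|z| < 1].
Definition closed_disc : set R[i] := [set z | `|z| <= 1].
Definition circle : set R[i] := [set z | `|z| = 1].

Definition unit_arc (c : R) : set R[i] :=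
  [set expi t | t in `[2 * pi / (c + 1), 2 * pi * c / (c + 1)]].

Definition unit_arc_interior (c : R) : set R[i] :=
  [set expi t | t in `]2 * pi / (c + 1), 2 * pi * c / (c + 1)[].

Definition closed_arc (G : set R[i]) : Prop :=
  exists a b : R, [/\ a < b, b <= a + 2 * pi & G = [set expi t | t in `[a, b]]].

End Circle.

Section Operators.
Context {R : realType} {X : completeNormedModType R[i]}.
Implicit Types (A : X -> X) (T : {linear X -> X}).
Local Open Scope ereal_scope.

Definition opnorm A : \bar R :=
  ereal_sup [set (complex.Re `|A x|)%:E | x in [set x : X | (`|x| <= 1)%R]].

Definition bounded_inverse A (S : {linear X -> X}) : Prop :=
  [/\ continuous S, cancel A S & cancel S A].

(* The norm of the inverse of A in B(X). Inverses are unique, so the infimum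
   runs over at most one value; it is +oo when A is not invertible, so that the
   finiteness of a supremum of such norms includes invertibility. *)
Definition invnorm A : \bar R :=
  ereal_inf [set opnorm S | S in [set S : {linear X -> X} | bounded_inverse A S]].

Definition pencil (l : R[i]) A : X -> X := fun x => (l *: x - A x)%R.

Definition spectrum A : set R[i] :=
  [set l | ~ exists S : {linear X -> X}, bounded_inverse (pencil l A) S].

Definition power_constant A : \bar R :=
  ereal_sup [set opnorm (iter m A) | m in [set: nat]].

Definition power_bounded T : Prop := continuous T /\ power_constant T < +oo.

Definition ritt T : Prop :=
  [/\ continuous T,
      spectrum T `<=` closed_disc &
      ereal_sup [set (complex.Re `|l - 1|)%:E * invnorm (pencil l T)
                | l in [set l : R[i] | (1 < `|l|)%R]] < +oo].

(* The double supremum over k and eta in G, taken over pairs (k, eta). *)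
Definition sup_resolvent (n : nat -> nat) (G : set R[i]) T : \bar R :=
  ereal_sup [set invnorm (pencil p.2 (iter (n p.1) T))
            | p in [set p : nat * R[i] | G p.2]].

Definition sup_dist_id (n : nat -> nat) T : \bar R :=
  ereal_sup [set opnorm (fun x : X => (x - iter (n k) T x)%R) | k in [set: nat]].

(* Only used for m > 0: m.-1 is truncated at m = 0. *)
Definition ritt_diff T (m : nat) : \bar R :=
  m%:R%:E * opnorm (fun x : X => (iter m T x - iter m.-1 T x)%R).

(* The norm of the Banach space X comes from ip, so that X is a Hilbert space. *)
Definition hilbert_product (ip : {dot X for Num.conj}) : Prop :=
  forall x : X, ip x x = (`|x| ^+ 2)%R.

Definition adjoint_of (ip : {dot X for Num.conj}) (T S : {linear X -> X}) : Prop :=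
  forall x y : X, ip (T x) y = ip x (S y).

Definition normal_contraction T : Prop :=
  exists ip : {dot X for Num.conj},
    [/\ hilbert_product ip, continuous T, opnorm T <= 1 &
        exists S : {linear X -> X},
          [/\ continuous S, adjoint_of ip T S & T \o S =1 S \o T]].

End Operators.

Section Sequences.
Context (R : realType).
Implicit Type n : nat -> nat.
Local Open Scope ereal_scope.

Definition seq_ratio n (k : nat) : R := ((n k.+1)%:R / (n k)%:R)%R.

Definition sup_ratio n : \bar R :=
  ereal_sup [set (seq_ratio n k)%:E | k in [set: nat]].

Definition limsup_ratio n : \bar R := limn_esup (fun k => (seq_ratio n k)%:E).

Definition ritt_sampling n : Prop :=
  forall (X : completeNormedModType R[i]) (T : {linear X -> X}),
    power_bounded T ->
    ereal_sup [set ritt_diff T (n k) | k in [set: nat]] < +oo ->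
    ritt T.

End Sequences.

(* Main.v *)
Require Import Defs.
From HB Require Import structures.
From mathcomp Require Import all_boot all_order all_algebra.
From mathcomp Require Import complex.
From mathcomp Require Import all_classical all_reals all_analysis.
From mathcomp Require Import ring lra zify.

Set Implicit Arguments.
Unset Strict Implicit.
Unset Printing Implicit Defensive.

Import Order.TTheory GRing.Theory Num.Theory.
Import numFieldNormedType.Exports.

Local Open Scope classical_set_scope.
Local Open Scope ring_scope.

(** Every operator is compared with its approximate eigenvectors.  For a power
bounded T with bound M, a relation ‖(l - T)x‖ = e propagates to powers:
‖(l^n - T^n)x‖ is at most n M e on the unit circle.  This gives at once
the resolvent outside the disc (resolvent_exists), and it reduces the Ritt
property to the lower bounds c |t| ‖x‖ <= ‖(e^{it} - T)x‖ for |t| <= pi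
(ritt_of_circle).

For part (i), let t be small and take the first k for which n_k |t| reaches the
beginning of the arc.  Since n_{k+1}/n_k is asymptotically at most c, the angle
n_k t cannot jump over an arc whose endpoints have ratio c, so that e^{i n_k t}
is close to a point of the arc; there T^{n_k} is bounded below, and the
propagated error n_k M e is of order e / |t|.  Hence e >= const |t| ‖x‖
(local_lower).  The angles away from 0 are handled by compactness and the
spectral hypothesis, or, when ‖I - T^{n_k}‖ is small, by the same argument
with k = 0, because n_0 = 1.  Part (iv) uses
T^m - T^{m-1} = T^{m-n_k} (T^{n_k} - T^{n_k-1}) for n_k <= m < n_{k+1}, and the
fact that bounded n ‖T^n - T^{n-1}‖ forces the lower bounds (ritt_of_diff).

The threshold 1 in part (ii) is of a different nature.  If
sup_k ‖I - T^{b^k}‖ = q < 1, then T is invertible with power bounded inverse, so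
its spectrum is contained in {1}, and in fact T = I (unipotent_id).  Here
N = T - 1 is quasinilpotent (quasinilpotent), and T is the limit of the
binomial series of (1 + W)^{1/n} at W = T^n - 1, n = b^k: the difference of
1 + X and a partial sum, as a polynomial in X, is divisible by a high power of
X, which quasinilpotence makes small.  The series gives
‖T - I‖ <= q / ((1 - q) n), and n tends to infinity.

All the counterexamples are diagonal operators on l^2 with eigenvalues
r_j e^{i t_j} tending to 1 tangentially, t_j / (1 - r_j) -> oo, which excludes the
Ritt property (diagonal_ritt).  For n_k = b^k the angles t_j = 2 pi / ((b+1) b^j)
have the property that multiplication by b exchanges +- 2 pi / (b+1), so that the
powers never enter the open arc (tangential_example).  If the ratios are
unbounded, an eigenvalue is placed in each large gap: its powers stay near the
positive axis before the gap and are already small after it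
(lacunary_example). *)

(** * Moduli, norms and the unit circle *)

Section Modulus.
Context {R : realType}.

(** Norms in a normed space over R[i] are R[i]-valued; the estimates are all done
in R. *)
Definition nrm (V : normedZmodType R[i]) (x : V) : R := complex.Re `|x|.

Lemma nrmE (V : normedZmodType R[i]) (x : V) : `|x| = (nrm x)%:C%C.
Proof. by rewrite /nrm RRe_real// ger0_real. Qed.

Lemma nrm_le1 (V : normedZmodType R[i]) (x : V) : (`|x| <= 1) = (nrm x <= 1).
Proof. by rewrite nrmE -[1]/(1%:C%C) lecR. Qed.

Lemma nrm_lt1 (V : normedZmodType R[i]) (x : V) : (`|x| < 1) = (nrm x < 1).
Proof. by rewrite nrmE -[1]/(1%:C%C) ltcR. Qed.

Lemma nrm_gt1 (V : normedZmodType R[i]) (x : V) : (1 < `|x|) = (1 < nrm x).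
Proof. by rewrite nrmE -[1]/(1%:C%C) ltcR. Qed.

Lemma nrm_ge0 (V : normedZmodType R[i]) (x : V) : 0 <= nrm x.
Proof. by have := normr_ge0 x; rewrite nrmE ler0c. Qed.

Lemma nrmD (V : normedZmodType R[i]) (x y : V) : nrm (x + y) <= nrm x + nrm y.
Proof. by have := ler_normD x y; rewrite !nrmE -rmorphD lecR. Qed.

Lemma nrmN (V : normedZmodType R[i]) (x : V) : nrm (- x) = nrm x.
Proof. by rewrite /nrm normrN. Qed.

Lemma nrmBC (V : normedZmodType R[i]) (x y : V) : nrm (x - y) = nrm (y - x).
Proof. by rewrite -nrmN opprB. Qed.

Lemma nrmB (V : normedZmodType R[i]) (x y : V) : nrm (x - y) <= nrm x + nrm y.
Proof. by rewrite -(nrmN y) nrmD. Qed.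

Lemma nrm_lerB (V : normedZmodType R[i]) (x y : V) : nrm x - nrm y <= nrm (x - y).
Proof. by rewrite lerBlDr -{1}(subrK y x) nrmD. Qed.

Lemma nrm0 (V : normedZmodType R[i]) : nrm (0 : V) = 0.
Proof. by rewrite /nrm normr0. Qed.

Lemma nrm_eq0 (V : normedZmodType R[i]) (x : V) : nrm x = 0 -> x = 0.
Proof. by move=> h; apply/eqP; rewrite -normr_eq0 nrmE h. Qed.

Lemma nrm_gt0 (V : normedZmodType R[i]) (x : V) : (0 < nrm x) = (x != 0).
Proof.
rewrite lt_neqAle nrm_ge0 andbT eq_sym; congr (~~ _).
by apply/eqP/eqP => [/nrm_eq0|->]; rewrite ?nrm0.
Qed.

Lemma nrm_le0 (V : normedZmodType R[i]) (x : V) : nrm x <= 0 -> x = 0.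
Proof. by move=> h; apply: nrm_eq0; apply/le_anti; rewrite h nrm_ge0. Qed.

Lemma nrm_sum (V : normedZmodType R[i]) I (r : seq I) (F : I -> V) :
  nrm (\sum_(i <- r) F i) <= \sum_(i <- r) nrm (F i).
Proof.
elim/big_ind2: _ => //; first by rewrite nrm0.
by move=> x a y b hx hy; apply: le_trans (nrmD _ _) _; apply: lerD.
Qed.

Lemma nrmZ (V : normedModType R[i]) (l : R[i]) (x : V) :
  nrm (l *: x) = nrm l * nrm x.
Proof. by apply: complexI; rewrite rmorphM/= -!nrmE normrZ. Qed.

Lemma nrmM (a b : R[i]) : nrm (a * b) = nrm a * nrm b.
Proof. by apply: complexI; rewrite rmorphM/= -!nrmE normrM. Qed.

Lemma nrmX (a : R[i]) k : nrm (a ^+ k) = nrm a ^+ k.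
Proof. by apply: complexI; rewrite rmorphXn/= -!nrmE normrX. Qed.

Lemma nrmV (a : R[i]) : nrm a^-1 = (nrm a)^-1.
Proof. by apply: complexI; rewrite fmorphV/= -!nrmE normfV. Qed.

Lemma nrm1 : nrm (1 : R[i]) = 1.
Proof. by rewrite /nrm normr1. Qed.

Lemma nrm_real (a : R) : nrm (a%:C%C) = `|a|.
Proof. by rewrite /nrm normc_def/= expr0n addr0 sqrtr_sqr. Qed.

Lemma nrm_nat k : nrm (k%:R : R[i]) = k%:R.
Proof. by rewrite -(rmorph_nat (real_complex R)) nrm_real normr_nat. Qed.

Lemma nrm_sqr (z : R[i]) : nrm z ^+ 2 = complex.Re z ^+ 2 + complex.Im z ^+ 2.
Proof.
by rewrite /nrm normc_def/= sqr_sqrtr// addr_ge0// sqr_ge0.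
Qed.

Lemma nrm_geRe (z : R[i]) : `|complex.Re z| <= nrm z.
Proof.
rewrite -(@ler_pXn2r _ 2)// ?nnegrE ?nrm_ge0// nrm_sqr real_normK ?num_real//.
by rewrite lerDl sqr_ge0.
Qed.

Lemma nrm_geIm (z : R[i]) : `|complex.Im z| <= nrm z.
Proof.
rewrite -(@ler_pXn2r _ 2)// ?nnegrE ?nrm_ge0// nrm_sqr real_normK ?num_real//.
by rewrite lerDr sqr_ge0.
Qed.

Lemma nrm_le_ReIm (z : R[i]) : nrm z <= `|complex.Re z| + `|complex.Im z|.
Proof.
rewrite -(@ler_pXn2r _ 2)// ?nnegrE ?nrm_ge0 ?addr_ge0// nrm_sqr sqrrD.
by rewrite !real_normK ?num_real// addrAC lerDl mulrn_wge0// mulr_ge0.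
Qed.

Lemma complex_ext (z w : R[i]) :
  complex.Re z = complex.Re w -> complex.Im z = complex.Im w -> z = w.
Proof. by case: z w => a b [c d]/= -> ->. Qed.

Lemma sin_MVT (x : R) : 0 < x -> exists2 c : R, 0 < c < x & sin x = cos c * x.
Proof.
move=> x0; have [|c] := MVT x0 (fun t _ => is_derive_sin t).
  by apply: derivable_within_continuous => t _; exact: ex_derive.
by rewrite in_itv/= sin0 !subr0 => cx h; exists c.
Qed.

Lemma sin_le_norm (x : R) : `|sin x| <= `|x|.
Proof.
wlog x0 : x / 0 <= x.
  move=> h; case: (leP 0 x) => [/h//|/ltW x0].
  by rewrite -normrN -sinN -[leRHS]normrN h// oppr_ge0.
rewrite [leRHS]ger0_norm// ler_norml; apply/andP; split.
  case: (leP x pi) => xp.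
    by apply: (@le_trans _ _ 0); [rewrite oppr_le0|rewrite sin_ge0_pi// x0 xp].
  apply: (@le_trans _ _ (-1)); last exact: sin_geN1.
  rewrite lerN2; apply: le_trans (ltW xp).
  by apply: le_trans (pi_ge2 R); rewrite ler1n.
move: x0; rewrite le_eqVlt => /predU1P[<-|x0]; first by rewrite sin0.
by have [c _ ->] := sin_MVT x0; rewrite ler_piMl ?cos_le1// ltW.
Qed.

Lemma cos_ge (x : R) : 1 - x ^+ 2 / 2 <= cos x.
Proof.
have -> : cos x = 1 - 2 * sin (x / 2) ^+ 2.
  by rewrite {1}(splitr x) cosD -!expr2 cos2sin2; ring.
have := sin_le_norm (x / 2); rewrite -(@ler_pXn2r _ 2)// ?nnegrE//.
rewrite !real_normK ?num_real// => h; nra.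
Qed.

Lemma sin_ge (x : R) : 0 <= x <= 1 -> x / 2 <= sin x.
Proof.
case/andP; rewrite le_eqVlt => /predU1P[<-|x0] x1; first by rewrite sin0 mul0r.
have [c /andP[c0 cx] ->] := sin_MVT x0.
have := cos_ge c => h; have : c ^+ 2 <= 1.
  by rewrite expr_le1// ?ltW//; apply: (lt_le_trans cx).
by nra.
Qed.

Lemma nrm_expi (t : R) : nrm (expi t) = 1.
Proof. by rewrite /nrm normc_def/= cos2Dsin2 sqrtr1. Qed.

Lemma expiD (s t : R) : expi (s + t) = expi s * expi t.
Proof.
by rewrite /expi/= cosD sinD; apply: complex_ext => //=; rewrite addrC// [sin t * _]mulrC.
Qed.

Lemma expi0 : expi (0 : R) = 1.
Proof. by rewrite /expi cos0 sin0. Qed.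

Lemma expiX (t : R) k : expi t ^+ k = expi (k%:R * t).
Proof.
elim: k => [|k IH]; first by rewrite expr0 mul0r expi0.
by rewrite exprS IH -expiD -natr1 mulrDl mul1r addrC.
Qed.

Lemma expi_lip (s t : R) : nrm (expi s - expi t) <= `|s - t|.
Proof.
rewrite -(@ler_pXn2r _ 2)// ?nnegrE ?nrm_ge0// nrm_sqr/= real_normK ?num_real//.
have := cos_ge (s - t); rewrite cosB.
have := cos2Dsin2 s; have := cos2Dsin2 t; nra.
Qed.

Lemma expi_dist1 (t : R) : nrm (expi t - 1) <= `|t|.
Proof. by rewrite -expi0 -{2}(subr0 t) expi_lip. Qed.

Lemma expi_sub2pi (t : R) : expi (2 * pi - t) = expi (- t).
Proof. by rewrite /expi addrC mulr_natl cosD2pi sinD2pi. Qed.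

Lemma expi_nrm1_surj (z : R[i]) : nrm z = 1 -> exists2 t : R, `|t| <= pi & z = expi t.
Proof.
move=> z1; have z2 : complex.Re z ^+ 2 + complex.Im z ^+ 2 = 1.
  by rewrite -nrm_sqr z1 expr1n.
have Rez : -1 <= complex.Re z <= 1 by rewrite -ler_norml -z1 nrm_geRe.
have [/andP[a0 api] ca] := acos_def Rez.
have sa : sin (acos (complex.Re z)) = `|complex.Im z|.
  rewrite sin_acos// -sqrtr_sqr; congr Num.sqrt; lra.
case: (leP 0 (complex.Im z)) => i0.
  exists (acos (complex.Re z)); first by rewrite ger0_norm.
  by apply: complex_ext => //=; rewrite sa ger0_norm.
exists (- acos (complex.Re z)); first by rewrite normrN ger0_norm.
by apply: complex_ext => /=; rewrite ?cosN// sinN sa ltr0_norm// opprK.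
Qed.

Lemma polar (z : R[i]) : exists2 t : R, `|t| <= pi & z = (nrm z)%:C%C * expi t.
Proof.
case: (eqVneq z 0) => [->|z0].
  by exists 0; rewrite ?normr0 ?pi_ge0// nrm0 mul0r.
have nz0 : nrm z != 0 by rewrite gt_eqF// nrm_gt0.
have [|t tpi h] := @expi_nrm1_surj (z * (nrm z)^-1%:C%C).
  by rewrite nrmM nrm_real normfV ger0_norm ?nrm_ge0// divff.
by exists t => //; rewrite -h mulrCA -rmorphM/= divff// mulr1.
Qed.

End Modulus.

Section Chords.
Context {R : realType}.

Lemma chordE (s : R) : 0 <= s <= 2 * pi -> nrm (expi s - 1) = 2 * sin (s / 2).
Proof.
move=> /andP[s0 s2].
have p0 : 0 <= 2 * sin (s / 2).
  by rewrite mulr_ge0// sin_ge0_pi//; apply/andP; split; lra.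
apply/eqP; rewrite -(@eqrXn2 _ 2)// ?nrm_ge0// nrm_sqr/=; apply/eqP.
have -> : cos s = 1 - 2 * sin (s / 2) ^+ 2.
  by rewrite {1}(splitr s) cosD -!expr2 cos2sin2; ring.
have -> : sin s = 2 * sin (s / 2) * cos (s / 2) by rewrite {1}(splitr s) sinD; ring.
rewrite subr0 exprMn [cos _ ^+ 2]cos2sin2; ring.
Qed.

Lemma chordN (s : R) : nrm (expi (- s) - 1) = nrm (expi s - 1).
Proof.
have -> : expi (- s) - 1 = expi (- s) * (1 - expi s).
  by rewrite mulrBr mulr1 -expiD addNr expi0.
by rewrite nrmM nrm_expi mul1r nrmBC.
Qed.

(** Through sin v = cos |v - pi/2| this is the monotonicity of the cosine. *)
Lemma sin_ge_mid (u b : R) : 0 <= b -> b <= u <= pi - b -> sin b <= sin u.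
Proof.
move=> b0 /andP[u1 u2]; have e v : sin v = cos `|v - pi / 2| :> R.
  by rewrite cos_norm cosB cos_pihalf sin_pihalf mulr0 add0r mulr1.
have bp : `|b - pi / 2| = pi / 2 - b by rewrite ler0_norm; lra.
have up : `|u - pi / 2| <= pi / 2 - b by rewrite ler_norml; lra.
have := pi_ge0 R => p0; have n0 := normr_ge0 (u - pi / 2).
by rewrite !e leNgt ltr_cos ?in_itv/= -?leNgt ?bp//; lra.
Qed.

End Chords.

(** * Bounded operators and their inverses *)

Section Operators.
Context {R : realType} {X : completeNormedModType R[i]}.
Implicit Types (A : X -> X) (T S : {linear X -> X}).

Lemma pos_complexP (e : R[i]) : 0 < e -> exists2 d : R, 0 < d & e = d%:C%C.
Proof.
move=> e0; exists (complex.Re e); last by rewrite RRe_real// gtr0_real.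
by move: e0; rewrite ltcE/= => /andP[].
Qed.

Lemma scalable0 A : scalable A -> A 0 = 0.
Proof. by move=> hA; rewrite -[in LHS](scale0r (0 : X)) hA scale0r. Qed.

Lemma opnorm_le A C : 0 <= C -> (forall x, nrm (A x) <= C * nrm x) ->
  (opnorm A <= C%:E)%E.
Proof.
move=> C0 h; apply: ge_ereal_sup => _ [x /= x1 <-]; rewrite lee_fin.
by apply: le_trans (h x) _; rewrite ler_piMr// -nrm_le1.
Qed.

Lemma opnorm_bound A (C : R) : scalable A -> (opnorm A <= C%:E)%E ->
  forall x, nrm (A x) <= C * nrm x.
Proof.
move=> hA hC x; case: (eqVneq x 0) => [->|x0].
  by rewrite scalable0// !nrm0 mulr0.
have nx0 : 0 < nrm x.
  by rewrite nrm_gt0.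
set y := (nrm x)^-1%:C%C *: x.
have y1 : nrm y = 1 by rewrite nrmZ nrm_real ger0_norm ?invr_ge0 ?nrm_ge0// mulVf// gt_eqF.
have : ((nrm (A y))%:E <= C%:E)%E.
  by apply: le_trans hC; apply: ereal_sup_ubound; exists y => //=; rewrite nrm_le1 y1.
rewrite lee_fin /y hA nrmZ nrm_real ger0_norm ?invr_ge0 ?nrm_ge0//.
by rewrite mulrC ler_pdivrMr.
Qed.

Lemma opnorm_ge0 A : (0 <= opnorm A)%E.
Proof.
apply: (@le_trans _ _ (nrm (A 0))%:E); first by rewrite lee_fin nrm_ge0.
by apply: ereal_sup_ubound; exists 0 => //=; rewrite normr0.
Qed.

Lemma ge0_lt_pinfty (x : \bar R) : (0 <= x)%E -> (x < +oo)%E -> exists2 r : R, 0 <= r & x = r%:E.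
Proof. by case: x => [r| |]//= r0 _; exists r. Qed.

Lemma lt_pinfty_bound (x : \bar R) : (x < +oo)%E -> exists2 K : R, 0 < K & (x < K%:E)%E.
Proof.
case: x => [r _|//|_]; last by exists 1; rewrite ?ltNyr.
by exists (`|r| + 1); rewrite ?ltr_wpDl// lte_fin (le_lt_trans (ler_norm r))// ltrDl.
Qed.

Lemma linear_continuous T C : (forall x, nrm (T x) <= C * nrm x) -> continuous T.
Proof.
move=> h x; apply/cvgrPdist_lt => _ /pos_complexP[e e0 ->].
have C1 : 0 < `|C| + 1 by rewrite ltr_wpDl.
near=> y; rewrite -raddfB/= nrmE ltcR.
apply: (@le_lt_trans _ _ ((`|C| + 1) * nrm (x - y))).
  apply: le_trans (h _) _; apply: ler_wpM2r; first exact: nrm_ge0.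
  by apply: le_trans (ler_norm _) _; rewrite lerDl.
rewrite -ltr_pdivlMl// mulrC -ltcR -nrmE.
near: y; apply: (@cvgr_dist_lt _ _ _ (nbhs x) _ id x) => //.
by rewrite ltcR divr_gt0.
Unshelve. all: by end_near. Qed.

Lemma continuous_linear_bound T : continuous T ->
  exists2 C : R, 0 < C & forall x, nrm (T x) <= C * nrm x.
Proof.
move=> cT; have := cT 0 => /cvgrPdist_lt/(_ _ ltr01).
case/nbhs_normP => _ /pos_complexP[d d0 ->] hd; exists (2 / d).
  by rewrite divr_gt0.
move=> x; case: (eqVneq x 0) => [->|x0]; first by rewrite linear0 !nrm0 mulr0.
have nx0 : 0 < nrm x.
  by rewrite nrm_gt0.
have c0 : 0 < d / 2 / nrm x by rewrite divr_gt0// divr_gt0.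
have /= := hd (((d / 2 / nrm x)%:C)%C *: x).
rewrite /ball_/= sub0r normrN linear0 sub0r normrN linearZ/= !nrmE !nrmZ !nrm_real.
rewrite !(gtr0_norm c0) (_ : 1 = 1%:C%C :> R[i])// !ltcR divfK ?gt_eqF//.
have d2 : d / 2 < d by lra.
move=> /(_ d2) h; rewrite -ler_pdivrMl ?divr_gt0// invf_div.
rewrite -(ler_pM2r (_ : 0 < (nrm x)^-1)) ?invr_gt0// mulfV ?gt_eqF//.
by rewrite mulrAC ltW.
Unshelve. all: by end_near. Qed.

(** M >= 1 is included so that M can be divided by even on the zero space. *)
Definition power_bound T (M : R) := 1 <= M /\ forall m x, nrm (iter m T x) <= M * nrm x.

Lemma iter_scalable T m : scalable (iter m T).
Proof. by move=> a x; elim: m => //= m ->; rewrite linearZ. Qed.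

Lemma iter_linD T m x y : iter m T (x + y) = iter m T x + iter m T y.
Proof. by elim: m => //= m ->; rewrite linearD. Qed.

Lemma iter_linB T m x y : iter m T (x - y) = iter m T x - iter m T y.
Proof. by elim: m => //= m ->; rewrite linearB. Qed.

Lemma power_constant_ge0 T : (0 <= power_constant T)%E.
Proof.
by apply: le_trans (opnorm_ge0 (iter 0 T)) _; apply: ereal_sup_ubound; exists 0%N.
Qed.

Lemma power_bounded_bound T : power_bounded T -> exists M, power_bound T M.
Proof.
case=> _ /(ge0_lt_pinfty (power_constant_ge0 T))[M M0 eM].
exists (Num.max 1 M); split; first by rewrite le_max lexx.
move=> m x; have : (opnorm (iter m T) <= M%:E)%E.
  by rewrite -eM; apply: ereal_sup_ubound; exists m.
move/opnorm_bound => /(_ (@iter_scalable T m) x)/le_trans; apply.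
by apply: ler_wpM2r; [exact: nrm_ge0|rewrite le_max lexx orbT].
Qed.

Lemma power_bound_bounded T M : power_bound T M -> power_bounded T.
Proof.
case=> M1 h; split; first exact: (linear_continuous (h 1%N)).
apply: (@le_lt_trans _ _ M%:E); last by rewrite ltry.
apply: ge_ereal_sup => _ [m _ <-]; by apply: opnorm_le; [exact: le_trans ler01 M1|exact: h].
Qed.

(** A bounded-below surjection has a bounded inverse: the inverse function is
automatically linear, and its norm is controlled by the lower bound. *)
Lemma inverse_of_lower A c : linear A -> 0 < c ->
  (forall x, c * nrm x <= nrm (A x)) -> (forall y, exists x, A x = y) ->
  exists2 S, bounded_inverse A S & forall y, nrm (S y) <= c^-1 * nrm y.
Proof.
move=> lA c0 hc sA.
have AB x y : A (x - y) = A x - A y.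
  by rewrite -[x - y]addrC -scaleN1r lA scaleN1r addrC.
have injA x y : A x = A y -> x = y.
  move=> e; apply/subr0_eq/nrm_le0.
  by have := hc (x - y); rewrite AB e subrr nrm0 pmulr_rle0.
have [f fK] : exists f, forall y, A (f y) = y.
  by have [f hf] := choice sA; exists f.
have lf : linear f.
  by move=> a x y; apply: injA; rewrite lA !fK.
pose mf := GRing.isLinear.Build _ _ _ _ f lf.
pose S : {linear X -> X} := HB.pack f mf.
have hS y : nrm (S y) <= c^-1 * nrm y.
  by rewrite -ler_pdivrMl ?invr_gt0// invrK -{2}(fK y) hc.
exists S => //; split; first exact: linear_continuous hS.
- by move=> x; apply: injA; rewrite fK.
- by move=> x; exact: fK.
Qed.

(** Invertibility without a chosen inverse; this form is stable under scaling,
composition and compactness arguments. *)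
Definition boundedly_invertible (A : X -> X) : Prop :=
  (exists2 c : R, 0 < c & forall x, c * nrm x <= nrm (A x)) /\ (forall y, exists x, A x = y).

Lemma boundedly_invertible_of_inverse (A : X -> X) S : bounded_inverse A S -> boundedly_invertible A.
Proof.
case=> cS SK KS; split; last by move=> y; exists (S y); rewrite KS.
have [C C0 hC] := continuous_linear_bound cS.
exists C^-1; first by rewrite invr_gt0.
by move=> x; rewrite ler_pdivrMl// -{1}(SK x) hC.
Qed.

Lemma pencil_linear l A : linear A -> linear (pencil l A).
Proof.
move=> lA a x y; rewrite /pencil lA scalerDr scalerBr !scalerA opprD addrACA.
by rewrite [l * a]mulrC.
Qed.

Lemma invnorm_le A S C : 0 <= C -> bounded_inverse A S ->
  (forall y, nrm (S y) <= C * nrm y) -> (invnorm A <= C%:E)%E.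
Proof.
move=> C0 hS h; apply: (le_trans _ (opnorm_le C0 h)).
by apply: ereal_inf_lbound; exists S.
Qed.

Lemma invnorm_lower A (C : R) : (invnorm A < C%:E)%E ->
  forall x, nrm x <= C * nrm (A x).
Proof.
move=> /ereal_inf_lt [_ [S [_ SA _] <-]] hC x.
have := @opnorm_bound S C (fun a u => linearZ_LR S a u) (ltW hC) (A x).
by rewrite SA.
Qed.

End Operators.

(** * Propagation of approximate eigenvalues to powers *)

Section Resolvent.
Context {R : realType} {X : completeNormedModType R[i]}.
Implicit Types (A : X -> X) (T S : {linear X -> X}).

Lemma cauchy_seq_limit (u : nat -> X) :
  (forall e : R, 0 < e -> exists N, forall n m, (N <= n)%N -> (N <= m)%N -> nrm (u n - u m) < e) ->
  exists l, forall e : R, 0 < e -> exists N, forall n, (N <= n)%N -> nrm (u n - l) < e.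
Proof.
move=> h; have : cvg (u @ \oo).
  apply/cauchy_cvgP/cauchy_exP => _ /pos_complexP[e e0 ->].
  have [N hN] := h _ e0; exists (u N); exists N => // n /= Nn.
  by rewrite -ball_normE/= nrmE ltcR hN.
move=> /cvgrPdist_lt hl; exists (lim (u @ \oo)) => e e0.
have [|N _ hN] := hl (e%:C)%C _; first by rewrite ltcR.
by exists N => n /hN/=; rewrite nrmE ltcR nrmBC.
Qed.

(** l^(n+1) - T^(n+1) = l (l^n - T^n) + T^n (l - T). *)
Lemma power_defect_step T M l x n : power_bound T M ->
  nrm (l ^+ n.+1 *: x - iter n.+1 T x) <=
  nrm l * nrm (l ^+ n *: x - iter n T x) + M * nrm (l *: x - T x).
Proof.
case=> _ hM; have -> : l ^+ n.+1 *: x - iter n.+1 T x =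
    l *: (l ^+ n *: x - iter n T x) + iter n T (l *: x - T x).
  rewrite scalerBr scalerA -exprS iter_linB iter_scalable -iterSr.
  by rewrite addrA subrK.
apply: le_trans (nrmD _ _) _; rewrite nrmZ lerD2l; exact: hM.
Qed.

(** The recursion for the defect, solved crudely; on the unit circle the bound is
n M times the defect of l. *)
Lemma power_defect T M l x n : power_bound T M -> 1 <= nrm l ->
  nrm (l ^+ n *: x - iter n T x) <= n%:R * nrm l ^+ n * M * nrm (l *: x - T x).
Proof.
move=> hT l1; have M0 : 0 <= M by apply: le_trans ler01 hT.1.
elim: n => [|n IH]; first by rewrite expr0 scale1r subrr nrm0 !mul0r.
apply: le_trans (power_defect_step _ _ _ hT) _.
set e := nrm (l *: x - T x) in IH *; set d := nrm (_ - _) in IH *.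
have e0 : 0 <= e by exact: nrm_ge0.
set a := nrm l in l1 IH *.
have a1 : 1 <= a ^+ n.+1 by exact: exprn_ege1.
have h1 : a * d <= n%:R * a ^+ n.+1 * M * e.
  have -> : n%:R * a ^+ n.+1 * M * e = a * (n%:R * a ^+ n * M * e) by rewrite exprS; ring.
  by apply: ler_wpM2l => //; apply: le_trans l1.
have h2 : M * e <= a ^+ n.+1 * (M * e) by rewrite ler_peMl// mulr_ge0.
rewrite -natr1; lra.
Qed.

(** The same recursion summed as a geometric series, for |l| > 1. *)
Lemma power_defect_geom T M l x n : power_bound T M -> 1 <= nrm l ->
  (nrm l - 1) * nrm (l ^+ n *: x - iter n T x) <= (nrm l ^+ n - 1) * (M * nrm (l *: x - T x)).
Proof.
move=> hT l1; have M0 : 0 <= M by apply: le_trans ler01 hT.1.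
elim: n => [|n IH]; first by rewrite !expr0 scale1r !subrr nrm0 mulr0 mul0r.
have := power_defect_step l x n hT.
set e := M * nrm (l *: x - T x) in IH *; set d := nrm (_ - _) in IH *; set d' := nrm (_ - _).
set a := nrm l in l1 IH *.
have e0 : 0 <= e by rewrite mulr_ge0// nrm_ge0.
rewrite exprS => hd; have : (a - 1) * d' <= (a - 1) * (a * d + e).
  by apply: ler_wpM2l => //; rewrite subr_ge0.
have : a * ((a - 1) * d) <= a * ((a ^+ n - 1) * e) by apply: ler_wpM2l => //; apply: le_trans l1.
nra.
Qed.

Lemma bernoulli_pow (a : R) n : 1 <= a -> n%:R * (a - 1) <= a ^+ n.
Proof.
move=> a1; elim: n => [|n IH]; first by rewrite mul0r expr0 ler01.
have a2 : 1 <= a ^+ n by exact: exprn_ege1.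
rewrite exprS -natr1; nra.
Qed.

Lemma arch_le0 (d C : R) : (forall n : nat, n%:R * d <= C) -> d <= 0.
Proof.
move=> h; rewrite leNgt; apply/negP => d0.
have := h (Num.truncn (C / d)).+1; rewrite leNgt; apply/negP/negPn.
by rewrite -ltr_pdivrMr// truncnS_gt.
Qed.

(** In |l|^n ‖x‖ <= ‖T^n x‖ + ‖(l^n - T^n)x‖ the first term on the right stays
bounded while |l|^n grows. *)
Lemma resolvent_lower T M l x : power_bound T M -> 1 < nrm l ->
  (nrm l - 1) * nrm x <= M * nrm (l *: x - T x).
Proof.
move=> hT l1; rewrite -subr_le0.
set d := _ - _; set a := nrm l in l1 d *.
have a1 : 0 < a - 1 by rewrite subr_gt0.
suff : (a - 1) * d <= 0 by rewrite pmulr_rle0.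
have e0 : 0 <= M * nrm (l *: x - T x) by rewrite mulr_ge0// ?nrm_ge0//; apply: le_trans ler01 hT.1.
have M0 : 0 <= M by apply: le_trans ler01 hT.1.
have MX : 0 <= (a - 1) * (M * nrm x) by rewrite mulr_ge0 ?(ltW a1)// mulr_ge0// nrm_ge0.
case: (leP d 0) => d0; first by rewrite pmulr_rle0.
apply: (@arch_le0 _ ((a - 1) * (M * nrm x))) => n; rewrite mulrA.
apply: (@le_trans _ _ (a ^+ n * d)).
  by apply: ler_wpM2r; [exact: ltW|apply: bernoulli_pow; exact: ltW].
have := power_defect_geom x n hT (ltW l1); rewrite -/a => h1.
have h2 : (a - 1) * (a ^+ n * nrm x - M * nrm x) <= (a - 1) * nrm (l ^+ n *: x - iter n T x).
  apply: ler_wpM2l; first exact: ltW.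
  rewrite -nrmX -nrmZ; apply: le_trans (nrm_lerB _ _); rewrite lerD2l lerN2; exact: hT.2.
by rewrite /d; nra.
Qed.

(** The range of a bounded-below operator is closed: the preimages of an
approximating sequence form a Cauchy sequence. *)
Lemma surj_of_dense A c C y (u : nat -> X) : linear A -> 0 < c ->
  (forall x, c * nrm x <= nrm (A x)) -> (forall x, nrm (A x) <= C * nrm x) ->
  (forall e : R, 0 < e -> exists N, forall n, (N <= n)%N -> nrm (A (u n) - y) < e) ->
  exists x, A x = y.
Proof.
move=> lA c0 hc hC hu.
have AB x z : A (x - z) = A x - A z.
  by rewrite -[x - z]addrC -scaleN1r lA scaleN1r addrC.
have [|v hv] := @cauchy_seq_limit u.
  move=> e e0; have [|N hN] := hu (c * e / 2); first by rewrite divr_gt0// mulr_gt0.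
  exists N => n m Nn Nm; rewrite -(ltr_pM2l c0); apply: le_lt_trans (hc _) _.
  rewrite AB; have -> : A (u n) - A (u m) = (A (u n) - y) - (A (u m) - y).
    by rewrite opprB addrA subrK.
  apply: le_lt_trans (nrmB _ _) _; have := hN _ Nn; have := hN _ Nm; lra.
exists v; apply/subr0_eq/nrm_le0.
apply/ler_addgt0Pr => e e0; rewrite add0r.
have [|N hN] := hu (e / 2); first by rewrite divr_gt0.
have C1 : 0 < `|C| + 1 by rewrite ltr_wpDl.
have [|N' hN'] := hv (e / 2 / (`|C| + 1)); first by rewrite !divr_gt0.
have := hN _ (leq_maxl N N'); have := hN' _ (leq_maxr N N'); set n := maxn N N'.
rewrite ltr_pdivlMr// => h1 h2.
have -> : A v - y = A (u n) - y - A (u n - v) by rewrite AB opprB addrCA [A (u n) - y]addrC addrK.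
apply: le_trans (nrmB _ _) _.
have := hC (u n - v); have : C <= `|C| by exact: ler_norm.
have := nrm_ge0 (u n - v); nra.
Qed.

End Resolvent.

(** * The Ritt condition as a family of lower bounds *)

Section RittCriteria.
Context {R : realType} {X : completeNormedModType R[i]}.
Implicit Types (A : X -> X) (T S : {linear X -> X}).

Lemma pencil_op_linear l T : linear (pencil l T).
Proof. by apply: pencil_linear => a x y; rewrite linearP. Qed.

Lemma power_bound1 T M x : power_bound T M -> nrm (T x) <= M * nrm x.
Proof. by case=> _ /(_ 1%N x). Qed.

(** Surjectivity comes from iterating u := l^-1 (y + T u), the partial sums of the
Neumann series; the residual of the n-th iterate is l^-n T^n y. The lower
bound for l - T makes the iterates converge, so no norm of the series has to
be summed. *)
Lemma resolvent_exists T M l : power_bound T M -> 1 < nrm l ->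
  exists2 S, bounded_inverse (pencil l T) S &
    forall y, nrm (S y) <= ((nrm l - 1) / M)^-1 * nrm y.
Proof.
move=> hT l1.
have M0 : 0 < M by apply: lt_le_trans ltr01 hT.1.
have a1 : 0 < nrm l - 1 by rewrite subr_gt0.
have lM : 0 < (nrm l - 1) / M by rewrite divr_gt0.
have hc x : (nrm l - 1) / M * nrm x <= nrm (pencil l T x).
  by rewrite mulrAC ler_pdivrMr// [leRHS]mulrC (resolvent_lower _ hT).
suff sA y : exists x, pencil l T x = y by exact: (inverse_of_lower (pencil_op_linear l T) lM hc sA).
have l0 : l != 0.
  by apply/negP => /eqP e; move: l1; rewrite e nrm0 ltNge ler01.
pose u := fix u n : X := if n is k.+1 then l^-1 *: (y + T (u k)) else 0.
have hu n : pencil l T (u n) - y = - (l ^- n *: iter n T y).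
  elim: n => [|n IH]; first by rewrite /pencil/= scaler0 linear0 subr0 expr0 invr1 scale1r sub0r.
  have -> : pencil l T (u n.+1) - y = l^-1 *: T (pencil l T (u n) - y).
    have eu : l *: u n.+1 = y + T (u n) by rewrite /= scalerA divff// scale1r.
    rewrite -linearZ_LR /pencil eu addrAC [y + _]addrC addrK -raddfB; congr (T _).
    apply: (scalerI l0); rewrite scalerBr eu scalerA divff// scale1r.
    by rewrite opprD addrA addrAC.
  by rewrite IH linearN linearZ/= scalerN scalerA -invfM -exprS.
apply: (surj_of_dense (pencil_op_linear l T) lM hc (C := nrm l + M) (u := u)).
  by move=> x; apply: le_trans (nrmB _ _) _; rewrite nrmZ mulrDl lerD2l; exact: power_bound1.
move=> e e0; pose N := (Num.truncn (M * nrm y / e / (nrm l - 1))).+1.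
exists N => n Nn; rewrite hu nrmN nrmZ nrmV nrmX mulrC.
have an : 0 < nrm l ^+ n by rewrite exprn_gt0// (lt_trans ltr01).
rewrite ltr_pdivrMr//; apply: le_lt_trans (hT.2 n y) _; rewrite -ltr_pdivrMl// mulrC.
apply: lt_le_trans (bernoulli_pow n (ltW l1)); rewrite -ltr_pdivrMr//.
by apply: lt_le_trans (truncnS_gt _) _; rewrite ler_nat.
Qed.

Lemma power_bound_continuous T M : power_bound T M -> continuous T.
Proof. by move=> hT; apply: (@linear_continuous _ _ _ M) => x; exact: power_bound1. Qed.

(** Outside the closed disc the inverse exists for every power bounded operator,
so only its norm is at stake. *)
Lemma ritt_of_lower_out T M c : power_bound T M -> 0 < c ->
  (forall (l : R[i]) x, 1 < nrm l -> c * nrm (l - 1) * nrm x <= nrm (l *: x - T x)) ->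
  ritt T.
Proof.
move=> hT c0 hc; split; first exact: power_bound_continuous hT.
  move=> l /= nS; rewrite /closed_disc/= nrm_le1 leNgt; apply/negP => l1; apply: nS.
  by have [S hS _] := resolvent_exists hT l1; exists S.
apply: (@le_lt_trans _ _ (c^-1)%:E); last by rewrite ltry.
apply: ge_ereal_sup => _ [l /= l1 <-].
rewrite nrm_gt1 in l1.
have [S hS _] := resolvent_exists hT l1.
rewrite -/(nrm (l - 1)).
have d0 : 0 < nrm (l - 1).
  by rewrite nrm_gt0 subr_eq0; apply: contraTneq l1 => ->; rewrite nrm1 ltxx.
have cd0 : 0 < c * nrm (l - 1) by rewrite mulr_gt0.
apply: (@le_trans _ _ ((nrm (l - 1))%:E * ((c * nrm (l - 1))^-1)%:E)%E).
  apply: lee_wpmul2l; first by rewrite lee_fin ltW.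
  apply: (invnorm_le _ hS); first by rewrite invr_ge0 ltW.
  move=> y; rewrite -ler_pdivrMl ?invr_gt0// invrK.
  by have := hc l (S y) l1; case: hS => _ _ /(_ y); rewrite /pencil => ->.
by rewrite -EFinM lee_fin invfM mulrCA divff ?mulr1 ?gt_eqF.
Qed.

Lemma ritt_lower T : ritt T -> exists2 K : R, 0 < K &
  forall (l : R[i]) x, 1 < nrm l -> nrm (l - 1) * nrm x <= K * nrm (l *: x - T x).
Proof.
case=> _ _ /lt_pinfty_bound[K K0 hK].
exists K => // l x l1.
have d0 : 0 < nrm (l - 1).
  by rewrite nrm_gt0 subr_eq0; apply: contraTneq l1 => ->; rewrite nrm1 ltxx.
have hl : ((nrm (l - 1))%:E * invnorm (pencil l T) < K%:E)%E.
  apply: le_lt_trans hK; apply: ereal_sup_ubound; exists l => //=.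
  by rewrite nrm_gt1.
have hi : (invnorm (pencil l T) < (K / nrm (l - 1))%:E)%E.
  by rewrite mulrC EFinM lte_pdivlMl.
by have := invnorm_lower hi x; rewrite /pencil mulrAC ler_pdivlMr// mulrC.
Qed.

End RittCriteria.

Section CircleCriterion.
Context {R : realType} {X : completeNormedModType R[i]}.
Implicit Types (T S : {linear X -> X}).

(** For l = |l| e^{it} put e = ‖(l - T)x‖. Power boundedness controls |l| - 1 by M
e, so passing to the point e^{it} of the circle costs a multiple of e only. *)
Lemma ritt_of_circle T M c : power_bound T M -> 0 < c ->
  (forall (t : R) x, `|t| <= pi -> c * `|t| * nrm x <= nrm (expi t *: x - T x)) ->
  ritt T.
Proof.
move=> hT c0 hc; have M1 := hT.1; have M0 : 0 < M by apply: lt_le_trans ltr01 M1.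
pose K := M + (1 + M) / c.
have K0 : 0 < K by rewrite addr_gt0// divr_gt0// addr_gt0.
apply: (ritt_of_lower_out hT (c := K^-1)); first by rewrite invr_gt0.
move=> l x l1; have [t tpi lE] := polar l.
set e := nrm (l *: x - T x).
have h1 := resolvent_lower x hT l1; rewrite -/e in h1.
have lt : nrm (l - expi t) = nrm l - 1.
  rewrite {1}lE -{2}[expi t]mul1r -mulrBl nrmM nrm_expi mulr1.
  by rewrite -(rmorphB (real_complex R) _ 1) nrm_real ger0_norm// subr_ge0 ltW.
have h2 : nrm (expi t *: x - T x) <= (nrm l - 1) * nrm x + e.
  have -> : expi t *: x - T x = (expi t - l) *: x + (l *: x - T x).
    by rewrite scalerBl addrA subrK.
  by apply: le_trans (nrmD _ _) _; rewrite nrmZ nrmBC lt.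
have h3 := hc t x tpi.
have h4 : nrm (l - 1) <= nrm l - 1 + `|t|.
  have -> : l - 1 = (l - expi t) + (expi t - 1) by rewrite addrA subrK.
  apply: le_trans (nrmD _ _) _; rewrite lt lerD2l; exact: expi_dist1.
have x0 := nrm_ge0 x.
rewrite -mulrA ler_pdivrMl//.
have h5 : `|t| * nrm x <= (1 + M) * e / c by rewrite ler_pdivlMr//; lra.
apply: (@le_trans _ _ ((nrm l - 1 + `|t|) * nrm x)); first exact: ler_wpM2r.
rewrite mulrDl [K * e]mulrDl; apply: lerD => //.
by rewrite mulrAC.
Qed.

(** T^n (T - 1)x is (l - 1) T^n x up to M ‖(l - T)x‖, while ‖T^n x‖ is not much
smaller than ‖x‖ for n up to 1 / ‖(l - T)x‖. Choosing n of order 1 / |l - 1|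
makes the hypothesis on T^(n+1) - T^n small compared with |l - 1|. *)
Lemma ritt_of_diff T M C : power_bound T M -> 0 <= C ->
  (forall m x, (m.+1)%:R * nrm (iter m.+1 T x - iter m T x) <= C * nrm x) ->
  ritt T.
Proof.
move=> hT C0 hC; have M1 := hT.1; have M0 : 0 < M by apply: lt_le_trans ltr01 M1.
pose K := 2 * M * (2 * C + 1).
have K0 : 0 < K by rewrite mulr_gt0// ?mulr_gt0// ltr_wpDl// mulr_ge0.
apply: (ritt_of_lower_out hT (c := K^-1)); first by rewrite invr_gt0.
move=> l x l1; rewrite -mulrA ler_pdivrMl//.
set e := nrm (l *: x - T x).
have e0 : 0 <= e by exact: nrm_ge0.
have d0 : 0 < nrm (l - 1).
  by rewrite nrm_gt0 subr_eq0; apply: contraTneq l1 => ->; rewrite nrm1 ltxx.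
set d := nrm (l - 1) in d0 *.
(* n is of order C / |l - 1|: large enough to make C / (n + 1) at most half of
   |l - 1|, and small enough to keep T^n x comparable to x. *)
pose n := Num.truncn (2 * C / d).
have /andP[n1 n2] : n%:R <= 2 * C / d < n.+1%:R.
  by apply: truncn_itv; rewrite divr_ge0// ?mulr_ge0// ltW.
rewrite ler_pdivlMr// in n1; rewrite ltr_pdivrMr// in n2.
have x0 := nrm_ge0 x.
have a1 : 1 <= nrm l ^+ n by apply: exprn_ege1; exact: ltW.
have h1 : nrm x - n%:R * M * e <= nrm (iter n T x).
  have := power_defect x n hT (ltW l1); rewrite -/e.
  have := nrm_lerB (l ^+ n *: x) (l ^+ n *: x - iter n T x).
  rewrite subKr nrmZ nrmX => h2 h3.
  case: (leP (nrm x - n%:R * M * e) 0) => hp; first exact: le_trans hp (nrm_ge0 _).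
  apply: (@le_trans _ _ (nrm l ^+ n * (nrm x - n%:R * M * e))); first by rewrite ler_peMl// ltW.
  by nra.
have h2 : d * nrm (iter n T x) <= nrm (iter n.+1 T x - iter n T x) + M * e.
  rewrite -nrmZ.
  have -> : (l - 1) *: iter n T x = (iter n.+1 T x - iter n T x) + iter n T (l *: x - T x).
    rewrite iter_linB iter_scalable -iterSr scalerBl scale1r.
    by rewrite [RHS]addrC addrA subrK.
  apply: le_trans (nrmD _ _) _; rewrite lerD2l; exact: hT.2.
have h3 := hC n x; have n3 : 0 < n.+1%:R :> R by rewrite ltr0n.
have h4 : 2 * nrm (iter n.+1 T x - iter n T x) <= d * nrm x.
  rewrite -(ler_pM2l n3); have := nrm_ge0 (iter n.+1 T x - iter n T x); nra.
have h5 : d * (nrm x - n%:R * M * e) <= d * nrm (iter n T x) by apply: ler_wpM2l => //; exact: ltW.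
have h6 : n%:R * d * (M * e) <= 2 * C * (M * e) by apply: ler_wpM2r => //; rewrite mulr_ge0// ltW.
rewrite /K; nra.
Qed.

(** The best lower bound of F t is a Lipschitz function of t, since a perturbation
of an operator changes its lower bound by at most the norm of the
perturbation; a positive continuous function on a segment has a positive
minimum. The index i makes the lemma applicable twice, to cover a disc in
polar coordinates. *)
Lemma uniform_lower (I : Type) (F : R -> I -> X -> X) K a b : a <= b -> 0 <= K ->
  (forall s t i x, nrm (F s i x - F t i x) <= K * `|s - t| * nrm x) ->
  (forall t, a <= t <= b -> exists2 c, 0 < c & forall i x, c * nrm x <= nrm (F t i x)) ->
  exists2 c, 0 < c & forall t i x, a <= t <= b -> c * nrm x <= nrm (F t i x).
Proof.
move=> ab K0 hK hF.
pose E t := [set c : R | 0 <= c <= 1 /\ forall i x, c * nrm x <= nrm (F t i x)].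
have E0 t : E t 0 by split; rewrite ?lexx ?ler01// => i x; rewrite mul0r nrm_ge0.
have Es t : has_sup (E t) by split; [exists 0|exists 1 => c [/andP[]]].
pose low t := sup (E t).
have low_in t : E t (low t).
  split.
    apply/andP; split; first exact: (ub_le_sup (Es t).2 (E0 t)).
    by apply: ge_sup; [exists 0|move=> c [/andP[]]].
  move=> i x; case: (leP (nrm x) 0) => x0.
    have -> : nrm x = 0 by apply/le_anti; rewrite x0 nrm_ge0.
    by rewrite mulr0 nrm_ge0.
  rewrite -ler_pdivlMr//; apply: ge_sup; first by exists 0.
  by move=> c [_ /(_ i x)]; rewrite ler_pdivlMr.
have low_lip s t : low s - K * `|s - t| <= low t.
  case: (leP (low s - K * `|s - t|) 0) => h0; first by apply: le_trans h0 _; have [/andP[]] := low_in t.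
  have [/andP[ls0 ls1] hs] := low_in s.
  apply: (ub_le_sup (Es t).2); split.
    by rewrite (ltW h0)/= lerBlDr; apply: le_trans ls1 _; rewrite lerDl mulr_ge0.
  move=> i x; rewrite mulrBl lerBlDr; apply: le_trans (hs i x) _.
  rewrite -{1}(subrK (F t i x) (F s i x)) addrC; apply: le_trans (nrmD _ _) _.
  by rewrite lerD2l.
have low_cont : continuous low.
  move=> s; apply/cvgrPdist_lt => e e0; near=> t.
  have K1 : 0 < K + 1 by rewrite ltr_wpDl.
  apply: (@le_lt_trans _ _ ((K + 1) * `|s - t|)).
    have := low_lip s t; have := low_lip t s; rewrite [`|t - s|]distrC => h1 h2.
    have := normr_ge0 (s - t); rewrite ler_norml; move: h1 h2; nra.
  rewrite -ltr_pdivlMl// mulrC.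
  near: t; apply: (@cvgr_dist_lt _ _ _ (nbhs s) _ id s) => //.
  by rewrite divr_gt0// ltr_wpDl.
have [c cab hc] := EVT_min ab (continuous_subspaceT low_cont).
rewrite in_itv/= in cab; have [k k0 hk] := hF c cab.
exists (low c); last first.
  move=> t i x tab; have [_ ht] := low_in t; apply: le_trans (ht i x).
  by apply: ler_wpM2r; [exact: nrm_ge0|apply: hc; rewrite in_itv].
apply: (@lt_le_trans _ _ (Num.min k 1)); first by rewrite lt_min k0 ltr01.
apply: (ub_le_sup (Es c).2); split.
  by rewrite le_min (ltW k0) ler01 ge_min lexx orbT.
move=> i x; apply: le_trans (hk i x); apply: ler_wpM2r; first exact: nrm_ge0.
by rewrite ge_min lexx.
Unshelve. all: by end_near. Qed.

Lemma lower_bound_off_spectrum T l : ~ spectrum T l ->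
  exists2 c, 0 < c & forall x, c * nrm x <= nrm (l *: x - T x).
Proof.
by move=> /contrapT [S hS]; have [] := boundedly_invertible_of_inverse hS.
Qed.

(** The two halves of the circle are indexed by a boolean. *)
Lemma away_from_one T d : 0 < d -> spectrum T `&` circle `<=` [set 1] ->
  exists2 c, 0 < c & forall t x, d <= `|t| <= pi -> c * nrm x <= nrm (expi t *: x - T x).
Proof.
move=> d0 hT; case: (leP d pi) => dpi; last first.
  exists 1 => // t x /andP[h1 h2]; have := lt_le_trans dpi (le_trans h1 h2).
  by rewrite ltxx.
pose F t (s : bool) x : X := expi (if s then t else - t) *: x - T x.
have [||t /andP[dt tpi]|c c0 hc] := @uniform_lower bool F 1 d pi dpi.
- exact: ler01.
- move=> s t i x; rewrite /F opprB addrA subrK -scalerBl nrmZ mul1r.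
  apply: ler_wpM2r; first exact: nrm_ge0.
  case: i; first exact: expi_lip.
  by apply: le_trans (expi_lip _ _) _; rewrite -opprB opprK addrC opprB distrC.
- have ns (u : R) : `|u| = t -> ~ spectrum T (expi u).
    move=> ut hu; have : expi u = 1.
      by apply: hT; split => //; rewrite /circle/= nrmE nrm_expi.
    move/(congr1 (@complex.Re R)) => /=; rewrite -cos_norm ut -[RHS]cos0 => /cos_inj e.
    suff : t = 0 by move=> t0; move: dt; rewrite t0 leNgt d0.
    by apply: e; rewrite in_itv/= ?lexx ?pi_ge0 ?tpi ?(le_trans (ltW d0) dt).
  have t0 : 0 <= t by exact: le_trans (ltW d0) dt.
  have [c1 c10 h1] := lower_bound_off_spectrum (ns t (ger0_norm t0)).
  have [|c2 c20 h2] := lower_bound_off_spectrum (ns (- t) _); first by rewrite normrN ger0_norm.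
  exists (Num.min c1 c2); first by rewrite lt_min c10.
  by case=> x; [apply: le_trans (h1 x)|apply: le_trans (h2 x)];
    apply: ler_wpM2r; rewrite ?nrm_ge0// ge_min lexx ?orbT.
exists c => // t x ht; case: (leP 0 t) => t0.
  by have := hc `|t| true x ht; rewrite /F ger0_norm.
by have := hc `|t| false x ht; rewrite /F ltr0_norm// opprK.
Qed.

End CircleCriterion.


(** * Sampling along a sequence of powers *)

Section SamplingCriterion.
Context {R : realType} {X : completeNormedModType R[i]}.
Implicit Types (T S : {linear X -> X}).
Variable n : nat -> nat.
Hypothesis n_pos : forall k, (0 < n k)%N.
Hypothesis n_incr : forall j k, (j < k)%N -> (n j < n k)%N.

Lemma sample_ge k : (k <= n k)%N.
Proof. by elim: k => // k IH; apply: leq_ltn_trans IH _; exact: n_incr. Qed.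

(** The first index at which n_k t reaches a: the previous one is still below a,
and one step multiplies by at most c. *)
Lemma arc_target (a c t : R) N : 0 < a -> 0 < t ->
  (forall k, (N <= k)%N -> (n k.+1)%:R <= c * (n k)%:R) ->
  (n N)%:R * t < a -> exists k, a <= (n k)%:R * t <= c * a.
Proof.
move=> a0 t0 hc hN.
have ex : exists k, a <= (n k)%:R * t.
  exists (Num.truncn (a / t)).+1; rewrite -ler_pdivrMr// ltW//.
  by apply: lt_le_trans (truncnS_gt _) _; rewrite ler_nat sample_ge.
case: (ex_minnP ex) => k hk kmin; exists k; rewrite hk/=.
case: k hk kmin => [|k] hk kmin.
  case: N hN {hc} => [|N] hN; first by move: (lt_le_trans hN hk); rewrite ltxx.
  have := lt_le_trans hN hk; rewrite ltr_pM2r// ltr_nat => h.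
  by have := n_incr (ltn0Sn N); rewrite ltnNge (ltnW h).
have kt : (n k)%:R * t < a by rewrite ltNge; apply/negP => /kmin; rewrite ltnn.
have Nk : (N <= k)%N.
  rewrite leqNgt; apply/negP => kN; have := lt_le_trans hN hk.
  rewrite ltr_pM2r// ltr_nat; rewrite leq_eqVlt in kN.
  case/orP: kN => [/eqP ->|/n_incr h]; first by rewrite ltnn.
  by rewrite ltnNge (ltnW h).
have c0 : 0 <= c.
  have : (0 : R) < (n k.+1)%:R by rewrite ltr0n.
  have : (0 : R) < (n k)%:R by rewrite ltr0n.
  have := hc k Nk; nra.
have := hc k Nk; nra.
Qed.

(** The sign s = +-1 selects the side of 1 from which the angle is taken. The
slack e is the excess of the ratios over c; the angle u is n_k t brought back
into [a, c a], at distance at most e a. *)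
Lemma local_lower T M (q a c e s : R) N : power_bound T M -> 0 < q -> 0 < a -> 0 <= e ->
  1 <= c -> `|s| = 1 ->
  (forall k u x, a <= u <= c * a -> q * nrm x <= nrm (expi (s * u) *: x - iter (n k) T x)) ->
  (forall k, (N <= k)%N -> (n k.+1)%:R <= (c + e) * (n k)%:R) -> e * a <= q / 2 ->
  forall t x, 0 < t -> (n N)%:R * t < a ->
    q / (2 * M * a * (c + e)) * t * nrm x <= nrm (expi (s * t) *: x - T x).
Proof.
move=> hT q0 a0 e0 c1 s1 hq hc ea t x t0 hN.
have M0 : 0 < M by apply: lt_le_trans ltr01 hT.1.
have [k /andP[k1 k2]] := arc_target a0 t0 hc hN.
pose u := Num.min ((n k)%:R * t) (c * a).
have uP : a <= u <= c * a.
  by rewrite le_min k1 ge_min lexx orbT /= andbT ler_peMl// ltW.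
have du : `|u - (n k)%:R * t| <= e * a.
  rewrite /u minEle; case: ifP => [_|/negbT]; first by rewrite subrr normr0 mulr_ge0// ltW.
  by rewrite -ltNge => h; rewrite ltr0_norm ?subr_lt0//; lra.
have := hq k u x uP.
set d := nrm (expi (s * t) *: x - T x) => h1.
have h2 : nrm (expi (s * u) *: x - iter (n k) T x) <= e * a * nrm x + (n k)%:R * M * d.
  have -> : expi (s * u) *: x - iter (n k) T x =
     (expi (s * u) - expi (s * t) ^+ n k) *: x + (expi (s * t) ^+ n k *: x - iter (n k) T x).
    by rewrite scalerBl addrA subrK.
  apply: le_trans (nrmD _ _) _; apply: lerD; last first.
    have := power_defect x (n k) hT (_ : 1 <= nrm (expi (s * t))).
    by rewrite nrm_expi expr1n mulr1; apply.
  rewrite nrmZ; apply: ler_wpM2r; first exact: nrm_ge0.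
  rewrite expiX; apply: le_trans (expi_lip _ _) _.
  by rewrite mulrCA -mulrBr normrM s1 mul1r.
have h3 : (n k)%:R * t * (M * d) <= (c + e) * a * (M * d).
  by apply: ler_wpM2r => //; rewrite mulr_ge0 ?nrm_ge0// ltW.
have x0 := nrm_ge0 x.
have h4 : q / 2 * nrm x <= (n k)%:R * M * d by nra.
have D0 : 0 < 2 * M * a * (c + e) by rewrite !mulr_gt0//; lra.
rewrite -mulrA mulrAC ler_pdivrMr//.
have : t * (q / 2 * nrm x) <= t * ((n k)%:R * M * d) by rewrite ler_pM2l.
lra.
Qed.

(** Lower bounds near 1 on both sides, linear in t, and a uniform one elsewhere,
combine to a linear bound on the whole circle. *)
Lemma ritt_glue T M (d c1 c2 c3 : R) : power_bound T M -> 0 < c1 -> 0 < c2 -> 0 < c3 ->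
  (forall t x, 0 < t < d -> c1 * t * nrm x <= nrm (expi t *: x - T x)) ->
  (forall t x, 0 < t < d -> c2 * t * nrm x <= nrm (expi (- t) *: x - T x)) ->
  (forall t x, d <= `|t| <= pi -> c3 * nrm x <= nrm (expi t *: x - T x)) ->
  ritt T.
Proof.
move=> hT c10 c20 c30 h1 h2 h3; have p0 := pi_gt0 R.
have c40 : 0 < c3 / pi by rewrite divr_gt0.
pose c := Num.min c1 (Num.min c2 (c3 / pi)).
have c0 : 0 < c by rewrite !lt_min c10 c20 c40.
have cc1 : c <= c1 by rewrite ge_min lexx.
have cc2 : c <= c2 by rewrite !ge_min lexx !orbT.
have cc3 : c <= c3 / pi by rewrite !ge_min lexx !orbT.
apply: (ritt_of_circle hT c0) => t x tpi.
have x0 := nrm_ge0 x; have t0 := normr_ge0 t.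
case: (ltP `|t| d) => td.
  case: (ltgtP t 0) => t1.
  - apply: (@le_trans _ _ (c2 * `|t| * nrm x)); first by rewrite !ler_wpM2r.
    by have := h2 `|t| x; rewrite td normr_gt0 lt_eqF//= ltr0_norm// opprK; apply.
  - apply: (@le_trans _ _ (c1 * `|t| * nrm x)); first by rewrite !ler_wpM2r.
    by have := h1 `|t| x; rewrite td normr_gt0 gt_eqF//= gtr0_norm//; apply.
  - by rewrite t1 normr0 mulr0 mul0r nrm_ge0.
apply: le_trans (h3 t x _); last by rewrite td.
apply: ler_wpM2r => //; apply: (@le_trans _ _ (c3 / pi * pi)); last by rewrite divfK// gt_eqF.
by apply: ler_pM => //; exact: ltW.
Qed.

Lemma sup_resolvent_lower T (G : set R[i]) : (sup_resolvent n G T < +oo)%E ->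
  exists2 q : R, 0 < q & forall k l x, G l -> q * nrm x <= nrm (l *: x - iter (n k) T x).
Proof.
move=> /lt_pinfty_bound[K K0 hK].
exists K^-1; first by rewrite invr_gt0.
move=> k l x Gl; rewrite ler_pdivrMl//.
apply: (@invnorm_lower _ _ (pencil l (iter (n k) T))).
by apply: le_lt_trans hK; apply: ereal_sup_ubound; exists (k, l).
Qed.

(** The arcs are described by angles going away from 1 in the two directions, so
that the case of an arc symmetric about the real axis (a1 = a2) and the case
of a single point of the circle (c = 1, a1 + a2 = 2 pi) are both covered. *)
Lemma ritt_of_sampled_arcs T (G : set R[i]) (c a1 a2 : R) : power_bounded T ->
  spectrum T `&` circle `<=` [set 1] -> (sup_resolvent n G T < +oo)%E ->
  1 <= c -> 0 < a1 -> 0 < a2 ->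
  (forall u, a1 <= u <= c * a1 -> G (expi u)) ->
  (forall u, a2 <= u <= c * a2 -> G (expi (- u))) ->
  (forall e : R, 0 < e -> exists N, forall k, (N <= k)%N -> (n k.+1)%:R <= (c + e) * (n k)%:R) ->
  ritt T.
Proof.
move=> /power_bounded_bound[M hT] sT hG c1 a10 a20 h1 h2 hc.
have M0 : 0 < M by apply: lt_le_trans ltr01 hT.1.
have [q q0 hq] := sup_resolvent_lower hG.
(* half of the lower bound q is sacrificed to the slack of the ratios *)
pose e := q / 2 / (a1 + a2).
have e0 : 0 < e by rewrite !divr_gt0// addr_gt0.
have ea : e * (a1 + a2) = q / 2 by rewrite /e divfK// gt_eqF// addr_gt0.
have [N hN] := hc e e0.
have nN : (0 : R) < (n N)%:R by rewrite ltr0n.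
pose d := Num.min a1 a2 / (n N)%:R.
have d0 : 0 < d by rewrite divr_gt0// lt_min a10.
have [c3 c30 h3] := away_from_one d0 sT.
have ce : 0 < c + e by rewrite addr_gt0// (lt_le_trans ltr01).
have ea1 : e * a1 <= q / 2 by nra.
have ea2 : e * a2 <= q / 2 by nra.
apply: (ritt_glue (d := d) (c1 := q / (2 * M * a1 * (c + e)))
  (c2 := q / (2 * M * a2 * (c + e))) (c3 := c3) hT) => //.
- by rewrite divr_gt0// !mulr_gt0.
- by rewrite divr_gt0// !mulr_gt0.
- move=> t x /andP[t0 td].
  have := local_lower (s := 1) hT q0 a10 (ltW e0) c1 (normr1 _) _ hN ea1 _ t0.
  rewrite mul1r; apply.
    by move=> k u y /h1 Gu; rewrite mul1r; exact: hq.
  move: td; rewrite ltr_pdivlMr// mulrC => td; apply: lt_le_trans td _.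
  by rewrite ge_min lexx.
- move=> t x /andP[t0 td].
  have := local_lower (s := -1) hT q0 a20 (ltW e0) c1 (normrN1 _) _ hN ea2 _ t0.
  rewrite mulN1r; apply.
    by move=> k u y /h2 Gu; rewrite mulN1r; exact: hq.
  move: td; rewrite ltr_pdivlMr// mulrC => td; apply: lt_le_trans td _.
  by rewrite ge_min lexx orbT.
Qed.

End SamplingCriterion.

Section SamplingTheorems.
Context {R : realType} {X : completeNormedModType R[i]}.
Implicit Types (T S : {linear X -> X}).
Variable n : nat -> nat.
Hypothesis n_pos : forall k, (0 < n k)%N.
Hypothesis n_incr : forall j k, (j < k)%N -> (n j < n k)%N.

Lemma seq_ratio_gt1 k : 1 < seq_ratio R n k.
Proof. by rewrite /seq_ratio ltr_pdivlMr ?ltr0n// mul1r ltr_nat n_incr. Qed.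

Lemma sup_ratio_ge0 : (0 <= sup_ratio R n)%E.
Proof.
apply: (@le_trans _ _ (seq_ratio R n 0)%:E); last by apply: ereal_sup_ubound; exists 0%N.
by rewrite lee_fin ltW// (lt_trans ltr01)// seq_ratio_gt1.
Qed.

Lemma seq_ratio_le k (c : R) : seq_ratio R n k <= c -> (n k.+1)%:R <= c * (n k)%:R.
Proof. by rewrite /seq_ratio ler_pdivrMr// ltr0n. Qed.

Lemma limsup_ratio_eventually (c : R) : (limsup_ratio R n <= c%:E)%E ->
  forall e : R, 0 < e -> exists N, forall k, (N <= k)%N -> seq_ratio R n k <= c + e.
Proof.
move=> hc e e0; have : (limsup_ratio R n < (c + e)%:E)%E.
  by apply: le_lt_trans hc _; rewrite lte_fin ltrDl.
move=> /ereal_inf_lt [_ [V [N _ hN] <-]] h; exists N => k Nk.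
rewrite -lee_fin; apply: le_trans (ltW h); apply: ereal_sup_ubound.
by exists k => //; apply: hN.
Qed.

Lemma arc_pos (c : R) : 1 <= c -> 0 < 2 * pi / (c + 1).
Proof. by move=> c1; rewrite divr_gt0 ?mulr_gt0 ?pi_gt0//; lra. Qed.

(** The arc is symmetric about the real axis: u -> 2 pi - u exchanges its end
angles a and c a. *)
Lemma ritt_of_arc_resolvent T (c : R) : (limsup_ratio R n <= c%:E)%E ->
  power_bounded T -> spectrum T `&` circle `<=` [set 1] ->
  (sup_resolvent n (unit_arc c) T < +oo)%E -> ritt T.
Proof.
move=> hc hT sT hG.
have hev := limsup_ratio_eventually hc.
have c1 : 1 <= c.
  apply/ler_addgt0Pr => e e0; have [N hN] := hev e e0.
  exact: le_trans (ltW (seq_ratio_gt1 N)) (hN _ (leqnn N)).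
have c2 : c + 1 != 0 by rewrite gt_eqF//; lra.
have a0 := arc_pos c1; set a := 2 * pi / (c + 1) in a0.
have ca : c * a = 2 * pi * c / (c + 1) by rewrite /a; field.
have a2 : a + c * a = 2 * pi by rewrite /a; field.
apply: (ritt_of_sampled_arcs n_pos n_incr hT sT hG c1 a0 a0).
- by move=> u hu; exists u => //; rewrite /= in_itv/= -ca.
- move=> u /andP[u1 u2]; exists (2 * pi - u); last exact: expi_sub2pi.
  by rewrite /= in_itv/= -ca -/a; apply/andP; split; lra.
- move=> e e0; have [N hN] := hev e e0; exists N => k /hN; exact: seq_ratio_le.
Qed.

Lemma ritt_of_point_resolvent T (z : R[i]) : seq_ratio R n @ \oo --> (1 : R) ->
  power_bounded T -> spectrum T `&` circle `<=` [set 1] ->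
  circle z -> z <> 1 -> (sup_resolvent n [set z] T < +oo)%E -> ritt T.
Proof.
move=> hc hT sT; rewrite /circle/= nrmE => z1 zn1 hG.
have {}z1 : nrm z = 1 by case: z1.
have [t tpi zt] := expi_nrm1_surj z1.
have p0 := pi_gt0 R.
have [a [a0 a2 za]] : exists a, [/\ 0 < a, a < 2 * pi & z = expi a].
  case: (ltgtP t 0) => t0.
  - exists (2 * pi + t); move: tpi; rewrite ler_norml => /andP[? ?].
    by split; [lra|lra|rewrite -[t]opprK expi_sub2pi opprK].
  - by exists t; move: tpi; rewrite ler_norml => /andP[? ?]; split => //; lra.
  - by case: zn1; rewrite zt t0 expi0.
have a20 : 0 < 2 * pi - a by lra.
apply: (ritt_of_sampled_arcs n_pos n_incr hT sT hG (lexx 1) a0 a20).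
- by move=> u; rewrite mul1r => /le_anti <-.
- by move=> u; rewrite mul1r => /le_anti <-; rewrite /= -expi_sub2pi subKr.
- move=> e e0; move/cvgrPdist_lt : hc => /(_ e e0) [N _ hN].
  exists N => k /hN/= h; apply: seq_ratio_le; move: h; rewrite distrC ltr_norml => /andP[_].
  by rewrite ltrBlDl => /ltW.
Qed.

Lemma sup_dist_bound T (q : R) : (sup_dist_id n T <= q%:E)%E ->
  forall k x, nrm (x - iter (n k) T x) <= q * nrm x.
Proof.
move=> h k; apply: (@opnorm_bound _ _ (fun x : X => x - iter (n k) T x)).
  by move=> a x; rewrite iter_scalable scalerBr.
by apply: le_trans h; apply: ereal_sup_ubound; exists k.
Qed.

Lemma sup_dist_lt T (q : R) : (sup_dist_id n T < q%:E)%E ->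
  exists2 r, r < q & (sup_dist_id n T <= r%:E)%E.
Proof.
case: (sup_dist_id n T) => [r|//|_]; first by rewrite lte_fin; exists r.
by exists (q - 1); rewrite ?leNye// ltrBlDr ltrDl.
Qed.

(** On the arc |1 - z| is at least 2 sin(pi / (c+1)), so T^{n_k} - z is bounded
below there without any assumption on the spectrum. As n_0 = 1 and the arc
contains all angles from a to pi, the first sample settles the angles away
from 0. *)
Lemma ritt_of_small_distance T (c : R) : n 0 = 1 ->
  (sup_ratio R n <= c%:E)%E -> power_bounded T ->
  (sup_dist_id n T < (2 * sin (pi / (c + 1)))%:E)%E -> ritt T.
Proof.
move=> n0 hc /power_bounded_bound[M hT] /sup_dist_lt[r rs /sup_dist_bound hr].
have M0 : 0 < M by apply: lt_le_trans ltr01 hT.1.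
have hk k : seq_ratio R n k <= c.
  by rewrite -lee_fin; apply: le_trans hc; apply: ereal_sup_ubound; exists k.
have c1 : 1 <= c by exact: le_trans (ltW (seq_ratio_gt1 0)) (hk 0%N).
have c2 : c + 1 != 0 by rewrite gt_eqF//; lra.
have a0 := arc_pos c1; set a := 2 * pi / (c + 1) in a0.
have a2 : a + c * a = 2 * pi by rewrite /a; field.
have aa : a = 2 * (pi / (c + 1)) by rewrite /a mulrA.
set b := pi / (c + 1) in rs aa.
have p0 := pi_gt0 R.
pose q := 2 * sin b - r.
have q0 : 0 < q by rewrite subr_gt0.
have far u : a <= u <= c * a -> 2 * sin b <= nrm (expi u - 1).
  move=> /andP[u1 u2]; rewrite chordE; last by apply/andP; split; lra.
  by rewrite ler_pM2l//; apply: sin_ge_mid; [lra|apply/andP; split; lra].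
have hq (l : R[i]) k x : 2 * sin b <= nrm (l - 1) ->
    q * nrm x <= nrm (l *: x - iter (n k) T x).
  move=> hl; have -> : l *: x - iter (n k) T x = (l - 1) *: x - (iter (n k) T x - x).
    by rewrite scalerBl scale1r opprB addrA subrK.
  apply: le_trans (nrm_lerB _ _); rewrite nrmZ [nrm (_ - x)]nrmBC /q mulrBl.
  by apply: lerB; [exact: ler_wpM2r (nrm_ge0 x) _ _ hl|exact: hr].
have hN k : (0 <= k)%N -> (n k.+1)%:R <= (c + 0) * (n k)%:R.
  by move=> _; rewrite addr0; apply: seq_ratio_le.
have e0 : 0 * a <= q / 2 by rewrite mul0r divr_ge0// ltW.
have c0 : 0 < q / (2 * M * a * (c + 0)).
  by rewrite addr0 divr_gt0// (mulr_gt0 (mulr_gt0 _ a0))// ?mulr_gt0//; apply: lt_le_trans c1.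
apply: (ritt_glue (d := a) hT c0 c0 q0).
- move=> t x /andP[t0 ta].
  have := local_lower n_pos n_incr (s := 1) hT q0 a0 (lexx 0) c1 (normr1 _) _ hN e0 x t0.
  rewrite mul1r n0 mul1r; apply => //.
  by move=> k u y /far hu; rewrite mul1r; exact: hq.
- move=> t x /andP[t0 ta].
  have := local_lower n_pos n_incr (s := -1) hT q0 a0 (lexx 0) c1 (normrN1 _) _ hN e0 x t0.
  rewrite mulN1r n0 mul1r; apply => //.
  by move=> k u y /far hu; rewrite mulN1r; apply: hq; rewrite chordN.
- move=> t x /andP[t1 t2]; have := hq (expi t) 0%N x; rewrite n0; apply.
  have h : a <= `|t| <= c * a.
    rewrite t1/=; have : 0 <= (c - 1) * a by rewrite mulr_ge0// ?subr_ge0// ltW.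
    by lra.
  by move/far: h; case: (leP 0 t) => t0; rewrite ?(ger0_norm t0)// ltr0_norm// chordN.
Qed.

Lemma sample_bracket m : n 0 = 1 -> (1 <= m)%N -> exists k, (n k <= m < n k.+1)%N.
Proof.
move=> n0; elim: m => // m IH _; case: m IH => [|m] IH.
  by exists 0%N; rewrite n0/= -[X in (X < _)%N]n0 n_incr.
have [//|k /andP[k1 k2]] := IH.
move: k2; rewrite leq_eqVlt => /predU1P[e|k2].
  by exists k.+1; rewrite e leqnn n_incr.
by exists k; rewrite (leq_trans k1)//= ltnW.
Qed.

Lemma ritt_diff_bound T m M : power_bound T M -> (ritt_diff T m <= (m%:R * (2 * M))%:E)%E.
Proof.
move=> hT; rewrite /ritt_diff EFinM; apply: lee_wpmul2l; first by rewrite lee_fin.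
have M0 : 0 <= M by apply: le_trans ler01 hT.1.
apply: opnorm_le; first by rewrite mulr_ge0.
move=> x; apply: le_trans (nrmB _ _) _.
by have := hT.2 m x; have := hT.2 m.-1 x; lra.
Qed.

(** The estimate is made term by term, so that the supremum on the right may be
infinite. *)
Lemma diff_sampling T (m : nat) : n 0 = 1 -> (sup_ratio R n < +oo)%E -> power_bounded T ->
  (1 <= m)%N ->
  (ritt_diff T m <= power_constant T * sup_ratio R n
           * ereal_sup [set ritt_diff T (n k) | k in [set: nat]])%E.
Proof.
move=> n0 hc hT m1; have [k /andP[k1 k2]] := sample_bracket n0 m1.
have [C C0 eC] := ge0_lt_pinfty (power_constant_ge0 T) hT.2.
have [c c0 ec] := ge0_lt_pinfty sup_ratio_ge0 hc.
apply: (@le_trans _ _ (power_constant T * sup_ratio R n * ritt_diff T (n k))%E); last first.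
  apply: lee_wpmul2l; first by rewrite mule_ge0 ?power_constant_ge0 ?sup_ratio_ge0.
  by apply: ereal_sup_ubound; exists k.
rewrite eC ec -EFinM /ritt_diff.
set D := opnorm (fun x : X => iter (n k) T x - iter (n k).-1 T x).
have [M hM] := power_bounded_bound hT.
have Dfin : (D < +oo)%E.
  have := ritt_diff_bound (n k) hM; rewrite /ritt_diff -/D muleC -lee_pdivlMr ?ltr0n// -EFinM.
  by move=> /le_lt_trans; apply; rewrite ltry.
have [d d0 ed] : exists2 d, 0 <= d & D = d%:E := ge0_lt_pinfty (opnorm_ge0 _) Dfin.
have hd x : nrm (iter (n k) T x - iter (n k).-1 T x) <= d * nrm x.
  apply: (@opnorm_bound _ _ (fun x : X => iter (n k) T x - iter (n k).-1 T x)).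
    by move=> a y; rewrite !iter_scalable scalerBr.
  by rewrite -/D ed.
have hC j x : nrm (iter j T x) <= C * nrm x.
  apply: (@opnorm_bound _ _ (iter j T)); first exact: iter_scalable.
  by rewrite -eC; apply: ereal_sup_ubound; exists j.
have mc : m%:R <= c * (n k)%:R.
  apply: (@le_trans _ _ (n k.+1)%:R); first by rewrite ler_nat ltnW.
  by apply: seq_ratio_le; rewrite -lee_fin -ec; apply: ereal_sup_ubound; exists k.
rewrite ed -!EFinM.
apply: (@le_trans _ _ (m%:R%:E * (C * d)%:E)%E).
  apply: lee_wpmul2l; first by rewrite lee_fin.
  apply: opnorm_le; first exact: mulr_ge0.
  move=> x; have -> : iter m T x - iter m.-1 T x =
      iter (m - n k) T (iter (n k) T x - iter (n k).-1 T x).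
    rewrite iter_linB -!iterD subnK//; congr (_ - iter _ _ _).
    by have := n_pos k; lia.
  by apply: le_trans (hC _ _) _; rewrite -mulrA; apply: ler_wpM2l.
rewrite -EFinM lee_fin mulrCA -!mulrA [c * _]mulrCA mulrA [leRHS]mulrA.
have Cd : 0 <= C * d by exact: mulr_ge0.
nra.
Qed.

Lemma ritt_of_sampled_diff T : n 0 = 1 -> (sup_ratio R n < +oo)%E -> power_bounded T ->
  (ereal_sup [set ritt_diff T (n k) | k in [set: nat]] < +oo)%E -> ritt T.
Proof.
move=> n0 hc hT; set s := ereal_sup _ => hs.
have s0 : (0 <= s)%E.
  apply: (@le_trans _ _ (ritt_diff T (n 0))); last by apply: ereal_sup_ubound; exists 0%N.
  by apply: mule_ge0; [rewrite lee_fin|exact: opnorm_ge0].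
have [d d0 ed] := ge0_lt_pinfty s0 hs.
have [C C0 eC] := ge0_lt_pinfty (power_constant_ge0 T) hT.2.
have [c c0 ec] := ge0_lt_pinfty sup_ratio_ge0 hc.
have [M hM] := power_bounded_bound hT.
have K0 : 0 <= C * c * d by rewrite !mulr_ge0.
apply: (ritt_of_diff hM K0) => m x.
have := @diff_sampling T m.+1 n0 hc hT (ltn0Sn m).
rewrite -/s eC ec ed -!EFinM /ritt_diff muleC -lee_pdivlMr ?ltr0n// -EFinM.
move=> /opnorm_bound => /(_ _ x) h; rewrite -ler_pdivlMl ?ltr0n// mulrA [_^-1 * _]mulrC.
by apply: h => a y; rewrite !iter_scalable scalerBr.
Qed.

End SamplingTheorems.

(** * Quasinilpotence when the powers stay close to the identity *)

Section EntireResolvent.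
Context {R : realType} {X : completeNormedModType R[i]}.
Implicit Types (T S N : {linear X -> X}).

Lemma subrBACA (W : zmodType) (a b c d : W) : a - b - (c - d) = a - c - (b - d).
Proof. by rewrite !opprB addrACA [RHS]addrACA [- b - c]addrC. Qed.

Lemma linear_pack (f : X -> X) : linear f -> exists S : {linear X -> X}, forall x, S x = f x.
Proof.
move=> lf; pose mf := GRing.isLinear.Build _ _ _ _ f lf.
by exists (HB.pack f mf : {linear X -> X}).
Qed.

Lemma boundedly_invertible_scale (A B : X -> X) (a : R[i]) : a != 0 -> (forall x, B x = a *: A x) ->
  boundedly_invertible A -> boundedly_invertible B.
Proof.
move=> a0 BA [[c c0 hc] sA]; have na0 : 0 < nrm a.
  by rewrite nrm_gt0.
split.
  exists (nrm a * c); first exact: mulr_gt0.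
  by move=> x; rewrite BA nrmZ -mulrA ler_pM2l.
by move=> y; have [x hx] := sA (a^-1 *: y); exists x; rewrite BA hx scalerA divff// scale1r.
Qed.

(** Neumann series, applied to the power bounded operator (1 - T)/p with q <= p <
1 at the point 1/p. *)
Lemma boundedly_invertible_near_id T (q : R) : q < 1 -> (forall x, nrm (x - T x) <= q * nrm x) ->
  boundedly_invertible T.
Proof.
move=> q1 hq; split.
  exists (1 - q); first by rewrite subr_gt0.
  move=> x; have := nrm_lerB x (x - T x); rewrite subKr; have := hq x; lra.
pose p := Num.max q (1 / 2).
have p1 : p < 1 by rewrite gt_max q1/=; lra.
have p0 : 0 < p by rewrite lt_max; apply/orP; right; lra.
have hp x : nrm (x - T x) <= p * nrm x.
  by apply: le_trans (hq x) _; rewrite ler_wpM2r ?nrm_ge0// le_max lexx.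
have [|B hB] := @linear_pack (fun x => (p^-1)%:C%C *: (x - T x)).
  move=> a x y; rewrite linearP/= scalerA mulrC -scalerA -scalerDr; congr (_ *: _).
  by rewrite scalerBr opprD addrACA.
have pB : power_bound B 1.
  split=> // m x; rewrite mul1r; elim: m => //= m IH; apply: le_trans IH.
  rewrite hB nrmZ nrm_real gtr0_norm ?invr_gt0// ler_pdivrMl//; exact: hp.
have pc0 : (p%:C)%C != 0 :> R[i] by rewrite eq_complex/= eqxx andbT gt_eqF.
have [|S [_ _ KS] _] := @resolvent_exists _ _ B 1 (p^-1)%:C%C pB.
  by rewrite nrm_real gtr0_norm ?invr_gt0// invf_gt1.
move=> y; exists (S ((p^-1)%:C%C *: y)).
have := KS ((p^-1)%:C%C *: y); rewrite /pencil hB -scalerBr subKr => /scalerI; apply.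
by rewrite eq_complex/= eqxx andbT invr_eq0 gt_eqF.
Qed.

(** Inside the disc: ‖T^m x‖ is bounded below uniformly in m because every T^{n_k}
is close to I, so T^-1 is power bounded and z - T = -z T (1/z - T^-1) is
invertible there too. *)
Lemma resolvent_off_one T M (q : R) (n : nat -> nat) : power_bound T M ->
  spectrum T `<=` open_disc `|` [set 1] -> q < 1 -> n 0 = 1 -> (forall k, (k <= n k)%N) ->
  (forall k x, nrm (x - iter (n k) T x) <= q * nrm x) ->
  forall z : R[i], z != 1 -> boundedly_invertible (fun x => z *: x - T x).
Proof.
move=> hT sT q1 n0 nk hq z z1.
have iT : boundedly_invertible T.
  by apply: (boundedly_invertible_near_id q1) => x; have := hq 0%N x; rewrite n0.
have M0 : 0 < M by apply: lt_le_trans ltr01 hT.1.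
case: (ltP (nrm z) 1) => nz; last first.
  have : ~ spectrum T z.
    move=> /sT [|/= e]; last by rewrite e eqxx in z1.
    by rewrite /open_disc/= nrm_lt1 ltNge nz.
  by move=> /contrapT [S hS]; exact: boundedly_invertible_of_inverse hS.
have [[c c0 hc] sTT] := iT.
have lT : linear T by move=> a x y; rewrite linearP.
have [Tinv [_ VT TV] _] := inverse_of_lower lT c0 hc sTT.
have pV : power_bound Tinv (Num.max 1 (M / (1 - q))).
  split; first by rewrite le_max lexx.
  move=> m x.
  have TVm : iter m T (iter m Tinv x) = x.
    by elim: m => // m IH; rewrite iterSr/= TV.
  set y := iter m Tinv x in TVm *.
  apply: (@le_trans _ _ (M / (1 - q) * nrm x)); last first.
    by apply: ler_wpM2r; [exact: nrm_ge0|rewrite le_max lexx orbT].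
  rewrite mulrAC ler_pdivlMr ?subr_gt0// mulrC.
  have := hT.2 (n m - m)%N x; rewrite -{1}TVm -iterD subnK//.
  have := nrm_lerB y (y - iter (n m) T y); rewrite subKr; have := hq m y; lra.
case: (eqVneq z 0) => [->|z0].
  apply: (@boundedly_invertible_scale T _ (-1)); [by rewrite oppr_eq0 oner_eq0| |exact: iT].
  by move=> x; rewrite scale0r sub0r scaleN1r.
have nz0 : 0 < nrm z.
  by rewrite nrm_gt0.
have [|S hS _] := @resolvent_exists _ _ Tinv _ z^-1 pV.
  by rewrite nrmV invf_gt1.
have [[d d0 hd] sV] := boundedly_invertible_of_inverse hS.
have fac x : z *: x - T x = (- z) *: T (pencil z^-1 Tinv x).
  rewrite /pencil linearB linearZ/= TV scalerBr scalerA !scaleNr.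
  by rewrite mulNr divff// scaleN1r opprK addrC.
apply: (@boundedly_invertible_scale (fun x => T (pencil z^-1 Tinv x)) _ (- z) _ fac).
  by rewrite oppr_eq0.
split.
  exists (c * d); first exact: mulr_gt0.
  by move=> x; apply: le_trans (hc _); rewrite -mulrA ler_pM2l.
by move=> y; have [w hw] := sTT y; have [x hx] := sV w; exists x; rewrite hx.
Qed.

End EntireResolvent.

Section Quasinilpotent.
Context {R : realType} {X : completeNormedModType R[i]}.
Variable N : {linear X -> X}.
Variable D : R.
Hypothesis D1 : 1 <= D.
Hypothesis ND : forall x, nrm (N x) <= D * nrm x.
Hypothesis Ninv : forall u : R[i], boundedly_invertible (fun x => x - u *: N x).

(** Compactness in the angle for each radius, then in the radius. *)
Lemma lower_on_disc (r0 : R) : 0 <= r0 ->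
  exists2 c : R, 0 < c & forall u x, nrm u <= r0 -> c * nrm x <= nrm (x - u *: N x).
Proof.
move=> r00; have p0 := pi_gt0 R.
pose F (r : R) (t : {t : R | `|t| <= pi}) (x : X) := x - (r%:C%C * expi (sval t)) *: N x.
have D0 : 0 <= D by apply: le_trans ler01 D1.
have diff u v x : nrm ((x - u *: N x) - (x - v *: N x)) <= nrm (u - v) * D * nrm x.
  rewrite opprB addrC addrA subrK -scalerBl nrmZ nrmBC -mulrA.
  by apply: ler_wpM2l => //; exact: nrm_ge0.
have [| |r /andP[r1 r2]|c c0 hc] := @uniform_lower _ _ _ F D 0 r0 r00.
- exact: D0.
- move=> s t i x; apply: le_trans (diff _ _ _) _; rewrite -mulrBl nrmM nrm_expi mulr1.
  by rewrite -rmorphB nrm_real [D * _]mulrC.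
- pose G (t : R) (i : unit) (x : X) := x - (r%:C%C * expi t) *: N x.
  have [| | |t _|c c0 hc] := @uniform_lower _ _ _ G (r * D) (- pi) pi.
  + lra.
  + exact: mulr_ge0.
  + move=> s t i x; apply: le_trans (diff _ _ _) _; apply: ler_wpM2r; first exact: nrm_ge0.
    rewrite -mulrBr nrmM nrm_real ger0_norm// mulrAC; apply: ler_wpM2l; first exact: mulr_ge0.
    exact: expi_lip.
  + by have [[c c0 hc] _] := Ninv (r%:C%C * expi t); exists c.
  by exists c => // -[t ht] x; apply: hc tt _ _; rewrite -ler_norml.
exists c => // u x ur; have [t tpi uE] := polar u.
have := hc (nrm u) (exist _ t tpi) x; rewrite /F/= -uE; apply.
by rewrite nrm_ge0.
Qed.

Section Radius.
Variables (r0 c : R).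
Hypothesis r00 : 0 <= r0.
Hypothesis c0 : 0 < c.
Hypothesis hc : forall u x, nrm u <= r0 -> c * nrm x <= nrm (x - u *: N x).
Variable V0 : R[i] -> X -> X.
Hypothesis V0K : forall u x, V0 u x - u *: N (V0 u x) = x.

(** The inverse of 1 - u N^(2^k), obtained by averaging (1 - w^2 A^2)^-1 = ((1 -
wA)^-1 + (1 + wA)^-1) / 2 repeatedly. It is the mean of (1 - zN)^-1 over the
roots z of z^(2^k) = u, which is why it inherits bounds and Lipschitz
constants that do not depend on k. *)
Fixpoint dyad_inv (k : nat) (u : R[i]) (x : X) : X :=
  if k is j.+1 then (2^-1 : R[i]) *: (dyad_inv j (sqrtc u) x + dyad_inv j (- sqrtc u) x) else V0 u x.

(** The two square roots play symmetric roles, hence any of them can be used in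
place of the chosen one. *)
Lemma dyad_inv_sqr k w x :
  dyad_inv k.+1 (w ^+ 2) x = (2^-1 : R[i]) *: (dyad_inv k w x + dyad_inv k (- w) x).
Proof.
rewrite /=; have : (sqrtc (w ^+ 2)) ^+ 2 == w ^+ 2 by rewrite sqr_sqrtc.
by rewrite eqf_sqr => /orP[] /eqP ->//; rewrite opprK addrC.
Qed.

Lemma sqrt_exists (u : R[i]) : exists w, u = w ^+ 2.
Proof. by exists (sqrtc u); rewrite sqr_sqrtc. Qed.

Lemma halfD (x : X) : (2^-1 : R[i]) *: (x + x) = x.
Proof.
rewrite scalerDr -scalerDl -[RHS](scale1r x); congr (_ *: _).
by rewrite [RHS]splitr !div1r.
Qed.

Definition dyadic (k : nat) := (2 ^ k)%N.

Lemma dyadic_radius k w : nrm (w ^+ 2) <= r0 ^+ dyadic k.+1 -> nrm w <= r0 ^+ dyadic k.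
Proof.
rewrite /dyadic expnS mulnC exprM nrmX ler_pXn2r// ?nnegrE ?nrm_ge0//.
exact: exprn_ge0.
Qed.

Lemma iter_dyadic k x : iter (dyadic k) N (iter (dyadic k) N x) = iter (dyadic k.+1) N x.
Proof. by rewrite -iterD addnn -mul2n /dyadic expnS. Qed.

Lemma dyadic_factorNP k w x : let y := x - w *: iter (dyadic k) N x in
  y + w *: iter (dyadic k) N y = x - w ^+ 2 *: iter (dyadic k.+1) N x.
Proof.
by move=> /=; rewrite iter_linB iter_scalable iter_dyadic scalerBr scalerA -expr2 addrA subrK.
Qed.

Lemma dyadic_factorPN k w x : let y := x + w *: iter (dyadic k) N x in
  y - w *: iter (dyadic k) N y = x - w ^+ 2 *: iter (dyadic k.+1) N x.
Proof.
have := dyadic_factorNP k (- w) x; rewrite sqrrN /= => <-.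
by rewrite !scaleNr opprK.
Qed.

Lemma dyad_inv_right k u x : nrm u <= r0 ^+ dyadic k ->
  dyad_inv k u x - u *: iter (dyadic k) N (dyad_inv k u x) = x.
Proof.
elim: k u x => [|k IH] u x; first by rewrite /= V0K.
have [w ->] := sqrt_exists u => /dyadic_radius wr.
have h1 := IH w x wr.
have := IH (- w) x; rewrite nrmN => /(_ wr); rewrite scaleNr opprK => h2.
set a := dyad_inv k w x in h1; set b := dyad_inv k (- w) x in h2.
have ha : a - w ^+ 2 *: iter (dyadic k.+1) N a = x + w *: iter (dyadic k) N x.
  by rewrite -dyadic_factorNP/= h1.
have hb : b - w ^+ 2 *: iter (dyadic k.+1) N b = x - w *: iter (dyadic k) N x.
  by rewrite -dyadic_factorPN/= h2.
rewrite dyad_inv_sqr -/a -/b iter_scalable scalerA mulrC -scalerA -scalerBr iter_linD [w ^+ 2 *: _]scalerDr.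
by rewrite opprD addrACA ha hb addrACA subrr addr0 halfD.
Qed.

Lemma dyad_inv_left k u x : nrm u <= r0 ^+ dyadic k ->
  dyad_inv k u (x - u *: iter (dyadic k) N x) = x.
Proof.
elim: k u x => [|k IH] u x.
  rewrite /dyadic expn0 expr1 => ur; apply/subr0_eq/nrm_le0.
  rewrite -(pmulr_rle0 _ c0); apply: le_trans (hc _ ur) _.
  set y := dyad_inv 0 u _; have e : y - u *: N y = x - u *: N x by exact: V0K.
  by rewrite linearB scalerBr subrBACA e subrr nrm0.
have [w ->] := sqrt_exists u => /dyadic_radius wr.
rewrite dyad_inv_sqr -{1}dyadic_factorPN/= -dyadic_factorNP/=.
rewrite IH//; have := IH (- w) (x - w *: iter (dyadic k) N x).
rewrite nrmN scaleNr opprK => ->//.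
by rewrite addrACA subrr addr0 halfD.
Qed.

Lemma dyad_inv_bound k u x : nrm u <= r0 ^+ dyadic k -> nrm (dyad_inv k u x) <= c^-1 * nrm x.
Proof.
elim: k u x => [|k IH] u x.
  by rewrite /dyadic expn0 expr1 => ur; rewrite ler_pdivlMl// -{2}(V0K u x) hc.
have [w ->] := sqrt_exists u => /dyadic_radius wr.
rewrite dyad_inv_sqr nrmZ nrmV.
have := nrmD (dyad_inv k w x) (dyad_inv k (- w) x); have := IH w x wr; have := IH (- w) x.
rewrite nrmN => /(_ wr).
rewrite nrm_nat.
lra.
Qed.

Definition radial_lip := c^-1 * (D * c^-1).

(** The Lipschitz constant of r -> (1 - rvN)^-1 is preserved by averaging over
square roots, whose moduli are the radii at the previous level. *)
Lemma dyad_inv_radial k v s t x : nrm v = 1 -> 0 <= s <= r0 -> 0 <= t <= r0 ->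
  nrm (dyad_inv k (v * (s ^+ dyadic k)%:C%C) x - dyad_inv k (v * (t ^+ dyadic k)%:C%C) x) <=
    radial_lip * `|s - t| * nrm x.
Proof.
move=> v1 sr tr; elim: k v v1 => [|k IH] v v1.
  rewrite /dyadic expn0 !expr1; set u := v * _; set u' := v * _.
  have ur : nrm u <= r0.
    by rewrite nrmM v1 mul1r nrm_real ger0_norm; case/andP: sr.
  have ur' : nrm u' <= r0.
    by rewrite nrmM v1 mul1r nrm_real ger0_norm; case/andP: tr.
  have := hc (dyad_inv 0 u x - dyad_inv 0 u' x) ur.
  have -> : dyad_inv 0 u x - dyad_inv 0 u' x - u *: N (dyad_inv 0 u x - dyad_inv 0 u' x) = (u - u') *: N (dyad_inv 0 u' x).
    rewrite linearB scalerBr.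
    have -> : u *: N (dyad_inv 0 u x) = dyad_inv 0 u x - x by rewrite -{3}(V0K u x) subKr.
    rewrite scalerBl; have -> : u' *: N (dyad_inv 0 u' x) = dyad_inv 0 u' x - x by rewrite -{3}(V0K u' x) subKr.
    by rewrite subrBACA subKr !opprB addrCA.
  rewrite nrmZ /u /u' -mulrBr nrmM v1 mul1r -rmorphB nrm_real -ler_pdivlMl// => h.
  apply: le_trans h _; rewrite /radial_lip -!mulrA; apply: ler_wpM2l; first by rewrite invr_ge0 ltW.
  have h1 : nrm (N (dyad_inv 0 u' x)) <= D * (c^-1 * nrm x).
    by apply: le_trans (ND _) _; apply: ler_wpM2l; [exact: le_trans ler01 D1|apply: (@dyad_inv_bound 0)].
  by apply: le_trans (ler_wpM2l (normr_ge0 _) h1) _; rewrite le_eqVlt; apply/orP; left; apply/eqP; ring.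
have [w vw] := sqrt_exists v.
have w1 : nrm w = 1.
  apply/eqP; rewrite -(@eqrXn2 _ 2)// ?nrm_ge0// -nrmX -vw v1 expr1n//.
have e r : v * (r ^+ dyadic k.+1)%:C%C = (w * (r ^+ dyadic k)%:C%C) ^+ 2.
  by rewrite vw exprMn -rmorphXn/= -exprM /dyadic expnS mulnC.
rewrite !e !dyad_inv_sqr -scalerBr nrmZ nrmV.
rewrite nrm_nat.
have := IH w w1; have := IH (- w); rewrite nrmN => /(_ w1).
rewrite !mulNr opprD addrACA => h1 h2.
apply: (@le_trans _ _ (2^-1 * (radial_lip * `|s - t| * nrm x + radial_lip * `|s - t| * nrm x))).
  by apply: ler_wpM2l; [rewrite invr_ge0|apply: le_trans (nrmD _ _) _; apply: lerD].
lra.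
Qed.

(** The powers of sN decay along the exponents 2^k, that is, s is inside the
radius of convergence of the resolvent series (the bound being uniform in x). *)
Definition decays (s : R) := forall e : R, 0 < e -> exists k0, forall k x, (k0 <= k)%N ->
  s ^+ dyadic k * nrm (iter (dyadic k) N x) <= e * nrm x.

Lemma decays0 : decays 0.
Proof.
move=> e e0; exists 0%N => k x _; rewrite expr0n gtn_eqF ?expn_gt0// mul0r.
by rewrite mulr_ge0 ?nrm_ge0// ltW.
Qed.

(** The radius of decay grows by a fixed amount. Where s^n N^n is small, (1 - s^n
N^n)^-1 is close to 1; by the radial Lipschitz bound it is still within 1/2 of
1 at the radius s + 2d, which bounds (s + 2d)^n N^n, and then (s + d)^n N^n
decays. *)
Lemma decays_step s d : 0 <= s -> 0 < d -> s + 2 * d <= r0 -> radial_lip * (2 * d) <= 1 / 4 ->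
  decays s -> decays (s + d).
Proof.
move=> s0 d0 sr dl hs e e0.
(* the inverses have norm at most 1/c, so this makes them 1/4-close to 1 *)
have [|k0 hk0] := hs (c / 4); first by rewrite divr_gt0.
pose t := s + 2 * d; have t0 : 0 <= t by rewrite /t; lra.
have t00 : 0 < t by rewrite /t; lra.
have hk k x : (k0 <= k)%N -> t ^+ dyadic k * nrm (iter (dyadic k) N x) <= nrm x.
  move=> /hk0 hsk.
  have sr0 : 0 <= s <= r0 by apply/andP; split; lra.
  have tr0 : 0 <= t <= r0 by apply/andP; split; rewrite /t; lra.
  have rad r : 0 <= r <= r0 -> nrm ((r ^+ dyadic k)%:C%C : R[i]) <= r0 ^+ dyadic k.
    move=> /andP[r1 r2]; rewrite nrm_real ger0_norm ?exprn_ge0//.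
    by apply: lerXn2r; rewrite // nnegrE// (le_trans r1).
  set y := x - (t ^+ dyadic k)%:C%C *: iter (dyadic k) N x.
  have yx : nrm (x - y) = t ^+ dyadic k * nrm (iter (dyadic k) N x).
    by rewrite /y subKr nrmZ nrm_real ger0_norm// exprn_ge0.
  have h1 := dyad_inv_left x (rad _ tr0); rewrite -/y in h1.
  pose z := dyad_inv k (s ^+ dyadic k)%:C%C y.
  have h2 : nrm (y - z) <= 1 / 4 * nrm y.
    have h := dyad_inv_right y (rad _ sr0); rewrite -/z in h.
    have -> : y - z = - ((s ^+ dyadic k)%:C%C *: iter (dyadic k) N z) by rewrite -[in LHS]h addrC addKr.
    rewrite nrmN nrmZ nrm_real ger0_norm ?exprn_ge0//; apply: le_trans (hsk z) _.
    have := dyad_inv_bound y (rad _ sr0); rewrite -/z ler_pdivlMl// => h3; lra.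
  have h3 : nrm (z - x) <= 1 / 4 * nrm y.
    have := dyad_inv_radial k y (nrm1) sr0 tr0; rewrite !mul1r h1 -/z => h4.
    apply: le_trans h4 _; apply: ler_wpM2r; first exact: nrm_ge0.
    have -> : `|s - t| = 2 * d by rewrite distrC /t ger0_norm; lra.
    by apply: le_trans dl _; lra.
  have h4 : nrm (x - y) <= 1 / 2 * nrm y.
    rewrite nrmBC; have -> : y - x = (y - z) + (z - x) by rewrite addrA subrK.
    by apply: le_trans (nrmD _ _) _; lra.
  have h5 : nrm y <= nrm x + nrm (x - y) by have := nrmB x (x - y); rewrite subKr.
  by rewrite -yx; lra.
pose q := t / (s + d).
have sd0 : 0 < s + d by lra.
have q1 : 1 < q by rewrite ltr_pdivlMr// mul1r /t; lra.
pose k1 := (Num.truncn (e^-1 / (q - 1))).+1.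
exists (maxn k0 k1) => k x; rewrite geq_max => /andP[kk0 kk1].
have qk : e^-1 <= q ^+ dyadic k.
  apply: le_trans (bernoulli_pow (dyadic k) (ltW q1)).
  rewrite -ler_pdivrMr ?subr_gt0//; apply: le_trans (ltW (truncnS_gt _)) _.
  rewrite ler_nat; apply: leq_trans kk1 _; apply: ltnW; exact: ltn_expl.
have := hk k x kk0; have -> : t = q * (s + d) by rewrite /q divfK// gt_eqF.
rewrite exprMn => h.
have sd : 0 <= (s + d) ^+ dyadic k * nrm (iter (dyadic k) N x) by rewrite mulr_ge0 ?exprn_ge0 ?nrm_ge0// ltW.
rewrite -mulrA in h; have := le_trans (ler_wpM2r sd qk) h.
by rewrite ler_pdivrMl.
Qed.

End Radius.

(** Starting from s = 0, finitely many steps of fixed size reach any radius: this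
is the spectral radius formula for an operator with spectrum {0}. *)
Lemma power_small (s : R) : 0 <= s ->
  exists2 m, (0 < m)%N & forall x, s ^+ m * nrm (iter m N x) <= nrm x.
Proof.
move=> s0; pose r0 := s + 3.
have r00 : 0 <= r0 by rewrite /r0; lra.
have [c c0 hc] := lower_on_disc r00.
have [V0 V0K] : exists V0, forall u x, V0 u x - u *: N (V0 u x) = x.
  have [f hf] := choice (fun p : R[i] * X => (Ninv p.1).2 p.2).
  by exists (fun u x => f (u, x)) => u x; exact: (hf (u, x)).
have l0 : 0 < radial_lip c.
  by rewrite /radial_lip !mulr_gt0 ?invr_gt0//; apply: lt_le_trans ltr01 D1.
pose d := Num.min 1 ((radial_lip c)^-1 / 8).
have d0 : 0 < d by rewrite lt_min ltr01 divr_gt0 ?invr_gt0.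
have d1 : d <= 1 by rewrite ge_min lexx.
have d2 : radial_lip c * (2 * d) <= 1 / 4.
  have : d <= (radial_lip c)^-1 / 8 by rewrite ge_min lexx orbT.
  by rewrite -(ler_pM2l l0) mulrA divff ?gt_eqF// => h; lra.
have hi i : i%:R * d <= s + 1 -> decays (i%:R * d).
  elim: i => [|i IH]; first by rewrite mul0r => _; exact: decays0.
  rewrite -natr1 mulrDl mul1r => h.
  have id0 : 0 <= i%:R * d by rewrite mulr_ge0// ltW.
  apply: (decays_step r00 c0 hc V0K id0 d0 _ d2); first by rewrite /r0; lra.
  by apply: IH; lra.
pose i := (Num.truncn (s / d)).+1.
have /andP[i1 i2] : (Num.truncn (s / d))%:R <= s / d < i%:R by apply: truncn_itv; rewrite divr_ge0// ltW.
rewrite ltr_pdivrMr// in i2; rewrite ler_pdivlMr// in i1.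
have [|k0 hk] := hi i _ 1 ltr01; first by rewrite /i -natr1 mulrDl mul1r; lra.
exists (dyadic k0); first by rewrite expn_gt0.
move=> x; have := hk k0 x (leqnn _); rewrite mul1r; apply: le_trans.
apply: ler_wpM2r; first exact: nrm_ge0.
by apply: lerXn2r; rewrite ?nnegrE// ?mulr_ge0// ltW.
Qed.

(** A single power m with s^m ‖N^m‖ <= 1 controls all powers by Euclidean division
of the exponent. *)
Lemma quasinilpotent (e : R) : 0 < e -> exists2 C, 0 <= C &
  forall j x, nrm (iter j N x) <= C * e ^+ j * nrm x.
Proof.
move=> e0; pose s := Num.max 1 e^-1.
have s1 : 1 <= s by rewrite le_max lexx.
have s0 : 0 < s by apply: lt_le_trans ltr01 s1.
have se : s^-1 <= e by rewrite invf_ple ?posrE// le_max lexx orbT.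
have [m m0 hm] := power_small (ltW s0).
have D0 : 0 < D by apply: lt_le_trans ltr01 D1.
have hD j x : nrm (iter j N x) <= D ^+ j * nrm x.
  elim: j => [|j IH]; first by rewrite expr0 mul1r.
  by rewrite iterS exprS -mulrA; apply: le_trans (ND _) _; rewrite ler_pM2l.
have ha a x : s ^+ (a * m) * nrm (iter (a * m) N x) <= nrm x.
  elim: a x => [|a IH] x; first by rewrite mul0n expr0 mul1r.
  rewrite mulSn iterD exprD; apply: le_trans (IH x).
  by rewrite [s ^+ m * _]mulrC -mulrA ler_pM2l ?exprn_gt0.
exists (D ^+ m * s ^+ m); first by rewrite mulr_ge0// exprn_ge0// ltW.
move=> j x.
apply: (@le_trans _ _ (D ^+ m * s ^+ m * s^-1 ^+ j * nrm x)); last first.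
  apply: ler_wpM2r; first exact: nrm_ge0.
  apply: ler_wpM2l; first by rewrite mulr_ge0// exprn_ge0// ltW.
  by apply: lerXn2r; rewrite ?nnegrE ?invr_ge0// ltW.
rewrite exprVn -(ler_pM2l (exprn_gt0 j s0)).
have -> : s ^+ j * (D ^+ m * s ^+ m / s ^+ j * nrm x) = s ^+ m * (D ^+ m * nrm x).
  by field; rewrite ?expf_eq0 gt_eqF ?andbF.
have {1 2}-> : j = (j %/ m * m + j %% m)%N by exact: divn_eq.
rewrite exprD iterD mulrAC.
have jm : (j %% m <= m)%N by rewrite ltnW// ltn_mod.
have h1 := ha (j %/ m)%N (iter (j %% m) N x).
have h2 : D ^+ (j %% m) * nrm x <= D ^+ m * nrm x.
  by apply: ler_wpM2r; [exact: nrm_ge0|exact: ler_weXn2l].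
have h3 : s ^+ (j %% m) <= s ^+ m by exact: ler_weXn2l.
have h4 : nrm (iter (j %% m) N x) <= D ^+ m * nrm x by exact: le_trans (hD _ _) h2.
rewrite mulrC; apply: ler_pM => //; first by rewrite exprn_ge0// ltW.
  by rewrite mulr_ge0 ?nrm_ge0// exprn_ge0// ltW.
exact: le_trans h1 h4.
Qed.

End Quasinilpotent.

(** * Partial sums of the binomial series *)

Section BinomialPolynomials.
Context {R : realType}.
Local Open Scope ring_scope.
Implicit Types p q P Q : {poly R}.

(** The generalized binomial coefficient of a real number a. *)
Fixpoint binom_coef (a : R) (m : nat) : R :=
  if m is j.+1 then binom_coef a j * (a - j%:R) / (j.+1)%:R else 1.

Lemma binom_coef_le (a : R) m : 0 <= a <= 1 -> `|binom_coef a m.+1| <= a.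
Proof.
move=> /andP[a0 a1]; elim: m => [|m IH].
  by rewrite /= mul1r subr0 invr1 mulr1 ger0_norm.
rewrite [binom_coef _ _]/= -[binom_coef a m * _ / _]/(binom_coef a m.+1) -mulrA normrM.
apply: le_trans IH; rewrite ler_piMr// normrM normfV (ger0_norm (ler0n _ _)).
rewrite ler_pdivrMr ?ltr0n// mul1r ler0_norm.
  by rewrite opprB lerBlDr -[leLHS]addr0; apply: lerD; rewrite ?ler_nat.
by rewrite subr_le0; apply: le_trans a1 _; rewrite ler1n.
Qed.

(** The polynomial W with 1 + W = (1 + X)^n. *)
Definition shift_pow (n : nat) : {poly R} := ('X + 1) ^+ n - 1.

(** The partial sum of order M of the binomial series of (1 + W)^(1/n), a
polynomial approximation of 1 + X. *)
Definition root_poly (n M : nat) : {poly R} :=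
  \sum_(i < M.+1) binom_coef n%:R^-1 i *: shift_pow n ^+ i.

Lemma deriv_shift_pow n i : (0 < n)%N ->
  ('X + 1) * (shift_pow n ^+ i.+1)^`() =
  ((i.+1)%:R * n%:R) *: (shift_pow n ^+ i * (1 + shift_pow n)).
Proof.
move=> n0; have dw : ('X + 1) * (shift_pow n)^`() = n%:R *: (1 + shift_pow n).
  rewrite /shift_pow derivB deriv_exp derivD derivX -polyC1 !derivC addr0 subr0 mul1r.
  by rewrite mulrnAr -exprS prednK// polyC1 [1 + _]addrC subrK scaler_nat.
rewrite deriv_exp/= [LHS]mulrnAr mulrA dw -scalerAl scalerMnl -mulr_natl.
by rewrite [X in _ *: X]mulrC.
Qed.

(** The full series S satisfies (1 + X) S' = S, as does 1 + X; truncation leaves a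
single term W^M, which has no coefficient below X^M. *)
Lemma root_poly_ode n M : (0 < n)%N ->
  ('X + 1) * (root_poly n M)^`() =
  root_poly n M + ((n%:R * M%:R - 1) * binom_coef n%:R^-1 M) *: shift_pow n ^+ M.
Proof.
move=> n0; have nn : n%:R != 0 :> R by rewrite pnatr_eq0 -lt0n.
elim: M => [|M IH].
  rewrite /root_poly big_ord1 expr0 /= scale1r mulr0 sub0r mulr1 scaleN1r subrr.
  by rewrite -polyC1 derivC mulr0.
rewrite /root_poly big_ord_recr -/(root_poly n M) derivD mulrDr IH derivZ -scalerAr.
rewrite (deriv_shift_pow M n0) mulrDr mulr1 -exprSr -addrA -[RHS]addrA; congr (_ + _).
rewrite scalerA scalerDr addrA -!scalerDl; set w := shift_pow n.
have -> : (n%:R * M%:R - 1) * binom_coef n%:R^-1 M + binom_coef n%:R^-1 M.+1 * (M.+1%:R * n%:R) = 0 :> R.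
  rewrite /=; have M0 : M%:R + 1 != 0 :> R by rewrite natr1 pnatr_eq0.
  by rewrite -natr1; field; rewrite nn ?[1 + _]addrC M0.
rewrite scale0r add0r; congr (_ *: _); ring.
Qed.

Lemma shift_powMX n : exists v, shift_pow n = v * 'X.
Proof.
have : root (shift_pow n) 0 by rewrite /root /shift_pow !hornerE ?add0r expr1n subrr.
by move=> /factor_theorem[v ->]; exists v; rewrite subr0.
Qed.

(** The differential equation gives (j+1) d_{j+1} = (1 - j) d_j for the
coefficients of the defect below X^M, and d_0 = 0. *)
Lemma root_poly_defect_coef n M j : (0 < n)%N -> (j <= M)%N -> ('X + 1 - root_poly n M)`_j = 0.
Proof.
move=> n0; set D := _ - _; pose k := (1 - n%:R * M%:R) * binom_coef (n%:R^-1 : R) M.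
have ode : ('X + 1) * D^`() = D + k *: shift_pow n ^+ M.
  rewrite /D derivB mulrBr root_poly_ode// derivD derivX -polyC1 derivC addr0 mulr1 polyC1.
  by rewrite opprD addrA -scaleNr -mulNr opprB.
have low i : (i < M)%N -> (shift_pow n ^+ M)`_i = 0.
  by move=> iM; have [v ->] := shift_powMX n; rewrite exprMn coefMXn iM.
have coef i : (i < M)%N -> (i.+1)%:R * D`_i.+1 = (1 - i%:R) * D`_i.
  move=> iM; have := congr1 (fun p : {poly R} => p`_i) ode.
  rewrite mulrDl mul1r coefD coefXM coefD coefZ low// mulr0 addr0 !coef_deriv.
  case: i iM => [|i] iM /=; first by rewrite add0r !mulr1n => ->; rewrite subr0 !mul1r.
  by rewrite -[D`_i.+1 *+ _]mulr_natl -[D`_i.+2 *+ _]mulr_natl => h; lra.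
elim: j => [_|j IH jM].
  rewrite /D coefB coefD coefX coef1 add0r /root_poly coef_sum big_ord_recl big1 ?addr0.
    by rewrite expr0 scale1r coef1 subrr.
  move=> i _; rewrite coefZ lift0 exprS; have [v ->] := shift_powMX n.
  by rewrite -mulrA coefM big_ord1/= [('X * _)`_0]coefXM !mulr0.
have := coef j jM; rewrite IH ?mulr0; last exact: ltnW.
by move/eqP; rewrite mulf_eq0 pnatr_eq0/= => /eqP.
Qed.

(** Coefficientwise majorants are compatible with sums and products, and the value
of the majorant at 1 bounds the sum of the moduli of the coefficients. *)
Definition majorized p P := forall i, `|p`_i| <= P`_i.

Lemma majorized_ge0 p P i : majorized p P -> 0 <= P`_i.
Proof. by move=> /(_ i); exact: le_trans. Qed.

Lemma majorizedD p P q Q : majorized p P -> majorized q Q -> majorized (p + q) (P + Q).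
Proof.
by move=> hp hq i; rewrite !coefD; apply: le_trans (ler_normD _ _) _; apply: lerD.
Qed.

Lemma majorizedN p P : majorized p P -> majorized (- p) P.
Proof. by move=> hp i; rewrite coefN normrN. Qed.

Lemma majorizedM p P q Q : majorized p P -> majorized q Q -> majorized (p * q) (P * Q).
Proof.
move=> hp hq i; rewrite !coefM; apply: le_trans (ler_norm_sum _ _ _) _.
by apply: ler_sum => j _; rewrite normrM ler_pM.
Qed.

Lemma majorized1 : majorized 1 1.
Proof. by move=> i; rewrite coef1; case: eqP; rewrite ?normr1 ?normr0. Qed.

Lemma majorizedX : majorized 'X 'X.
Proof. by move=> i; rewrite coefX; case: eqP; rewrite ?normr1 ?normr0. Qed.

Lemma majorized_exp p P k : majorized p P -> majorized (p ^+ k) (P ^+ k).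
Proof.
move=> h; elim: k => [|k IH]; first by rewrite !expr0; exact: majorized1.
by rewrite !exprS; exact: majorizedM.
Qed.

Lemma majorized_root_poly_defect n M : (0 < n)%N -> exists2 P, majorized ('X + 1 - root_poly n M) P &
  P.[1] <= 2 + (M.+1)%:R * (2 ^+ n + 1) ^+ M.
Proof.
move=> n0; exists ('X + 1 + \sum_(i < M.+1) (('X + 1) ^+ n + 1) ^+ i).
  apply: majorizedD; first by apply: majorizedD; [exact: majorizedX|exact: majorized1].
  apply: majorizedN; rewrite /root_poly; elim/big_ind2: _ => //.
  - by move=> i; rewrite coef0 normr0.
  - by move=> p P q Q; exact: majorizedD.
  move=> i _.
  have b1 : `|binom_coef (n%:R^-1 : R) i| <= 1.
    case: (nat_of_ord i) => [|m]; first by rewrite normr1.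
    apply: le_trans (binom_coef_le m _) _; last by rewrite invf_le1 ?ltr0n// ler1n.
    by rewrite invr_ge0 ler0n invf_le1 ?ltr0n// ler1n.
  have h : majorized (shift_pow n ^+ i) ((('X + 1) ^+ n + 1) ^+ i).
    apply: majorized_exp; apply: majorizedD; last by apply: majorizedN; exact: majorized1.
    by apply: majorized_exp; apply: majorizedD; [exact: majorizedX|exact: majorized1].
  by move=> j; rewrite coefZ normrM; apply: le_trans (h j); rewrite ler_piMl.
rewrite hornerD horner_sum !hornerE lerD2l.
apply: (@le_trans _ _ (\sum_(i < M.+1) (2 ^+ n + 1) ^+ M)).
  apply: ler_sum => i _; rewrite !hornerE; apply: ler_weXn2l; last by rewrite -ltnS.
  by rewrite lerDr exprn_ge0.
by rewrite sumr_const card_ord mulr_natl.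
Qed.

End BinomialPolynomials.

(** * Operators whose sampled powers stay close to the identity *)

Section Unipotent.
Context {R : realType} {X : completeNormedModType R[i]}.
Implicit Types (T N : {linear X -> X}) (p q P : {poly R}).

(** Evaluation of a real polynomial at the operator N. *)
Definition peval N p (x : X) : X := \sum_(i < size p) (p`_i)%:C%C *: iter i N x.

Lemma peval_wide N p m x : (size p <= m)%N -> peval N p x = \sum_(i < m) (p`_i)%:C%C *: iter i N x.
Proof.
move=> pm; rewrite /peval (big_ord_widen _ (fun i => (p`_i)%:C%C *: iter i N x) pm).
rewrite big_mkcond; apply: eq_bigr => i _; case: ltnP => // h.
by rewrite nth_default// scale0r.
Qed.

Lemma peval0 N x : peval N 0 x = 0.
Proof. by rewrite /peval size_poly0 big_ord0. Qed.

Lemma pevalD N p q x : peval N (p + q) x = peval N p x + peval N q x.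
Proof.
set m := maxn (size p) (size q).
rewrite (peval_wide _ _ (size_polyD p q)) (peval_wide _ _ (leq_maxl _ (size q))).
rewrite (peval_wide _ _ (leq_maxr (size p) _)) -big_split/=; apply: eq_bigr => i _.
by rewrite coefD rmorphD scalerDl.
Qed.

Lemma pevalZ N (a : R) p x : peval N (a *: p) x = a%:C%C *: peval N p x.
Proof.
rewrite (peval_wide _ _ (size_scale_leq a p)) /peval scaler_sumr; apply: eq_bigr => i _.
by rewrite coefZ rmorphM scalerA.
Qed.

Lemma peval_sum N (I : Type) (r : seq I) (F : I -> {poly R}) x :
  peval N (\sum_(i <- r) F i) x = \sum_(i <- r) peval N (F i) x.
Proof. by elim/big_rec2: _ => [|i y p _ <-]; rewrite ?peval0// pevalD. Qed.

Lemma pevalN N p x : peval N (- p) x = - peval N p x.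
Proof. by rewrite -scaleN1r pevalZ rmorphN1 scaleN1r. Qed.

Lemma peval1 N x : peval N 1 x = x.
Proof. by rewrite /peval size_poly1 big_ord1 coef1/= scale1r. Qed.

Lemma pevalMX N p x : peval N (p * 'X) x = N (peval N p x).
Proof.
case: (eqVneq p 0) => [->|p0]; first by rewrite mul0r peval0 linear0.
rewrite /peval size_mulX// big_ord_recl coefMX/= scale0r add0r linear_sum; apply: eq_bigr => i _.
by rewrite coefMX/= linearZ.
Qed.

Lemma pevalX N x : peval N 'X x = N x.
Proof. by rewrite -['X]mul1r pevalMX peval1. Qed.

Lemma pevalMXD1 N p x : peval N (p * ('X + 1)) x = peval N p x + N (peval N p x).
Proof. by rewrite mulrDr mulr1 pevalD pevalMX addrC. Qed.

(** Only the coefficients of order at least m contribute, and there ‖N^j‖ <= C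
e^m. *)
Lemma peval_bound N p P C e m : 0 <= C -> 0 <= e <= 1 ->
  (forall j x, nrm (iter j N x) <= C * e ^+ j * nrm x) -> majorized p P ->
  (forall j, (j < m)%N -> p`_j = 0) ->
  forall x, nrm (peval N p x) <= C * e ^+ m * P.[1] * nrm x.
Proof.
move=> C0 /andP[e0 e1] hN pP p0 x.
pose w := maxn (size p) (size P).
rewrite (peval_wide _ _ (leq_maxl _ (size P))) (horner_coef_wide _ (leq_maxr (size p) _)).
apply: le_trans (nrm_sum _ _) _; rewrite mulr_sumr mulr_suml; apply: ler_sum => i _.
rewrite expr1n mulr1 nrmZ nrm_real; have Pi := majorized_ge0 i pP.
have x0 := nrm_ge0 x.
case: (ltnP i m) => im.
  by rewrite p0// normr0 mul0r !mulr_ge0// exprn_ge0.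
apply: (@le_trans _ _ (P`_i * (C * e ^+ i * nrm x))).
  by apply: ler_pM => //; exact: nrm_ge0.
have h : e ^+ i <= e ^+ m by exact: ler_wiXn2l.
have k0 : 0 <= P`_i * C * nrm x by rewrite !mulr_ge0.
by have := ler_wpM2l k0 h; lra.
Qed.

(** All binomial coefficients of 1/n but the first have modulus at most 1/n,
whatever M is. *)
Lemma peval_root_poly_dist T N (n M : nat) (q : R) x : (0 < n)%N -> 0 <= q < 1 ->
  (forall y, N y = T y - y) -> (forall y, nrm (iter n T y - y) <= q * nrm y) ->
  nrm (peval N (root_poly n M) x - x) <= n%:R^-1 * (q / (1 - q)) * nrm x.
Proof.
move=> n0 /andP[q0 q1] hN hq.
have hw i y : nrm (peval N (shift_pow n ^+ i) y) <= q ^+ i * nrm y.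
  elim: i y => [|i IH] y; first by rewrite !expr0 peval1 mul1r.
  have pevalM p z : peval N (p * shift_pow n) z = iter n T (peval N p z) - peval N p z.
    rewrite /shift_pow mulrBr mulr1 pevalD pevalN; congr (_ - _).
    elim: n {n0 hq IH} p => [|k IH] p; first by rewrite expr0 mulr1.
    rewrite exprS mulrA IH pevalMXD1 hN addrC subrK -iterSr; congr (iter _ _ _).
  rewrite exprSr pevalM exprS -mulrA; apply: le_trans (hq _) _; exact: ler_wpM2l.
have n1 : 0 <= (n%:R^-1 : R) <= 1.
  by rewrite invr_ge0 ler0n invf_le1 ?ltr0n// ler1n.
rewrite /root_poly big_ord_recl pevalD expr0 /= scale1r peval1 addrC addKr peval_sum.
apply: le_trans (nrm_sum _ _) _.
apply: (@le_trans _ _ (\sum_(i < M) n%:R^-1 * q ^+ i.+1 * nrm x)).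
  apply: ler_sum => i _; rewrite pevalZ nrmZ nrm_real -[leRHS]mulrA.
  exact: (ler_pM (normr_ge0 _) (nrm_ge0 _) (binom_coef_le i n1) (hw i.+1 x)).
rewrite -mulr_suml -mulr_sumr; apply: ler_wpM2r; first exact: nrm_ge0.
apply: ler_wpM2l; first by case/andP: n1.
have q10 : 0 < 1 - q by rewrite subr_gt0.
rewrite ler_pdivlMr//.
elim: M => [|M IH]; first by rewrite big_ord0 mul0r.
have : (\sum_(i < M) q ^+ i.+1) * (1 - q) = q * (1 - q ^+ M).
  elim: M {IH} => [|M IH]; first by rewrite big_ord0 mul0r expr0 subrr mulr0.
  by rewrite big_ord_recr/= mulrDl IH !exprS; ring.
rewrite big_ord_recr/= mulrDl => ->; rewrite exprS.
have : 0 <= q ^+ M.+1 * q by rewrite mulr_ge0// exprn_ge0.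
by rewrite exprS; lra.
Qed.

(** For fixed k, ‖T - I‖ is at most the distance from I to the partial sum at W =
T^{n_k} - 1, which is O(1/n_k) uniformly in M, plus the defect of the partial
sum, which tends to 0 with M because N is quasinilpotent. *)
Lemma unipotent_id T M (q : R) (n : nat -> nat) : power_bound T M -> 0 <= q < 1 ->
  spectrum T `<=` open_disc `|` [set 1] -> n 0 = 1 -> (forall k, (k <= n k)%N) ->
  (forall k x, nrm (x - iter (n k) T x) <= q * nrm x) -> forall x, T x = x.
Proof.
move=> hT /andP[q0 q1] sT n0 nk hq x.
have [|N hN] := @linear_pack _ _ (fun x => T x - x).
  by move=> a u v; rewrite linearP/= scalerBr opprD addrACA.
have M0 : 0 < M by apply: lt_le_trans ltr01 hT.1.
have Ninv u : boundedly_invertible (fun x => x - u *: N x).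
  case: (eqVneq u 0) => [->|u0].
    by split; [exists 1 => // y; rewrite scale0r subr0 mul1r|move=> y; exists y; rewrite scale0r subr0].
  have z1 : (1 + u) / u != 1.
    apply: contra_neq (oner_neq0 R[i]) => h.
    have : 1 + u = u by rewrite -[LHS](divfK u0) h mul1r.
    by move/eqP; rewrite -subr_eq0 addrK => /eqP.
  apply: (boundedly_invertible_scale u0 _ (resolvent_off_one hT sT q1 n0 nk hq z1)) => y.
  by rewrite hN [RHS]scalerBr scalerA [u * _]mulrC divfK// scalerBr scalerDl scale1r opprB addrA.
have ND y : nrm (N y) <= (M + 1) * nrm y.
  by rewrite hN; apply: le_trans (nrmB _ _) _; have := power_bound1 y hT; lra.
have D1 : 1 <= M + 1 by lra.
have nq k y : nrm (iter (n k) T y - y) <= q * nrm y by rewrite nrmBC.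
have step k : nrm (T x - x) <= (n k)%:R^-1 * (q / (1 - q)) * nrm x.
  have [nk0|nk0] := posnP (n k).
    have := nk 0; case: k nk0 => [|k] nk0; first by rewrite n0 in nk0.
    by have := nk k.+1; rewrite nk0.
  (* L^M bounds the coefficients of W^M, so the rate of quasinilpotence is chosen
     small compared with 1/L. *)
  pose L : R := 2 ^+ n k + 1.
  have L0 : 0 < L by rewrite addr_gt0// exprn_gt0.
  have e0 : 0 < (4 * L)^-1 by rewrite invr_gt0 mulr_gt0.
  have [C C0 hC] := quasinilpotent D1 ND Ninv e0.
  have e1 : (4 * L)^-1 <= 1.
    rewrite invf_le1 ?mulr_gt0//; have : 0 < 2 ^+ n k :> R by rewrite exprn_gt0.
    by rewrite /L; lra.
  apply/ler_addgt0Pr => e eps0.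
  pose K := C * 3 * nrm x.
  have K0 : 0 <= K by rewrite !mulr_ge0// nrm_ge0.
  have [m mpos hm] : exists2 m, (0 < m)%N & K <= e * m%:R.
    by exists (Num.truncn (K / e)).+1; rewrite // mulrC -ler_pdivrMr// ltW// truncnS_gt.
  have [P pP P1] := @majorized_root_poly_defect R (n k) m nk0.
  have low j : (j < m.+1)%N -> ('X + 1 - root_poly (n k) m : {poly R})`_j = 0.
    by rewrite ltnS; exact: root_poly_defect_coef.
  have e01 : 0 <= (4 * L)^-1 <= 1 by rewrite (ltW e0).
  have := peval_bound C0 e01 hC pP low x.
  rewrite pevalD pevalN pevalD pevalX peval1 hN subrK => h1.
  have h2 := peval_root_poly_dist m x nk0 (_ : 0 <= q < 1) hN (nq k).
  rewrite q0 q1 in h2; have {}h2 := h2 isT.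
  have -> : T x - x = (peval N (root_poly (n k) m) x - x) + (T x - peval N (root_poly (n k) m) x).
    by rewrite [RHS]addrC addrA subrK.
  apply: le_trans (nrmD _ _) _; apply: lerD => //; apply: le_trans h1 _.
  have h3 : (4 * L)^-1 ^+ m.+1 * P.[1] <= 3 / m%:R.
    have L1 : 1 <= L by rewrite /L lerDr exprn_ge0.
    have Lm : 1 <= L ^+ m by exact: exprn_ege1.
    have m2 : (m%:R + 2) <= 2 ^+ m.+1 :> R.
      rewrite -natrD -natrX ler_nat addn2; exact: ltn_expl.
    have m1 : 0 < m%:R :> R by rewrite ltr0n.
    have A0 : 0 < (4 * L) ^+ m.+1 by rewrite exprn_gt0// mulr_gt0.
    rewrite exprVn mulrC ler_pdivrMr// mulrAC ler_pdivlMr//; apply: le_trans (ler_wpM2r (ltW m1) P1) _.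
    rewrite -/L -[m.+1%:R]natr1.
    have -> : (4 * L) ^+ m.+1 = (2 ^+ m.+1 * 2 ^+ m.+1) * (L * L ^+ m).
      by rewrite -exprS -[2 ^+ _ * 2 ^+ _]exprMn [LHS]exprMn; congr (_ ^+ _ * _); ring.
    set t := 2 ^+ m.+1 in m2 *; set l := L ^+ m in Lm *.
    have h4 : (m%:R + 2) * (m%:R + 2) <= t * t by apply: ler_pM => //; lra.
    have h5 : l <= L * l by rewrite ler_peMl//; lra.
    have h6 : (2 + (m%:R + 1) * l) * m%:R <= (m%:R + 2) * (m%:R + 2) * l.
      have : m%:R <= m%:R * l by rewrite ler_peMr// ltW.
      by have : 0 <= m%:R * l; [rewrite mulr_ge0//; lra|lra].
    have t0 : 0 <= t by rewrite exprn_ge0.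
    have tt0 : 0 <= t * t by rewrite mulr_ge0.
    apply: le_trans h6 _; apply: (@le_trans _ _ (t * t * l)); first by rewrite ler_wpM2r//; lra.
    apply: (@le_trans _ _ (t * t * (L * l))); first exact: ler_wpM2l.
    have : 0 <= t * t * (L * l) by rewrite mulr_ge0// mulr_ge0//; lra.
    lra.
  rewrite (_ : _ * _ * _ * _ = C * nrm x * ((4 * L)^-1 ^+ m.+1 * P.[1])); last by ring.
  have h4 : C * nrm x * ((4 * L)^-1 ^+ m.+1 * P.[1]) <= C * nrm x * (3 / m%:R).
    by apply: ler_wpM2l => //; rewrite mulr_ge0// nrm_ge0.
  apply: le_trans h4 _; rewrite mulrA ler_pdivrMr ?ltr0n//.
  by apply: le_trans hm; rewrite /K; lra.
case: (leP (nrm (T x - x)) 0) => [h|h].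
  by apply/subr0_eq/nrm_le0.
pose K := q / (1 - q) * nrm x.
pose k := (Num.truncn (K / nrm (T x - x))).+1.
have hk : K < k%:R * nrm (T x - x) by rewrite -ltr_pdivrMr// truncnS_gt.
have nk0 : 0 < (n k)%:R :> R by rewrite ltr0n; apply: leq_trans (nk k).
have := step k; rewrite -mulrA ler_pdivlMl// -/K leNgt => /negP[].
apply: lt_le_trans hk _; apply: ler_wpM2r; first exact: ltW.
by rewrite ler_nat nk.
Qed.

Lemma ritt_of_unipotent T M (q : R) (n : nat -> nat) : power_bound T M -> 0 <= q < 1 ->
  spectrum T `<=` open_disc `|` [set 1] -> n 0 = 1 -> (forall k, (k <= n k)%N) ->
  (forall k x, nrm (x - iter (n k) T x) <= q * nrm x) -> ritt T.
Proof.
move=> hT hq sT n0 nk hn; have T1 := unipotent_id hT hq sT n0 nk hn.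
apply: (ritt_of_lower_out hT ltr01) => l x l1.
have -> : l *: x - T x = (l - 1) *: x by rewrite T1 scalerBl scale1r.
by rewrite nrmZ mul1r.
Qed.

End Unipotent.

(** * The Hilbert space of square summable sequences *)

Section RealSums.
Context {R : realType}.
Implicit Types u v : nat -> R.

Definition psum u (n : nat) : R := \sum_(i < n) u i.

(** A one-constructor predicate rather than a convergence statement itself, so
that it does not unfold to a quantified formula. *)
Variant has_sum u (l : R) : Prop := HasSum of psum u @ \oo --> l.

Lemma has_sum_uniq u l m : has_sum u l -> has_sum u m -> l = m.
Proof. by move=> [h1] [h2]; rewrite -(cvg_lim _ h1)// (cvg_lim _ h2). Qed.

Lemma has_sum_ext u v (l : R) : has_sum u l -> u =1 v -> has_sum v l.
Proof. by move=> h /funext <-. Qed.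

Lemma has_sumD u v l m : has_sum u l -> has_sum v m -> has_sum (fun i => u i + v i) (l + m).
Proof.
move=> [h1] [h2]; split; rewrite (_ : psum _ = psum u \+ psum v); first exact: cvgD.
by apply/funext => n; rewrite /psum big_split.
Qed.

Lemma has_sumZ a u l : has_sum u l -> has_sum (fun i => a * u i) (a * l).
Proof.
move=> [h]; split; rewrite (_ : psum _ = (fun n => a * psum u n)); first exact: cvgMl_tmp.
by apply/funext => n; rewrite /psum mulr_sumr.
Qed.

Lemma has_sum_le u l C : has_sum u l -> (forall n, psum u n <= C) -> l <= C.
Proof. by move=> [h] hC; apply: (cvgr_to_le h); exact: nearW. Qed.

Lemma psum_le_sum u l n : (forall i, 0 <= u i) -> has_sum u l -> psum u n <= l.
Proof.
move=> u0 [h]; apply: (cvgr_to_ge h); exists n => // m /= nm.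
rewrite /psum (big_ord_widen _ (fun i => u i) nm) big_mkcond; apply: ler_sum => i _.
by case: ifP.
Qed.

Lemma bounded_has_sum u C : (forall i, 0 <= u i) -> (forall n, psum u n <= C) ->
  exists l, has_sum u l.
Proof.
move=> u0 hC; have : cvgn (psum u).
  apply: nondecreasing_is_cvgn.
    apply/nondecreasing_seqP => n; rewrite /psum big_ord_recr/= lerDl//.
  by exists C => _ [n _ <-].
by move=> h; exists (limn (psum u)); split.
Qed.

(** u = (|u| + u) - |u| is a difference of two nonnegative summable sequences. *)
Lemma abs_has_sum u C : (forall n, psum (fun i => `|u i|) n <= C) -> exists l, has_sum u l.
Proof.
move=> hC; have [l hl] := bounded_has_sum (fun i => normr_ge0 (u i)) hC.
have [m hm] : exists m, has_sum (fun i => `|u i| + u i) m.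
  apply: (@bounded_has_sum _ (C + C)).
    by move=> i; rewrite -lerBlDr sub0r lerNl; have := ler_norm (- u i); rewrite normrN; lra.
  move=> n; rewrite /psum big_split/=; apply: lerD; first exact: hC.
  by apply: le_trans (hC n); apply: ler_sum => i _; exact: ler_norm.
exists (m + -1 * l).
have -> : u = (fun i => (`|u i| + u i) + -1 * `|u i|).
  by apply/funext => i; rewrite mulN1r addrAC subrr add0r.
by apply: has_sumD => //; exact: has_sumZ.
Qed.

End RealSums.

Section SquareSummable.
Context {R : realType}.

Definition square_summable (f : nat -> R[i]) :=
  exists C : R, forall n, psum (fun i => nrm (f i) ^+ 2) n <= C.

Record ell2 := Ell2 { entry :> nat -> R[i]; entry_summable : square_summable entry }.

Lemma ell2_eq (x y : ell2) : (forall i, x i = y i) -> x = y.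
Proof.
case: x y => f hf [g hg] /= h; have e : f = g by apply/funext.
by subst g; congr Ell2; exact: Prop_irrelevance.
Qed.

HB.instance Definition _ := gen_eqMixin ell2.
HB.instance Definition _ := gen_choiceMixin ell2.

Lemma sqr_nrmD (a b : R[i]) : nrm (a + b) ^+ 2 <= 2 * nrm a ^+ 2 + 2 * nrm b ^+ 2.
Proof.
have := nrmD a b; rewrite -(@ler_pXn2r _ 2)// ?nnegrE ?nrm_ge0 ?addr_ge0 ?nrm_ge0//.
by move/le_trans; apply; have := sqr_ge0 (nrm a - nrm b); nra.
Qed.

Lemma summable0 : square_summable (fun=> 0).
Proof. by exists 0 => n; rewrite /psum big1// => i _; rewrite nrm0 expr0n. Qed.

Lemma summableD f g : square_summable f -> square_summable g ->
  square_summable (fun i => f i + g i).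
Proof.
move=> [C hC] [D hD]; exists (2 * C + 2 * D) => n.
apply: (@le_trans _ _ (2 * psum (fun i => nrm (f i) ^+ 2) n + 2 * psum (fun i => nrm (g i) ^+ 2) n)).
  by rewrite /psum !mulr_sumr -big_split; apply: ler_sum => i _; exact: sqr_nrmD.
by apply: lerD; rewrite ler_pM2l.
Qed.

Lemma summableM (l : nat -> R[i]) K f : (forall i, nrm (l i) <= K) -> square_summable f ->
  square_summable (fun i => l i * f i).
Proof.
move=> hl [C hC]; exists (K ^+ 2 * C) => n.
have K0 : 0 <= K by apply: le_trans (hl 0%N); exact: nrm_ge0.
apply: (@le_trans _ _ (K ^+ 2 * psum (fun i => nrm (f i) ^+ 2) n)).
  rewrite /psum mulr_sumr; apply: ler_sum => i _; rewrite nrmM exprMn.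
  by apply: ler_wpM2r; [exact: sqr_ge0|apply: lerXn2r; rewrite ?nnegrE ?nrm_ge0].
by apply: ler_wpM2l; first exact: sqr_ge0.
Qed.

Lemma summableZ (a : R[i]) f : square_summable f -> square_summable (fun i => a * f i).
Proof. exact: summableM. Qed.

Lemma summableN f : square_summable f -> square_summable (fun i => - f i).
Proof. by case=> C hC; exists C => n; apply: le_trans (hC n); apply: ler_sum => i _; rewrite nrmN. Qed.

Definition ell2_zero := Ell2 summable0.
Definition ell2_add (x y : ell2) := Ell2 (summableD (entry_summable x) (entry_summable y)).
Definition ell2_opp (x : ell2) := Ell2 (summableN (entry_summable x)).
Definition ell2_scale (a : R[i]) (x : ell2) := Ell2 (summableZ a (entry_summable x)).

Lemma ell2_addA : associative ell2_add.
Proof. by move=> x y z; apply: ell2_eq => i /=; rewrite addrA. Qed.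
Lemma ell2_addC : commutative ell2_add.
Proof. by move=> x y; apply: ell2_eq => i /=; rewrite addrC. Qed.
Lemma ell2_add0 : left_id ell2_zero ell2_add.
Proof. by move=> x; apply: ell2_eq => i /=; rewrite add0r. Qed.
Lemma ell2_addN : left_inverse ell2_zero ell2_opp ell2_add.
Proof. by move=> x; apply: ell2_eq => i /=; rewrite addNr. Qed.

HB.instance Definition _ :=
  GRing.isZmodule.Build ell2 ell2_addA ell2_addC ell2_add0 ell2_addN.

Lemma ell2_scaleA a b (x : ell2) : ell2_scale a (ell2_scale b x) = ell2_scale (a * b) x.
Proof. by apply: ell2_eq => i /=; rewrite mulrA. Qed.
Lemma ell2_scale1 : left_id 1 ell2_scale.
Proof. by move=> x; apply: ell2_eq => i /=; rewrite mul1r. Qed.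
Lemma ell2_scaleDr : right_distributive ell2_scale +%R.
Proof. by move=> a x y; apply: ell2_eq => i /=; rewrite mulrDr. Qed.
Lemma ell2_scaleDl (x : ell2) : {morph ell2_scale^~ x : a b / a + b}.
Proof. by move=> a b; apply: ell2_eq => i /=; rewrite mulrDl. Qed.

HB.instance Definition _ := GRing.Zmodule_isLmodule.Build R[i] ell2
  ell2_scaleA ell2_scale1 ell2_scaleDr ell2_scaleDl.

Lemma entryD (x y : ell2) i : (x + y) i = x i + y i. Proof. by []. Qed.
Lemma entryZ a (x : ell2) i : (a *: x) i = a * x i. Proof. by []. Qed.
Lemma entryB (x y : ell2) i : (x - y) i = x i - y i. Proof. by []. Qed.

Definition re_term (x y : ell2) i : R := complex.Re (x i * conjc (y i)).
Definition im_term (x y : ell2) i : R := complex.Im (x i * conjc (y i)).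

Lemma nrm_conjc (z : R[i]) : nrm (conjc z) = nrm z.
Proof. by rewrite /nrm normcJ. Qed.

Lemma prod_summable (x y : ell2) (u : nat -> R) :
  (forall i, `|u i| <= nrm (x i * conjc (y i))) -> exists l, has_sum u l.
Proof.
move=> hu; have [C hC] := entry_summable x; have [D hD] := entry_summable y.
apply: (@abs_has_sum _ _ (C + D)) => n.
apply: (@le_trans _ _ (psum (fun i => nrm (x i) ^+ 2) n + psum (fun i => nrm (y i) ^+ 2) n)).
  rewrite /psum -big_split/=; apply: ler_sum => i _; apply: le_trans (hu i) _.
  rewrite nrmM nrm_conjc; have := sqr_ge0 (nrm (x i) - nrm (y i)).
  by have := mulr_ge0 (nrm_ge0 (x i)) (nrm_ge0 (y i)); rewrite sqrrB mulr2n; lra.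
exact: lerD.
Qed.

Lemma re_summable x y : exists l, has_sum (re_term x y) l.
Proof. by apply: (@prod_summable x y) => i; exact: nrm_geRe. Qed.

Lemma im_summable x y : exists l, has_sum (im_term x y) l.
Proof. by apply: (@prod_summable x y) => i; exact: nrm_geIm. Qed.

Definition re_dot x y := sval (cid (re_summable x y)).
Definition im_dot x y := sval (cid (im_summable x y)).

Lemma re_dotP x y : has_sum (re_term x y) (re_dot x y).
Proof. exact: svalP. Qed.
Lemma im_dotP x y : has_sum (im_term x y) (im_dot x y).
Proof. exact: svalP. Qed.

Definition ell2_dot (x y : ell2) : R[i] := Complex (re_dot x y) (im_dot x y).

Lemma ell2_dotE x y a b : has_sum (re_term x y) a -> has_sum (im_term x y) b ->
  ell2_dot x y = Complex a b.
Proof.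
by move=> h1 h2; rewrite /ell2_dot (has_sum_uniq (re_dotP x y) h1) (has_sum_uniq (im_dotP x y) h2).
Qed.

Lemma ell2_dot_linearl y : GRing.linear_for ( *%R ) (ell2_dot ^~ y).
Proof.
move=> a x x'; have h1 := re_dotP x y; have h2 := im_dotP x y.
have h3 := re_dotP x' y; have h4 := im_dotP x' y.
rewrite (@ell2_dotE _ _ (complex.Re a * re_dot x y + - complex.Im a * im_dot x y + re_dot x' y)
  (complex.Re a * im_dot x y + complex.Im a * re_dot x y + im_dot x' y)).
- by rewrite /ell2_dot; case: a => ar ai; apply: complex_ext => /=; rewrite ?mulNr.
- apply: (has_sum_ext (has_sumD (has_sumD (has_sumZ _ h1) (has_sumZ _ h2)) h3)) => i.
  rewrite /re_term /im_term /=; case: (x i) (x' i) (y i) a => [? ?] [? ?] [? ?] [? ?] /=; ring.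
- apply: (has_sum_ext (has_sumD (has_sumD (has_sumZ _ h2) (has_sumZ _ h1)) h4)) => i.
  rewrite /re_term /im_term /=; case: (x i) (x' i) (y i) a => [? ?] [? ?] [? ?] [? ?] /=; ring.
Qed.

Lemma ell2_dotC x y : ell2_dot x y = (-1) ^+ false * Num.conj (ell2_dot y x).
Proof.
rewrite expr0 mul1r (@ell2_dotE _ _ (re_dot y x) (-1 * im_dot y x)).
- by apply: complex_ext => //=; rewrite mulN1r.
- apply: (has_sum_ext (re_dotP y x)) => i; rewrite /re_term.
  by case: (x i) (y i) => [? ?] [? ?] /=; ring.
- apply: (has_sum_ext (has_sumZ _ (im_dotP y x))) => i; rewrite /im_term.
  by case: (x i) (y i) => [? ?] [? ?] /=; ring.
Qed.

Lemma ell2_dot_linearr x : GRing.linear_for (Num.conj \; *%R ) (ell2_dot x).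
Proof.
move=> a y y'; rewrite !(ell2_dotC x) !expr0 !mul1r ell2_dot_linearl /=.
by rewrite (rmorphD Num.conj) (rmorphM Num.conj).
Qed.

Lemma ell2_dot_bilinear : bilinear_for ( *%R ) (Num.conj \; *%R ) ell2_dot.
Proof. by split; [exact: ell2_dot_linearl|exact: ell2_dot_linearr]. Qed.

Definition sqnorm (x : ell2) := re_dot x x.

Lemma sqnormP (x : ell2) : has_sum (fun i => nrm (x i) ^+ 2) (sqnorm x).
Proof.
apply: (has_sum_ext (re_dotP x x)) => i; rewrite /re_term nrm_sqr.
by case: (x i) => [? ?] /=; ring.
Qed.


Lemma ell2_dotxx x : ell2_dot x x = (sqnorm x)%:C%C.
Proof.
rewrite /ell2_dot /sqnorm; congr Complex; apply: (has_sum_uniq (im_dotP x x)).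
have -> : im_term x x = (fun i => 0 * re_term x x i).
  by apply/funext => i; rewrite /im_term mul0r; case: (x i) => [? ?] /=; ring.
by have := has_sumZ 0 (re_dotP x x); rewrite mul0r.
Qed.

Lemma sqnorm_ge (x : ell2) n : psum (fun i => nrm (x i) ^+ 2) n <= sqnorm x.
Proof. by apply: (psum_le_sum _ _ (sqnormP x)) => i; exact: sqr_ge0. Qed.

Lemma sqnorm_le (x : ell2) C : (forall n, psum (fun i => nrm (x i) ^+ 2) n <= C) -> sqnorm x <= C.
Proof. exact: has_sum_le (sqnormP x). Qed.

Lemma sqnorm_ge0 x : 0 <= sqnorm x.
Proof. by have := sqnorm_ge x 0; rewrite /psum big_ord0. Qed.

Lemma entry_le (x : ell2) i : nrm (x i) ^+ 2 <= sqnorm x.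
Proof.
apply: le_trans (sqnorm_ge x i.+1); rewrite /psum big_ord_recr/= lerDr.
by apply: sumr_ge0 => j _; exact: sqr_ge0.
Qed.

Lemma sqnorm_eq0 x : sqnorm x <= 0 -> x = 0.
Proof.
move=> h; apply: ell2_eq => i; apply: nrm_eq0; apply/eqP.
by rewrite -sqrf_eq0; apply/eqP/le_anti; rewrite sqr_ge0 (le_trans (entry_le x i)).
Qed.

Lemma ell2_dot_gt0 x : x != 0 -> 0 < ell2_dot x x.
Proof.
move=> x0; rewrite ell2_dotxx ltcR lt_neqAle sqnorm_ge0 andbT eq_sym.
by apply: contra_neq x0 => h; apply: sqnorm_eq0; rewrite h.
Qed.

HB.instance Definition _ := bilinear_isBilinear.Build R[i] ell2 ell2 R[i]
  ( *%R ) (Num.conj \; *%R ) ell2_dot ell2_dot_bilinear.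
HB.instance Definition _ := isHermitianSesquilinear.Build R[i] ell2 false Num.conj ell2_dot ell2_dotC.
HB.instance Definition _ := isDotProduct.Build R[i] ell2 ell2_dot ell2_dot_gt0.

Definition ell2_norm (x : ell2) : R := Num.sqrt (sqnorm x).

Lemma sqr_ell2_norm x : ell2_norm x ^+ 2 = sqnorm x.
Proof. by rewrite sqr_sqrtr// sqnorm_ge0. Qed.

Lemma ell2_norm_le (x : ell2) C : 0 <= C -> (forall n, psum (fun i => nrm (x i) ^+ 2) n <= C ^+ 2) ->
  ell2_norm x <= C.
Proof.
move=> C0 h; rewrite -(@ler_pXn2r _ 2)// ?nnegrE ?sqrtr_ge0// sqr_ell2_norm.
exact: sqnorm_le.
Qed.

(** The factor t/s is chosen so that summing the inequality over the coordinates
gives exactly (s + t)^2 when s and t are the two norms. *)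
Lemma sqr_young (a b s t : R) : 0 < s -> 0 < t ->
  (a + b) ^+ 2 <= (1 + t / s) * a ^+ 2 + (1 + s / t) * b ^+ 2.
Proof.
move=> s0 t0; rewrite -subr_ge0.
have -> : (1 + t / s) * a ^+ 2 + (1 + s / t) * b ^+ 2 - (a + b) ^+ 2 =
   (t * a - s * b) ^+ 2 / (s * t) by field; rewrite !gt_eqF.
by rewrite divr_ge0 ?sqr_ge0// ltW// mulr_gt0.
Qed.

(** Minkowski's inequality, by summing the weighted Young inequality with the
ratio of the two norms as weight; the zero vectors are treated separately. *)
Lemma ell2_normD x y : ell2_norm (x + y) <= ell2_norm x + ell2_norm y.
Proof.
set s := ell2_norm x; set t := ell2_norm y.
have n0 z : ell2_norm z = 0 -> z = 0.
  by move=> h; apply: sqnorm_eq0; rewrite -sqr_ell2_norm h expr0n.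
have s0 : 0 <= s by exact: sqrtr_ge0.
have t0 : 0 <= t by exact: sqrtr_ge0.
move: s0; rewrite le_eqVlt => /predU1P[/esym s0|s0].
  by rewrite (n0 x s0) add0r s0 add0r.
move: t0; rewrite le_eqVlt => /predU1P[/esym t0|t0].
  by rewrite (n0 y t0) addr0 t0 addr0.
apply: ell2_norm_le => [|n]; first by rewrite addr_ge0 ?ltW.
apply: (@le_trans _ _ ((1 + t / s) * psum (fun i => nrm (x i) ^+ 2) n +
   (1 + s / t) * psum (fun i => nrm (y i) ^+ 2) n)).
  rewrite /psum !mulr_sumr -big_split; apply: ler_sum => i _ /=.
  apply: le_trans (sqr_young _ _ s0 t0).
  by apply: lerXn2r; rewrite ?nnegrE ?nrm_ge0 ?addr_ge0 ?nrm_ge0 ?nrmD.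
have k1 : 0 <= 1 + t / s by rewrite addr_ge0// ltW// divr_gt0.
have k2 : 0 <= 1 + s / t by rewrite addr_ge0// ltW// divr_gt0.
apply: (@le_trans _ _ ((1 + t / s) * s ^+ 2 + (1 + s / t) * t ^+ 2)).
  by apply: lerD; apply: ler_wpM2l => //; rewrite sqr_ell2_norm sqnorm_ge.
rewrite le_eqVlt; apply/orP; left; apply/eqP.
by field; rewrite !gt_eqF.
Qed.

Lemma ell2_normZ a x : ell2_norm (a *: x) = nrm a * ell2_norm x.
Proof.
have h : sqnorm (a *: x) = nrm a ^+ 2 * sqnorm x.
  apply: (has_sum_uniq (sqnormP _)).
  by apply: (has_sum_ext (has_sumZ _ (sqnormP x))) => i; rewrite entryZ nrmM exprMn.
by rewrite /ell2_norm h sqrtrM ?sqr_ge0// sqrtr_sqr ger0_norm// nrm_ge0.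
Qed.

Lemma ell2C_normD (x y : ell2) :
  (ell2_norm (x + y))%:C%C <= (ell2_norm x)%:C%C + (ell2_norm y)%:C%C :> R[i].
Proof. by rewrite -rmorphD lecR ell2_normD. Qed.

Lemma ell2C_normZ (a : R[i]) (x : ell2) :
  (ell2_norm (a *: x))%:C%C = `|a| * (ell2_norm x)%:C%C :> R[i].
Proof. by rewrite ell2_normZ rmorphM/= nrmE. Qed.

Lemma ell2C_norm0 (x : ell2) : (ell2_norm x)%:C%C = 0 :> R[i] -> x = 0.
Proof.
by case=> h; apply: sqnorm_eq0; rewrite -sqr_ell2_norm h expr0n.
Qed.

HB.instance Definition _ := Lmodule_isNormed.Build R[i] ell2
  ell2C_normD ell2C_normZ ell2C_norm0.

Lemma nrm_ell2 (x : ell2) : nrm x = ell2_norm x.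
Proof. by []. Qed.

End SquareSummable.

Section Completeness.
Context {R : realType}.

(** The limit is the supremum of the lower bounds u_n - 1/(n+1). *)
Lemma fast_cauchy_limit (u : nat -> R) :
  (forall n m, `|u n - u m| <= harmonic n + harmonic m) ->
  exists l, forall n, `|u n - l| <= harmonic n.
Proof.
move=> h; pose E := [set u n - harmonic n | n in [set: nat]].
have ub m x : E x -> x <= u m + harmonic m.
  by case=> n _ <-; have := h n m; rewrite ler_norml => /andP[_]; lra.
exists (sup E) => m; have h1 : sup E <= u m + harmonic m.
  by apply: ge_sup; [exists (u 0%N - harmonic 0); exists 0%N|exact: ub].
have h2 : u m - harmonic m <= sup E.
  by apply: ub_le_sup; [exists (u 0%N + harmonic 0); exact: ub|exists m].
by rewrite ler_norml; apply/andP; split; lra.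
Qed.

Lemma fast_cauchy_limitC (u : nat -> R[i]) :
  (forall n m, nrm (u n - u m) <= harmonic n + harmonic m) ->
  exists l, forall n, nrm (u n - l) <= 2 * harmonic n.
Proof.
move=> h; have [|a ha] := @fast_cauchy_limit (fun n => complex.Re (u n)).
  by move=> n m; apply: le_trans (h n m); apply: le_trans (nrm_geRe _); case: (u n) (u m) => [? ?] [? ?].
have [|b hb] := @fast_cauchy_limit (fun n => complex.Im (u n)).
  by move=> n m; apply: le_trans (h n m); apply: le_trans (nrm_geIm _); case: (u n) (u m) => [? ?] [? ?].
exists (Complex a b) => n; apply: le_trans (nrm_le_ReIm _) _.
have -> : complex.Re (u n - Complex a b) = complex.Re (u n) - a by case: (u n).
have -> : complex.Im (u n - Complex a b) = complex.Im (u n) - b by case: (u n).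
by rewrite mulr_natl mulr2n; apply: lerD; [exact: ha|exact: hb].
Qed.

(** A Cauchy filter contains balls of radius 1/(n+1) around points u_n; these
converge coordinatewise to some g. On the first N coordinates the distance
from u_n to g is compared with the distance from u_n to u_m for m so large
that N coordinatewise errors are negligible; the resulting bound does not
depend on N. *)
Lemma ell2_complete (F : set_system (@ell2 R)) : ProperFilter F -> cauchy F -> cvg F.
Proof.
move=> FF /cauchyP cF.
have eps0 n : 0 < (harmonic n)%:C%C :> R[i] by rewrite ltcR harmonic_gt0.
have [u hu] := choice (fun n => cF _ (eps0 n)).
have inball (x y : @ell2 R) (r : R) : ball x r%:C%C y -> nrm (x - y) < r.
  by rewrite -ball_normE/= nrmE ltcR.
have du n m : nrm (u n - u m) <= harmonic n + harmonic m.
  have [z [z1 z2]] := filter_ex (filterI (hu n) (hu m)).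
  have -> : u n - u m = (u n - z) - (u m - z) by rewrite opprB addrA subrK.
  by apply: le_trans (nrmB _ _) _; apply: lerD; apply: ltW; exact: inball.
have sq (x : @ell2 R) N : psum (fun i => nrm (x i) ^+ 2) N <= nrm x ^+ 2.
  by rewrite nrm_ell2 sqr_ell2_norm; exact: sqnorm_ge.
have ent (x : @ell2 R) i : nrm (x i) <= nrm x.
  by rewrite -(@ler_pXn2r _ 2)// ?nnegrE ?nrm_ge0// nrm_ell2 sqr_ell2_norm entry_le.
have /choice[g hg] : forall i, exists l, forall n, nrm (u n i - l) <= 2 * harmonic n.
  move=> i; apply: fast_cauchy_limitC => n m.
  by apply: le_trans (du n m); rewrite -entryB; exact: ent.
have dg n N : psum (fun i => nrm (u n i - g i) ^+ 2) N <= (4 * harmonic n) ^+ 2.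
  (* N + 1 errors of size 1/(m+1) add up to at most 1/(n+1) *)
  pose m := (N * n.+1 + n)%N; set a : R := harmonic n; set b : R := harmonic m.
  have b0 : 0 < b by exact: harmonic_gt0.
  have ba : N.+1%:R * b <= a.
    rewrite /a /b /harmonic/= ler_pdivrMr ?ltr0n// mulrC ler_pdivlMr ?ltr0n// -natrM ler_nat /m; lia.
  have Nb : N%:R * b <= a.
    by apply: le_trans ba; rewrite ler_pM2r// ler_nat.
  have b_le : b <= a by apply: le_trans ba; rewrite -natr1 mulrDl mul1r lerDr mulr_ge0// ltW.
  have a1 : 0 <= a by exact: ltW (harmonic_gt0 _).
  have h i : nrm (u n i - g i) ^+ 2 <= 2 * nrm ((u n - u m) i) ^+ 2 + 8 * b ^+ 2.
    have -> : u n i - g i = (u n - u m) i + (u m i - g i) by rewrite entryB addrA subrK.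
    apply: le_trans (sqr_nrmD _ _) _; rewrite lerD2l.
    have := hg i m; rewrite -/b -(@ler_pXn2r _ 2)// ?nnegrE ?nrm_ge0 ?mulr_ge0 ?(ltW b0)// exprMn.
    lra.
  apply: (@le_trans _ _ (2 * psum (fun i => nrm ((u n - u m) i) ^+ 2) N + N%:R * (8 * b ^+ 2))).
    have -> : N%:R * (8 * b ^+ 2) = \sum_(i < N) 8 * b ^+ 2 by rewrite sumr_const card_ord mulr_natl.
    rewrite /psum mulr_sumr -big_split/=.
    by apply: ler_sum => i _; exact: h.
  have d1 : nrm (u n - u m) ^+ 2 <= (a + b) ^+ 2.
    by apply: lerXn2r; rewrite ?nnegrE ?nrm_ge0 ?addr_ge0 ?(ltW b0)//; exact: du.
  have d2 : (a + b) ^+ 2 <= (a + a) ^+ 2.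
    by apply: lerXn2r; rewrite ?nnegrE ?addr_ge0 ?(ltW b0)// lerD2l.
  have d3 : N%:R * (8 * b ^+ 2) <= 8 * a ^+ 2.
    have : N%:R * b * b <= a * a by apply: ler_pM => //; rewrite ?mulr_ge0// ?(ltW b0).
    by rewrite !expr2; lra.
  have := sq (u n - u m) N; move: d2; rewrite !expr2; lra.
have sg n : square_summable (fun i => u n i - g i) by exists ((4 * harmonic n) ^+ 2); exact: dg.
have gs : square_summable g.
  have := summableD (entry_summable (u 0%N)) (summableN (sg 0%N)).
  by congr square_summable; apply/funext => i; rewrite opprB addrCA subrr addr0.
pose G := Ell2 gs.
have ug n : nrm (u n - G) <= 4 * harmonic n.
  rewrite nrm_ell2; apply: ell2_norm_le; first by rewrite mulr_ge0// ltW ?harmonic_gt0.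
  by move=> N; exact: dg.
apply/cvg_ex; exists G; apply/cvg_ballP => _ /pos_complexP[e e0 ->].
pose n := Num.truncn (5 / e).
have n5 : 5 * harmonic n < e.
  by rewrite /harmonic/= ltr_pdivrMr ?ltr0n// mulrC -ltr_pdivrMr// truncnS_gt.
apply: filterS (hu n) => y /inball yn.
rewrite -ball_normE/= nrmE ltcR.
have -> : G - y = (u n - y) - (u n - G) by rewrite opprB addrCA [u n - y]addrC addrK.
by apply: le_lt_trans (nrmB _ _) _; have := ug n; lra.
Qed.

HB.instance Definition _ := Uniform_isComplete.Build (@ell2 R) ell2_complete.

End Completeness.

(** * Diagonal operators *)

Section Diagonal.
Context {R : realType}.
Notation H := (@ell2 R).
Implicit Types (T : {linear H -> H}) (l : nat -> R[i]).

Definition diagonal (A : H -> H) l := forall (x : H) i, entry (A x) i = l i * entry x i.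

Lemma diagonal_ex l K : (forall i, nrm (l i) <= K) -> exists T, diagonal T l.
Proof.
move=> hl; pose f (x : H) : H := Ell2 (summableM hl (entry_summable x)).
have [|T hT] := @linear_pack _ _ f.
  by move=> a x y; apply: ell2_eq => i; rewrite [RHS]entryD entryZ /= mulrDr mulrCA.
by exists T => x i; rewrite hT.
Qed.

Lemma diagonal_bound A l K : diagonal A l -> (forall i, nrm (l i) <= K) ->
  forall x, nrm (A x) <= K * nrm x.
Proof.
move=> hA hl x; have K0 : 0 <= K by apply: le_trans (hl 0%N); exact: nrm_ge0.
rewrite !nrm_ell2; apply: ell2_norm_le => [|n]; first by rewrite mulr_ge0// sqrtr_ge0.
rewrite exprMn sqr_ell2_norm; apply: (@le_trans _ _ (K ^+ 2 * psum (fun i => nrm (entry x i) ^+ 2) n)).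
  rewrite /psum mulr_sumr; apply: ler_sum => i _; rewrite hA nrmM exprMn.
  by apply: ler_wpM2r; [exact: sqr_ge0|apply: lerXn2r; rewrite ?nnegrE ?nrm_ge0].
by apply: ler_wpM2l; [exact: sqr_ge0|exact: sqnorm_ge].
Qed.

Lemma diagonal_iter T l m : diagonal T l -> diagonal (iter m T) (fun i => l i ^+ m).
Proof.
move=> hT x i; elim: m => [|m IH]; first by rewrite expr0 mul1r.
by rewrite iterS hT IH exprS mulrA.
Qed.

Lemma diagonal_pencil z A l : diagonal A l -> diagonal (pencil z A) (fun i => z - l i).
Proof. by move=> hA x i; rewrite /pencil entryB entryZ hA mulrBl. Qed.

Lemma diagonal_inverse A l (d : R) : 0 < d -> diagonal A l -> (forall i, d <= nrm (l i)) ->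
  exists S : {linear H -> H}, bounded_inverse A S /\ forall x, nrm (S x) <= d^-1 * nrm x.
Proof.
move=> d0 hA hd; have l0 i : l i != 0.
  by apply/eqP => h; have := hd i; rewrite h nrm0 leNgt d0.
have hl i : nrm (l i)^-1 <= d^-1.
  by rewrite nrmV lef_pV2 ?posrE// (lt_le_trans d0).
have [S hS] := diagonal_ex hl; exists S; split; last exact: diagonal_bound hS hl.
split; first exact: linear_continuous (diagonal_bound hS hl).
- by move=> x; apply: ell2_eq => i; rewrite hS hA mulrA mulVf// mul1r.
- by move=> x; apply: ell2_eq => i; rewrite hA hS mulrA divff// mul1r.
Qed.

Lemma diagonal_invnorm A l (d : R) : 0 < d -> diagonal A l -> (forall i, d <= nrm (l i)) ->
  (invnorm A <= (d^-1)%:E)%E.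
Proof.
move=> d0 hA hd; have [S [hS hb]] := diagonal_inverse d0 hA hd.
by apply: (invnorm_le _ hS hb); rewrite invr_ge0 ltW.
Qed.

Lemma diagonal_spectrum T l z (d : R) : 0 < d -> diagonal T l -> (forall i, d <= nrm (z - l i)) ->
  ~ spectrum T z.
Proof.
move=> d0 hT hd; apply; have [S [hS _]] := diagonal_inverse d0 (diagonal_pencil z hT) hd.
by exists S.
Qed.

(** Finitely many eigenvalues stay away from z since they are in the open disc,
and the others are close to 1. *)
Lemma diagonal_spectrum_disc T l : diagonal T l -> (forall i, nrm (l i) < 1) ->
  (forall e : R, 0 < e -> exists k, forall i, (k <= i)%N -> nrm (l i - 1) <= e) ->
  spectrum T `<=` open_disc `|` [set 1].
Proof.
move=> hT l1 lim z hz; apply: contrapT => hn.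
have z1 : z != 1 by apply/eqP => h; apply: hn; right.
have nz : 1 <= nrm z.
  rewrite leNgt; apply/negP => h; apply: hn; left.
  by rewrite /open_disc/= nrm_lt1.
have dz : 0 < nrm (z - 1).
  by rewrite nrm_gt0 subr_eq0.
have [|k hk] := lim (nrm (z - 1) / 2); first by rewrite divr_gt0.
have [d d0 hd] : exists2 d : R, 0 < d & forall i, (i < k)%N -> d <= nrm (z - l i).
  elim: k {hk} => [|k [d d0 hd]]; first by exists 1.
  have pk : 0 < nrm (z - l k).
    apply: lt_le_trans (nrm_lerB _ _); rewrite subr_gt0; exact: lt_le_trans (l1 k) nz.
  exists (Num.min d (nrm (z - l k))); first by rewrite lt_min d0.
  move=> i; rewrite ltnS leq_eqVlt => /predU1P[->|/hd h]; first by rewrite ge_min lexx orbT.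
  by rewrite ge_min h.
have dd : 0 < Num.min d (nrm (z - 1) / 2) by rewrite lt_min d0 divr_gt0.
apply: (diagonal_spectrum dd hT _ hz) => i; case: (ltnP i k) => ik.
  by rewrite ge_min hd.
rewrite ge_min; apply/orP; right.
have := nrm_lerB (z - 1) (l i - 1); have -> : z - 1 - (l i - 1) = z - l i by rewrite opprB addrA subrK.
have := hk i ik; lra.
Qed.

Lemma diagonal_power_bound T l : diagonal T l -> (forall i, nrm (l i) <= 1) -> power_bound T 1.
Proof.
move=> hT l1; split=> // m; apply: (diagonal_bound (diagonal_iter m hT)) => i.
by rewrite nrmX exprn_ile1// nrm_ge0.
Qed.

(** The adjoint is the diagonal operator with the conjugate eigenvalues. *)
Lemma diagonal_normal T l : diagonal T l -> (forall i, nrm (l i) <= 1) -> normal_contraction T.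
Proof.
move=> hT l1; have hp := diagonal_power_bound hT l1.
have l1' i : nrm (conjc (l i)) <= 1 by rewrite nrm_conjc.
have [S hS] := diagonal_ex l1'.
exists (ell2_dot : {dot H for Num.conj}); split.
- by move=> x; rewrite -[LHS]/(ell2_dot x x) ell2_dotxx nrmE -rmorphXn/= nrm_ell2 sqr_ell2_norm.
- exact: power_bound_continuous hp.
- by apply: opnorm_le => // x; exact: power_bound1.
- exists S; split.
  + exact: linear_continuous (diagonal_bound hS l1').
  + move=> x y; change (ell2_dot (T x) y = ell2_dot x (S y)); apply: ell2_dotE; [apply: (has_sum_ext (re_dotP x (S y)))|apply: (has_sum_ext (im_dotP x (S y)))] => i;
      rewrite /re_term /im_term hT hS; case: (entry x i) (entry y i) (l i) => [? ?] [? ?] [? ?] /=; ring.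
  + by move=> x; apply: ell2_eq => i /=; rewrite hT hS hS hT mulrCA.
Qed.

Definition unit_vec (j : nat) : nat -> R[i] := fun i => (i == j)%:R.

Lemma unit_vec_summable j : square_summable (unit_vec j).
Proof.
exists 1 => n; rewrite /psum.
apply: (@le_trans _ _ (\sum_(i < n) (if (i == j :> nat) then 1 else 0))).
  apply: ler_sum => i _; rewrite /unit_vec; case: eqP => _; first by rewrite nrm1 expr1n.
  by rewrite nrm0 expr0n.
case: (ltnP j n) => jn.
  rewrite (bigD1 (Ordinal jn))//= eqxx big1 ?addr0// => i /eqP h.
  by case: eqP => // e; case: h; apply: val_inj.
rewrite big1 ?ler01// => i _; case: eqP => // e.
by have := ltn_ord i; rewrite e ltnNge jn.
Qed.

Definition basis_vec j : H := Ell2 (unit_vec_summable j).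

Lemma diagonal_basis T l j : diagonal T l -> T (basis_vec j) = l j *: basis_vec j.
Proof.
move=> hT; apply: ell2_eq => i; rewrite hT entryZ /= /unit_vec.
by case: eqP => [->|_]//; rewrite !mulr0.
Qed.

Lemma basis_vec_gt0 j : 0 < nrm (basis_vec j).
Proof.
rewrite nrm_gt0; apply/eqP => h.
have := congr1 (fun x : H => entry x j) h; rewrite /= /unit_vec eqxx => /eqP.
by rewrite oner_eq0.
Qed.

(** Testing the Ritt bound at l = s e^{it} with s > 1 on the eigenvector gives |l
- 1| <= K (s - r), and |Im l| = s sin t; then s tends to 1. So r must not tend
to 1 faster than the angle tends to 0. *)
Lemma diagonal_ritt T (r t : nat -> R) : (forall i, 0 < r i <= 1) ->
  diagonal T (fun i => (r i)%:C%C * expi (t i)) -> ritt T ->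
  exists K : R, forall i, sin (t i) <= K * (1 - r i).
Proof.
move=> hr hT /ritt_lower[K K0 hK]; exists K => j.
have /andP[r0 r1] := hr j.
apply/ler_addgt0Pr => e e0.
pose s := 1 + e / K.
have eK : 0 < e / K by rewrite divr_gt0.
have s1 : 1 < s by rewrite ltrDl.
have s0 : 0 < s by apply: lt_trans s1.
have := hK (s%:C%C * expi (t j)) (basis_vec j).
rewrite nrmM nrm_real nrm_expi mulr1 gtr0_norm// => /(_ s1).
rewrite (diagonal_basis j hT) -scalerBl nrmZ mulrA ler_pM2r ?basis_vec_gt0//.
rewrite -mulrBl nrmM nrm_expi mulr1 -rmorphB nrm_real ger0_norm; last by rewrite subr_ge0 ltW// (le_lt_trans r1).
have -> : K * (s - r j) = K * (1 - r j) + e by rewrite /s; field; rewrite gt_eqF.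
apply: le_trans.
apply: le_trans (nrm_geIm _); rewrite /= mul0r addr0 subr0.
case: (leP (sin (t j)) 0) => h; first exact: le_trans h (normr_ge0 _).
by rewrite gtr0_norm ?mulr_gt0// ler_peMl// ltW.
Qed.

End Diagonal.

(** * Tangential examples *)

Section Geometry.
Context {R : realType}.

(** Radial contraction of w at most halves its distance to a point z of the
circle, because z - aw is at least 1 - a in modulus. *)
Lemma half_dist (z w : R[i]) (a : R) : nrm z = 1 -> nrm w = 1 -> 0 <= a <= 1 ->
  nrm (z - w) <= 2 * nrm (z - a%:C%C * w).
Proof.
move=> z1 w1 /andP[a0 a1].
have -> : z - w = (z - a%:C%C * w) - (1 - a)%:C%C * w.
  by rewrite rmorphB rmorph1 mulrBl mul1r opprB addrA subrK.
apply: le_trans (nrmB _ _) _; rewrite nrmM w1 mulr1 nrm_real ger0_norm ?subr_ge0//.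
have := nrm_lerB z (a%:C%C * w); rewrite z1 nrmM w1 mulr1 nrm_real ger0_norm//; lra.
Qed.

Lemma dist_one_convex (w : R[i]) (a q : R) : 0 <= a <= 1 -> 1 <= q -> nrm (1 - w) <= q ->
  nrm (1 - a%:C%C * w) <= q.
Proof.
move=> /andP[a0 a1] q1 wq.
have -> : 1 - a%:C%C * w = (1 - a)%:C%C + a%:C%C * (1 - w).
  by rewrite rmorphB rmorph1 mulrBr mulr1 addrA subrK.
apply: le_trans (nrmD _ _) _; rewrite nrmM !nrm_real !ger0_norm ?subr_ge0//; nra.
Qed.

Lemma expi_dist_sqr (t : R) : nrm (1 - expi t) ^+ 2 = 2 - 2 * cos t.
Proof.
rewrite nrm_sqr/=; have := cos2Dsin2 t; rewrite sub0r sqrrN sqrrB expr1n mul1r mulr2n; lra.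
Qed.

Lemma pi_le4 : pi <= 4 :> R.
Proof.
rewrite leNgt; apply/negP => p4; have := cos2_lt0 R; rewrite ltNge => /negP; apply.
by apply: cos_ge0_pihalf; apply/andP; split; lra.
Qed.

(** Compactness of closed arcs enters only through this maximum of the real part. *)
Lemma arc_max_cos (G : set R[i]) : closed_arc G ->
  exists2 t0 : R, G (expi t0) & forall z, G z -> complex.Re z <= cos t0.
Proof.
move=> [a [b [ab _ ->]]].
have cc : {within `[a, b], continuous (@cos R)}.
  by apply: continuous_subspaceT => x; exact: continuous_cos.
have [t0 t0ab ht] := EVT_max (ltW ab) cc.
by exists t0; [exists t0|move=> _ [t tab <-] /=; exact: ht].
Qed.

End Geometry.

(** The angle at which the arc of ratio b starts; its multiples by powers of b are
congruent to plus or minus itself modulo 2 pi. *)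
Definition base_angle {R : realType} (b : nat) : R := 2 * pi / (b%:R + 1).

Section TangentialExample.
Context {R : realType}.
Notation H := (@ell2 R).
Variable b : nat.
Hypothesis b2 : (2 <= b)%N.
Local Notation a := (@base_angle R b).
Let th (j : nat) : R := a / b%:R ^+ j.
Let r (j : nat) : R := 1 - th j / (j%:R + 4).

Lemma base_ge2 : 2 <= b%:R :> R. Proof. by rewrite ler_nat. Qed.

Lemma base_angle_bounds : 0 < a /\ a <= 8 / 3 /\ a <= pi /\ b%:R * a = 2 * pi - a.
Proof.
have p0 := pi_gt0 R; have pi4 := @pi_le4 R; have b2R := base_ge2.
have h : a * (b%:R + 1) = 2 * pi by rewrite /base_angle divfK// gt_eqF//; lra.
have a0 : 0 < a by rewrite /base_angle divr_gt0 ?mulr_gt0//; lra.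
split=> //; have h3 : a * 3 <= 2 * pi by rewrite -h ler_pM2l//; lra.
split; [lra|split; lra].
Qed.

Lemma tang_angle_bounds j : 0 < th j /\ th j <= a.
Proof.
have b2R := base_ge2; have [a0 _] := base_angle_bounds; have bj : 1 <= b%:R ^+ j :> R by rewrite exprn_ege1//; lra.
have bj0 : 0 < b%:R ^+ j :> R by lra.
by split; [rewrite divr_gt0|rewrite ler_pdivrMr// ler_peMr// ltW].
Qed.

Lemma tang_radius_bounds j : 0 < r j /\ r j < 1.
Proof.
have [a0 [a1 _]] := base_angle_bounds; have [t0 t1] := tang_angle_bounds j.
have j0 : 0 <= j%:R :> R by [].
have j4 : 0 < j%:R + 4 :> R by lra.
have h : 0 < th j / (j%:R + 4) by rewrite divr_gt0.
split; rewrite /r; last lra.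
by rewrite subr_gt0 ltr_pdivrMr//; lra.
Qed.

(** (b + 1) a = 2 pi, hence multiplication by b acts on e^{+-ia} as complex
conjugation. *)
Lemma base_angle_pow m : expi (b%:R ^+ m * a) = expi a \/ expi (b%:R ^+ m * a) = expi (- a).
Proof.
have [_ [_ [_ ba]]] := base_angle_bounds.
have e1 : expi (b%:R * a) = expi (- a) by rewrite ba expi_sub2pi.
have e2 : expi (b%:R * - a) = expi a.
  by rewrite mulrN ba -expi_sub2pi subKr.
elim: m => [|m IH]; first by left; rewrite expr0 mul1r.
rewrite exprS -mulrA -expiX.
by case: IH => ->; rewrite expiX; [right|left].
Qed.

(** Before the index j the angle is at most a, afterwards it is one of +-a. *)
Lemma tang_angle_cos k j : cos a <= complex.Re (expi (th j) ^+ (b ^ k)).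
Proof.
have [a0 [_ [api _]]] := base_angle_bounds; have [t0 t1] := tang_angle_bounds j.
rewrite expiX natrX /th.
have b2R := base_ge2; have bn : b%:R != 0 :> R by rewrite gt_eqF//; lra.
case: (leqP j k) => jk.
  have -> : b%:R ^+ k * (a / b%:R ^+ j) = b%:R ^+ (k - j) * a.
    by rewrite -{1}(subnK jk) exprD; field; rewrite expf_eq0 (negbTE bn) andbF.
  by case: (base_angle_pow (k - j)) => ->; rewrite /= ?cosN.
have -> : b%:R ^+ k * (a / b%:R ^+ j) = th (j - k).
  rewrite /th -{1}(subnK (ltnW jk)) exprD; field.
  by rewrite !expf_eq0 (negbTE bn) !andbF.
have [u0 u1] := tang_angle_bounds (j - k).
by rewrite /= leNgt ltr_cos ?in_itv/= -?leNgt//; lra.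
Qed.

(** Eigenvalues of angle a b^-j and modulus 1 - a b^-j / (j + 4): they tend to 1,
the defect of the modulus is small compared with the angle, and all their
powers of exponent b^k have the form ro w with Re w >= cos a. *)
Lemma tangential_example : exists T : {linear H -> H},
  [/\ normal_contraction T, power_bound T 1, spectrum T `<=` open_disc `|` [set 1], ~ ritt T &
    exists l, diagonal T l /\ forall k i, exists ro w, [/\ 0 <= ro <= 1, nrm w = 1,
       cos a <= complex.Re w & l i ^+ (b ^ k) = ro%:C%C * w]].
Proof.
have b2R := base_ge2; have [a0 [a1 _]] := base_angle_bounds.
pose l j : R[i] := (r j)%:C%C * expi (th j).
have nl j : nrm (l j) = r j.
  have [r0 _] := tang_radius_bounds j.
  by rewrite nrmM nrm_expi mulr1 nrm_real gtr0_norm.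
have l1 j : nrm (l j) < 1 by rewrite nl; have [] := tang_radius_bounds j.
have [T hT] := diagonal_ex (fun i => ltW (l1 i)).
exists T; split.
- by apply: (diagonal_normal hT) => i; exact: ltW.
- by apply: (diagonal_power_bound hT) => i; exact: ltW.
- apply: (diagonal_spectrum_disc hT l1) => e e0.
  pose k := (Num.truncn (2 * a / e)).+1; exists k => i ki.
  have [t0 t1] := tang_angle_bounds i; have [r0 r1] := tang_radius_bounds i.
  have -> : l i - 1 = (l i - expi (th i)) + (expi (th i) - 1) by rewrite addrA subrK.
  apply: le_trans (nrmD _ _) _.
  have -> : l i - expi (th i) = ((r i - 1)%:C)%C * expi (th i) by rewrite rmorphB rmorph1 mulrBl mul1r.
  rewrite nrmM nrm_expi mulr1 nrm_real ltr0_norm ?subr_lt0//.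
  have h1 := expi_dist1 (th i); rewrite gtr0_norm// in h1.
  have j0 : 0 <= i%:R :> R by [].
  have h2 : 1 - r i <= th i.
    by rewrite /r subKr ler_pdivrMr; [rewrite ler_peMr ?(ltW t0)//; lra|lra].
  have h3 : th i <= a / i%:R.
    have i0 : 0 < i%:R :> R by rewrite ltr0n; apply: leq_trans ki.
    rewrite /th ler_pM2l// lef_pV2 ?posrE ?exprn_gt0//; last by lra.
    by rewrite -natrX ler_nat ltnW// ltn_expl.
  have h4 : 2 * (a / i%:R) <= e.
    rewrite mulrA ler_pdivrMr ?ltr0n; last by apply: leq_trans ki.
    rewrite [leRHS]mulrC -ler_pdivrMr//; apply: le_trans (ltW (truncnS_gt _)) _.
    by rewrite ler_nat.
  lra.
- move=> /(diagonal_ritt _ hT) []; first by move=> i; have [r0 r1] := tang_radius_bounds i; rewrite r0 ltW.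
  move=> K hK; pose i := (Num.truncn (2 * K)).+2.
  have [t0 t1] := tang_angle_bounds i.
  have ti : th i <= 1.
    rewrite /th ler_pdivrMr ?exprn_gt0//; last by lra.
    have : 2 ^+ 2 <= b%:R ^+ i :> R.
      apply: (@le_trans _ _ (b%:R ^+ 2)); first by apply: lerXn2r; rewrite ?nnegrE//; lra.
      by apply: ler_weXn2l => //; lra.
    lra.
  have := hK i; have := @sin_ge R (th i); rewrite (ltW t0) ti => /(_ isT) h1 h2.
  have j0 : 0 <= i%:R :> R by [].
  have j4 : 0 < i%:R + 4 :> R by lra.
  have h3 : th i / 2 <= K * (th i / (i%:R + 4)) by apply: le_trans h1 _; apply: le_trans h2 _; rewrite /r subKr.
  have h4 : (i%:R + 4) * th i <= 2 * K * th i.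
    by move: h3; rewrite mulrA ler_pdivlMr//; lra.
  move: h4; rewrite ler_pM2r// => h4.
  have := truncnS_gt (2 * K); rewrite ltNge => /negP; apply.
  apply: le_trans h4; rewrite /i -[(_.+2)%:R]natr1; lra.
exists l; split=> // k i; exists (r i ^+ (b ^ k)), (expi (th i) ^+ (b ^ k)).
have [r0 r1] := tang_radius_bounds i.
split; [|by rewrite nrmX nrm_expi expr1n|exact: tang_angle_cos|by rewrite /l exprMn rmorphXn].
by rewrite exprn_ge0 ?exprn_ile1// ltW.
Qed.

End TangentialExample.

Section LacunaryExample.
Context {R : realType}.
Notation H := (@ell2 R).
Variable n : nat -> nat.
Hypothesis n_pos : forall k, (0 < n k)%N.
Hypothesis n_incr : forall j k, (j < k)%N -> (n j < n k)%N.
Hypothesis n_sup : sup_ratio R n = +oo%E.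

(** Adding the first j ratios to the bound forces the index to be at least j. *)
Lemma big_gap (B : R) j : exists2 k, (j <= k)%N & B <= seq_ratio R n k.
Proof.
have r0 i : 0 <= seq_ratio R n i by rewrite divr_ge0.
pose B' := `|B| + \sum_(i < j) seq_ratio R n i.
have : (B'%:E < sup_ratio R n)%E by rewrite n_sup ltry.
move=> /ereal_sup_gt[_ [k _ <-]]; rewrite lte_fin => hk; exists k.
  rewrite leqNgt; apply/negP => kj; move: hk; rewrite ltNge => /negP; apply.
  rewrite /B' (bigD1 (Ordinal kj))//= addrCA lerDl addr_ge0//.
  by apply: sumr_ge0.
apply: le_trans (ltW hk); apply: le_trans (ler_norm B) _; rewrite lerDl.
by apply: sumr_ge0.
Qed.

Lemma quad_le_exp (x : R) : 0 <= x -> x * (1 + x) <= 4 * expR x.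
Proof.
move=> x0; have h := expR_ge1Dx (x / 2).
have -> : expR x = expR (x / 2) ^+ 2 by rewrite expr2 -expRD -splitr.
have : (1 + x / 2) ^+ 2 <= expR (x / 2) ^+ 2.
  by apply: lerXn2r; rewrite ?nnegrE ?expR_ge0// addr_ge0// divr_ge0.
rewrite !expr2; nra.
Qed.

(** Let p and p' = rho^2 p be the two ends of a gap of the sequence, rho^2 being
the large ratio.  The eigenvalue has angle d / p and modulus exp(-1 / (rho p)).
Up to the exponent p the angle is at most d; from p' on the modulus is at most
exp(-rho); the angle exceeds the defect of the modulus by the factor d rho.
After the gap, with x = n_k / (rho p) >= rho, the bound on the differences
n_k (l^n_k - l^(n_k - 1)) reduces to the boundedness of x (1 + x) exp(-x). *)
Lemma lacunary_example (d A : R) : 0 < d <= 1 -> 1 <= A -> exists T : {linear H -> H},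
  [/\ normal_contraction T, power_bound T 1, spectrum T `<=` open_disc `|` [set 1], ~ ritt T &
    exists l, [/\ diagonal T l,
      forall k i, (exists ro t, [/\ 0 <= ro <= 1, 0 <= t <= d & l i ^+ n k = ro%:C%C * expi t])
         \/ nrm (l i ^+ n k) <= (1 + A)^-1 &
      exists C : R, forall k i, (n k)%:R * nrm (l i ^+ n k - l i ^+ (n k).-1) <= C]].
Proof.
move=> /andP[d0 d1] A1.
have /choice[kk hkk] : forall j, exists k, (j <= k)%N /\ (A + j%:R) ^+ 2 <= seq_ratio R n k.
  by move=> j; have [k h1 h2] := big_gap ((A + j%:R) ^+ 2) j; exists k.
pose p j : R := (n (kk j))%:R.
pose p' j : R := (n (kk j).+1)%:R.
have p1 j : 1 <= p j by rewrite ler1n.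
have jp j : j%:R <= p j by rewrite ler_nat; apply: leq_trans (hkk j).1 _; exact: (sample_ge n_incr).
pose rho j := Num.sqrt (seq_ratio R n (kk j)).
have rho_sqr j : rho j ^+ 2 * p j = p' j.
  rewrite sqr_sqrtr; last by rewrite divr_ge0.
  by rewrite /seq_ratio divfK// gt_eqF// ltr0n.
have rhoA j : A + j%:R <= rho j.
  have h : 0 <= A + j%:R by rewrite addr_ge0//; lra.
  rewrite -[leLHS](ger0_norm h) -sqrtr_sqr ler_wsqrtr//; exact: (hkk j).2.
have rho1 j : 1 <= rho j by have := rhoA j; have : 0 <= j%:R :> R by []; lra.
(* th and ep are the angle and the defect of the modulus: r >= 1 - ep *)
pose th j := d / p j.
pose ep j := (rho j * p j)^-1.
have rp0 j : 0 < rho j * p j by rewrite mulr_gt0//; [have := rho1 j|have := p1 j]; lra.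
have ep0 j : 0 < ep j by rewrite invr_gt0.
have ep1 j : ep j <= 1.
  rewrite invf_le1//; have := rho1 j; have := p1 j; nra.
have th0 j : 0 < th j by rewrite divr_gt0//; have := p1 j; lra.
have thp j : th j * p j = d by rewrite divfK// gt_eqF//; have := p1 j; lra.
have thd j : th j <= d by rewrite ler_pdivrMr ?ler_peMr ?(ltW d0)//; have := p1 j; lra.
have epp j : ep j * p j * rho j = 1 by rewrite -mulrA [p j * _]mulrC mulVf// gt_eqF.
have epp' j : ep j * p' j = rho j.
  have -> : ep j * p' j = rho j * (ep j * p j * rho j) by rewrite -rho_sqr; ring.
  by rewrite epp mulr1.
have the j : th j = d * rho j * ep j.
  have : th j * p j = d * rho j * ep j * p j.
    have -> : d * rho j * ep j * p j = d * (ep j * p j * rho j) by ring.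
    by rewrite thp epp mulr1.
  by apply: mulIf; rewrite gt_eqF//; have := p1 j; lra.
pose r j := expR (- ep j).
have r0 j : 0 < r j by exact: expR_gt0.
have r1 j : r j < 1 by rewrite expR_lt1 oppr_lt0.
have rX j m : r j ^+ m = expR (- (m%:R * ep j)) by rewrite -expRM_natl mulrN.
have rep j : 1 - r j <= ep j by have := expR_ge1Dx (- ep j); rewrite /r; lra.
pose l j : R[i] := (r j)%:C%C * expi (th j).
have nl j : nrm (l j) = r j by rewrite nrmM nrm_expi mulr1 nrm_real gtr0_norm.
have l1 j : nrm (l j) < 1 by rewrite nl.
have dl j : nrm (l j - 1) <= ep j + th j.
  have -> : l j - 1 = (l j - expi (th j)) + (expi (th j) - 1) by rewrite addrA subrK.
  apply: le_trans (nrmD _ _) _.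
  have -> : l j - expi (th j) = ((r j - 1)%:C)%C * expi (th j) by rewrite rmorphB rmorph1 mulrBl mul1r.
  rewrite nrmM nrm_expi mulr1 nrm_real ltr0_norm ?subr_lt0// opprB.
  by apply: lerD; [exact: rep|have := expi_dist1 (th j); rewrite gtr0_norm].
have [T hT] := diagonal_ex (fun i => ltW (l1 i)).
exists T; split.
- by apply: (diagonal_normal hT) => i; exact: ltW.
- by apply: (diagonal_power_bound hT) => i; exact: ltW.
- apply: (diagonal_spectrum_disc hT l1) => e e0.
  pose k := (Num.truncn (2 / e)).+1; exists k => i ki.
  have i0 : 0 < i%:R :> R by rewrite ltr0n; apply: leq_trans ki.
  have h1 : 2 <= e * i%:R.
    rewrite [leRHS]mulrC -ler_pdivrMr//; apply: le_trans (ltW (truncnS_gt _)) _.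
    by rewrite ler_nat.
  apply: le_trans (dl i) _; have := thp i; have := epp i; have := jp i; have := rho1 i.
  have := p1 i; have := th0 i; have := ep0 i => *.
  have h2 : ep i * p i <= 1 by nra.
  have h3 : (ep i + th i) * i%:R <= 2 by nra.
  have : (ep i + th i) * i%:R <= e * i%:R by lra.
  by rewrite ler_pM2r.
- move=> /(diagonal_ritt _ hT) []; first by move=> i; rewrite r0 ltW.
  move=> K hK; pose i := (Num.truncn (2 * K / d)).+1.
  have := hK i; have := @sin_ge R (th i); rewrite (ltW (th0 i)) (le_trans (thd i) d1) => /(_ isT) h1 h2.
  have K0 : 0 <= K.
    have : 0 < K * (1 - r i) by apply: lt_le_trans h2; apply: lt_le_trans h1; rewrite divr_gt0.
    by have := r1 i; nra.
  have h3 : th i / 2 <= K * ep i.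
    by apply: le_trans h1 _; apply: le_trans h2 _; apply: ler_wpM2l.
  have h4 : d * rho i <= 2 * K by have := the i; have := ep0 i; nra.
  have := truncnS_gt (2 * K / d); rewrite ltNge => /negP; apply.
  rewrite ler_pdivlMr//; have := rhoA i; rewrite /i; nra.
exists l; split=> //.
- move=> k i; case: (leqP k (kk i)) => hk.
    left; exists (r i ^+ n k), ((n k)%:R * th i); split.
    + by rewrite exprn_ge0 ?exprn_ile1// ltW.
    + rewrite mulr_ge0 ?(ltW (th0 i))//= -(thp i) mulrC ler_pM2l// ler_nat.
      by move: hk; rewrite leq_eqVlt => /predU1P[->|/n_incr/ltnW].
    + by rewrite /l exprMn rmorphXn expiX.
  right; rewrite nrmX nl rX expRN lef_pV2 ?posrE ?expR_gt0//; last by lra.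
  apply: le_trans (expR_ge1Dx _); rewrite lerD2l.
  apply: (@le_trans _ _ (rho i)); first by have := rhoA i; have : 0 <= i%:R :> R by []; lra.
  rewrite -(epp' i) mulrC ler_pM2r// ler_nat.
  by move: hk; rewrite leq_eqVlt => /predU1P[->|/n_incr/ltnW].
exists (4 * expR 1) => k i.
have e1 : 1 <= expR 1 :> R by have := expR_ge1Dx (1 : R); lra.
have -> : l i ^+ n k - l i ^+ (n k).-1 = l i ^+ (n k).-1 * (l i - 1).
  by rewrite mulrBr mulr1 -exprSr prednK.
rewrite nrmM nrmX nl.
have m0 : 0 < (n k)%:R :> R by rewrite ltr0n.
have rm : r i ^+ (n k).-1 <= 1 by rewrite exprn_ile1// ltW.
have rm0 : 0 <= r i ^+ (n k).-1 by rewrite exprn_ge0// ltW.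
case: (leqP k (kk i)) => hk.
  have mp : (n k)%:R <= p i.
    by rewrite ler_nat; move: hk; rewrite leq_eqVlt => /predU1P[->|/n_incr/ltnW].
  apply: (@le_trans _ _ (p i * (1 * (ep i + th i)))).
    apply: ler_pM => //; first by rewrite mulr_ge0// nrm_ge0.
    by apply: ler_pM => //; exact: nrm_ge0.
  have := thp i; have := epp i; have := rho1 i; have := ep0 i; have := p1 i => *.
  have h2 : ep i * p i <= 1 by nra.
  lra.
pose x := (n k)%:R * ep i.
have xr : rho i <= x.
  rewrite -(epp' i) /x mulrC ler_pM2r// ler_nat.
  by move: hk; rewrite leq_eqVlt => /predU1P[->|/n_incr/ltnW].
have rme : r i ^+ (n k).-1 <= expR 1 * (expR x)^-1.
  rewrite rX -expRN -expRD ler_expR.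
  have -> : (n k).-1%:R = (n k)%:R - 1 :> R by rewrite -subn1 natrB.
  by rewrite mulrBl mul1r -/x; have := ep1 i; lra.
have x0 : 0 <= x by rewrite mulr_ge0// ltW.
have h1 : (n k)%:R * nrm (l i - 1) <= x * (1 + x).
  apply: (@le_trans _ _ ((n k)%:R * (ep i + th i))); first by rewrite ler_pM2l.
  rewrite the -[X in X + _]mul1r -mulrDl mulrCA mulrC -/x; apply: ler_wpM2l => //.
  rewrite lerD2l; apply: le_trans xr; rewrite ler_piMl//; have := rho1 i; lra.
rewrite mulrCA; apply: (@le_trans _ _ (expR 1 * (expR x)^-1 * (4 * expR x))).
  apply: ler_pM => //; first by rewrite mulr_ge0 ?nrm_ge0// ltW.
  exact: le_trans h1 (quad_le_exp x0).
have ex : expR x != 0 by rewrite gt_eqF// expR_gt0.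
by rewrite le_eqVlt; apply/orP; left; apply/eqP; field.
Qed.

End LacunaryExample.

(** * Thresholds and sampling sequences *)

Section ExampleBounds.
Context {R : realType}.
Notation H := (@ell2 R).

Lemma diagonal_sup_dist (T : {linear H -> H}) l (n : nat -> nat) (C : R) : diagonal T l ->
  (forall k i, nrm (1 - l i ^+ n k) <= C) -> (sup_dist_id n T <= C%:E)%E.
Proof.
move=> hT hC; apply: ge_ereal_sup => _ [k _ <-].
have h : diagonal (fun x : H => x - iter (n k) T x) (fun i => 1 - l i ^+ n k).
  by move=> x i; rewrite entryB (diagonal_iter _ hT) mulrBl mul1r.
apply: opnorm_le; last exact: diagonal_bound h (hC k).
by apply: le_trans (hC k 0%N); exact: nrm_ge0.
Qed.

Lemma diagonal_sup_resolvent (T : {linear H -> H}) l (n : nat -> nat) (G : set R[i]) (d : R) :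
  0 < d -> diagonal T l -> (forall k i z, G z -> d <= nrm (z - l i ^+ n k)) ->
  (sup_resolvent n G T < +oo)%E.
Proof.
move=> d0 hT hd; apply: (@le_lt_trans _ _ (d^-1)%:E); last exact: ltry.
apply: ge_ereal_sup => _ [[k z] /= Gz <-].
apply: (diagonal_invnorm d0 (diagonal_pencil z (diagonal_iter (n k) hT))) => i.
exact: hd.
Qed.

Lemma diagonal_ritt_diff (T : {linear H -> H}) l (m : nat) (C : R) : (0 < m)%N -> diagonal T l ->
  (forall i, m%:R * nrm (l i ^+ m - l i ^+ m.-1) <= C) -> (ritt_diff T m <= C%:E)%E.
Proof.
move=> m0 hT hC; have mR : 0 < m%:R :> R by rewrite ltr0n.
have h : diagonal (fun x : H => iter m T x - iter m.-1 T x) (fun i => l i ^+ m - l i ^+ m.-1).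
  by move=> x i; rewrite entryB !(diagonal_iter _ hT) mulrBl.
have hb i : nrm (l i ^+ m - l i ^+ m.-1) <= m%:R^-1 * C by rewrite ler_pdivlMl.
rewrite /ritt_diff; apply: (@le_trans _ _ (m%:R%:E * (m%:R^-1 * C)%:E)%E).
  apply: lee_wpmul2l; first by rewrite lee_fin.
  apply: opnorm_le; last exact: diagonal_bound h hb.
  by apply: le_trans (hb 0%N); exact: nrm_ge0.
by rewrite -EFinM mulrA divff ?mul1r// gt_eqF.
Qed.

Lemma closed_arc_nrm (G : set R[i]) z : closed_arc G -> G z -> nrm z = 1.
Proof. by move=> [a [b [_ _ ->]]] [t _ <-]; exact: nrm_expi. Qed.

Lemma cos_arc (a t : R) : 0 <= a -> a < t < 2 * pi - a -> cos t < cos a.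
Proof.
move=> a0 /andP[t1 t2]; have p0 := pi_gt0 R.
have c2 : cos (2 * pi - t) = cos t.
  by have := congr1 (@complex.Re R) (expi_sub2pi t); rewrite /= cosN.
by case: (leP t pi) => tp; [|rewrite -c2]; rewrite ltr_cos ?in_itv/=; lra.
Qed.

End ExampleBounds.

Section PowersOfBase.
Context {R : realType}.
Variable b : nat.
Hypothesis b2 : (2 <= b)%N.
Notation nb := (fun k => (b ^ k)%N).
Local Notation a := (@base_angle R b).
Let s : R := 2 * sin (pi / (b%:R + 1)).

Lemma base_pow_pos k : (0 < nb k)%N.
Proof. by rewrite expn_gt0; case: b b2. Qed.

Lemma base_pow_incr j k : (j < k)%N -> (nb j < nb k)%N.
Proof. by move=> jk; rewrite ltn_exp2l. Qed.

Lemma base_sup_ratio : (sup_ratio R nb <= b%:R%:E)%E.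
Proof.
apply: ge_ereal_sup => _ [k _ <-]; rewrite lee_fin /seq_ratio expnS natrM mulfK//.
by rewrite pnatr_eq0 -lt0n base_pow_pos.
Qed.

Lemma chord_base : nrm (1 - expi a) = s.
Proof.
have [a0 [_ [api _]]] := base_angle_bounds (R := R) b2.
rewrite nrmBC chordE; last by apply/andP; split; lra.
by rewrite /s /base_angle; congr (2 * sin _); rewrite mulrAC [2 * pi]mulrC mulfK// pnatr_eq0.
Qed.

Lemma base_resolvent_example (G : set R[i]) : closed_arc G ->
  G `<=` unit_arc_interior b%:R ->
  exists (X : completeNormedModType R[i]) (T : {linear X -> X}),
    [/\ normal_contraction T, spectrum T `<=` open_disc `|` [set 1],
        (sup_resolvent nb G T < +oo)%E & ~ ritt T].
Proof.
move=> cG Gi; have [t0 Gt0 ht0] := arc_max_cos cG.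
have [a0 [_ [api ba]]] := base_angle_bounds (R := R) b2.
have cc : cos t0 < cos a.
  have [t tb et] := Gi _ Gt0.
  have -> : cos t0 = cos t by have := congr1 (@complex.Re R) et.
  apply: cos_arc; first exact: ltW.
  have e : 2 * pi * b%:R / (b%:R + 1) = 2 * pi - a by rewrite -ba /base_angle; ring.
  by move: tb; rewrite /= in_itv/= e.
have [T [h1 h2 h3 h4 [l [hT hl]]]] := tangential_example (R := R) b2.
exists (@ell2 R), T; split=> //.
apply: (diagonal_sup_resolvent (d := (cos a - cos t0) / 2) _ hT).
  by rewrite divr_gt0// subr_gt0.
move=> k i z Gz; have [ro [w [ro1 w1 cw ->]]] := hl k i.
have := half_dist (closed_arc_nrm cG Gz) w1 ro1.
have : cos a - cos t0 <= nrm (z - w).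
  rewrite nrmBC; apply: le_trans (nrm_geRe _); apply: le_trans (ler_norm _).
  have := ht0 z Gz; case: z {Gz} => ? ?; case: w {w1} cw => ? ? /=; lra.
by lra.
Qed.

Lemma base_threshold (X : completeNormedModType R[i]) (T : {linear X -> X}) :
  power_bounded T -> (sup_dist_id nb T < s%:E)%E -> ritt T.
Proof.
by move=> hT; apply: ritt_of_small_distance hT => //;
  [exact: base_pow_pos|exact: base_pow_incr|exact: base_sup_ratio].
Qed.

(** Distances below s are covered by the criterion of small distance.  A distance
below 1 leaves only the identity, which is a Ritt operator. *)
Lemma base_threshold_disc (X : completeNormedModType R[i]) (T : {linear X -> X}) :
  power_bounded T -> spectrum T `<=` open_disc `|` [set 1] ->
  (sup_dist_id nb T < (Num.max 1 s)%:E)%E -> ritt T.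
Proof.
move=> hT sT; rewrite EFin_max lt_max => /orP[|]; last exact: base_threshold.
move=> /sup_dist_lt[q q1 /sup_dist_bound hq]; have [M hM] := power_bounded_bound hT.
apply: (@ritt_of_unipotent _ _ T M (Num.max 0 q) nb hM) => //.
- by rewrite le_max lexx gt_max ltr01 q1.
- by move=> k; rewrite ltnW// ltn_expl.
- move=> k x; apply: le_trans (hq k x) _; apply: ler_wpM2r; first exact: nrm_ge0.
  by rewrite le_max lexx orbT.
Qed.

(** The powers ro w lie on segments from 0 to points of the circle at distance at
most s from 1, and the distance to 1 is convex. *)
Lemma base_sharp_disc (Q : R) : Num.max 1 s < Q ->
  exists (X : completeNormedModType R[i]) (T : {linear X -> X}),
    [/\ power_bounded T, spectrum T `<=` open_disc `|` [set 1],
        (sup_dist_id nb T < Q%:E)%E & ~ ritt T].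
Proof.
move=> hQ; have [T [h1 h2 h3 h4 [l [hT hl]]]] := tangential_example (R := R) b2.
exists (@ell2 R), T; split=> //; first exact: power_bound_bounded h2.
apply: (@le_lt_trans _ _ (Num.max 1 s)%:E); last by rewrite lte_fin.
apply: (diagonal_sup_dist hT) => k i.
have [ro [w [ro1 w1 cw ->]]] := hl k i.
apply: dist_one_convex => //; first by rewrite le_max lexx.
have s0 : 0 <= s by rewrite -chord_base nrm_ge0.
rewrite le_max; apply/orP; right.
rewrite -(@ler_pXn2r _ 2)// ?nnegrE ?nrm_ge0// -chord_base expi_dist_sqr.
have [t _ wt] := expi_nrm1_surj w1; rewrite wt /= in cw *.
rewrite expi_dist_sqr; lra.
Qed.

(** The unimodular scalar e^{ia}: its sampled powers are e^{+-ia}. *)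
Lemma base_sharp (Q : R) : s < Q ->
  exists (X : completeNormedModType R[i]) (T : {linear X -> X}),
    [/\ power_bounded T, (sup_dist_id nb T < Q%:E)%E & ~ ritt T].
Proof.
move=> hQ; pose l (i : nat) : R[i] := expi a.
have l1 i : nrm (l i) <= 1 by rewrite nrm_expi.
have [T hT] := diagonal_ex l1.
exists (@ell2 R), T; split; first exact: power_bound_bounded (diagonal_power_bound hT l1).
  apply: (@le_lt_trans _ _ s%:E); last by rewrite lte_fin.
  apply: (diagonal_sup_dist hT) => k i; rewrite /l expiX natrX.
  have [->|->] := base_angle_pow (R := R) b2 k; first by rewrite chord_base.
  by rewrite nrmBC chordN nrmBC chord_base.
move=> rT; have hT1 : diagonal T (fun i => (1 : R)%:C%C * expi a).
  by move=> x i; rewrite hT rmorph1 mul1r.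
have r1 (i : nat) : 0 < (1 : R) <= 1 by rewrite ltr01 lexx.
have [K hK] := diagonal_ritt (r := fun=> 1) (t := fun=> a) r1 hT1 rT.
have := hK 0%N; rewrite subrr mulr0 leNgt => /negP; apply.
have [a0 [a1 [api ba]]] := base_angle_bounds (R := R) b2.
apply: sin_gt0_pi; rewrite a0/=.
have b2a : 2 * a <= b%:R * a by rewrite ler_pM2r// base_ge2.
have p0 := pi_gt0 R; clear hK r1 hT1 rT; lra.
Qed.

End PowersOfBase.

Section UnboundedGaps.
Context {R : realType}.
Variable n : nat -> nat.
Hypothesis n_pos : forall k, (0 < n k)%N.
Hypothesis n_incr : forall j k, (j < k)%N -> (n j < n k)%N.
Hypothesis n_sup : sup_ratio R n = +oo%E.

(** The arc keeps a distance e from 1.  The powers before the gap have angle at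
most e/2, the others have modulus at most 1/2. *)
Lemma gap_resolvent_example (G : set R[i]) : closed_arc G -> G `<=` circle `\ 1 ->
  exists (X : completeNormedModType R[i]) (T : {linear X -> X}),
    [/\ normal_contraction T, spectrum T `<=` open_disc `|` [set 1], ~ ritt T &
        (sup_resolvent n G T < +oo)%E].
Proof.
move=> cG G1; have [t0 Gt0 ht0] := arc_max_cos cG.
pose e : R := 1 - cos t0.
have e0 : 0 < e.
  rewrite subr_gt0 lt_neqAle cos_le1 andbT; apply/eqP => ct.
  have [_ /=] := G1 _ Gt0; apply; apply: complex_ext => //=.
  by apply/eqP; rewrite -sqrf_eq0 sin2cos2 ct expr1n subrr.
pose d := Num.min 1 (e / 2).
have d0 : 0 < d by rewrite lt_min ltr01 divr_gt0.
have d1 : d <= 1 by rewrite ge_min lexx.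
have de : d <= e / 2 by rewrite ge_min lexx orbT.
have dd : 0 < d <= 1 by rewrite d0.
have [T [h1 h2 h3 h4 [l [hT hl _]]]] := lacunary_example n_pos n_incr n_sup dd (lexx 1).
exists (@ell2 R), T; split=> //.
have f0 : 0 < Num.min (e / 4) (1 / 2) by rewrite lt_min !divr_gt0.
apply: (diagonal_sup_resolvent f0 hT) => k i z Gz.
have nz := closed_arc_nrm cG Gz.
rewrite ge_min; case: (hl k i) => [[ro [t [ro1 /andP[t1 t2] ->]]]|hn]; last first.
  apply/orP; right; apply: le_trans (nrm_lerB _ _); rewrite nz; move: hn.
  rewrite (_ : 1 + 1 = 2)//; lra.
apply/orP; left.
have := half_dist nz (nrm_expi t) ro1.
have := nrm_lerB (z - 1) (expi t - 1); have -> : z - 1 - (expi t - 1) = z - expi t by rewrite opprB addrA subrK.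
have := expi_dist1 t; rewrite ger0_norm//.
have : e <= nrm (z - 1).
  rewrite nrmBC; apply: le_trans (nrm_geRe _); apply: le_trans (ler_norm _).
  by have := ht0 z Gz; rewrite /e; case: z {Gz nz} => ? ? /=; lra.
by lra.
Qed.

Lemma gap_distance_example (q : R) : 1 < q ->
  exists (X : completeNormedModType R[i]) (T : {linear X -> X}),
    [/\ normal_contraction T, spectrum T `<=` open_disc `|` [set 1], ~ ritt T &
        (sup_dist_id n T <= q%:E)%E].
Proof.
move=> q1; have dd : 0 < (1 : R) <= 1 by rewrite ltr01 lexx.
pose A := 1 + (q - 1)^-1; have q0 : 0 < (q - 1)^-1 by rewrite invr_gt0 subr_gt0.
have A1 : 1 <= A by rewrite lerDl ltW.
have [T [h1 h2 h3 h4 [l [hT hl _]]]] := lacunary_example n_pos n_incr n_sup dd A1.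
exists (@ell2 R), T; split=> //; apply: (diagonal_sup_dist hT) => k i.
case: (hl k i) => [[ro [t [ro1 /andP[t1 t2] ->]]]|hn].
  apply: (dist_one_convex ro1 (ltW q1)); rewrite nrmBC.
  by apply: le_trans (expi_dist1 t) _; rewrite ger0_norm//; lra.
apply: le_trans (nrmB _ _) _; rewrite nrm1.
have : (1 + A)^-1 <= q - 1.
  by rewrite -[leRHS]invrK lef_pV2 ?posrE//; rewrite /A; lra.
by lra.
Qed.

Lemma gap_not_sampling : ~ ritt_sampling R n.
Proof.
move=> hs; have dd : 0 < (1 : R) <= 1 by rewrite ltr01 lexx.
have [T [h1 h2 h3 h4 [l [hT _ [C hC]]]]] := lacunary_example n_pos n_incr n_sup dd (lexx 1).
apply: h4; apply: (hs (@ell2 R) T (power_bound_bounded h2)).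
apply: (@le_lt_trans _ _ C%:E); last exact: ltry.
by apply: ge_ereal_sup => _ [k _ <-]; apply: (diagonal_ritt_diff (n_pos k) hT).
Qed.

End UnboundedGaps.
Theorem theoremD (R : realType) (n : nat -> nat)
    (n_pos : forall k, (0 < n k)%N)
    (n_incr : forall j k, (j < k)%N -> (n j < n k)%N)
    (n_0 : n 0%N = 1%N) :
  (* (i) *)
  [/\ (forall c' : R,
         (limsup_ratio R n < +oo)%E -> (limsup_ratio R n <= c'%:E)%E ->
         forall (X : completeNormedModType R[i]) (T : {linear X -> X}),
           power_bounded T ->
           spectrum T `&` circle `<=` [set 1] ->
           (sup_resolvent n (unit_arc c') T < +oo)%E ->
           ritt T),
      (seq_ratio R n @ \oo --> (1 : R) ->
         forall (X : completeNormedModType R[i]) (T : {linear X -> X}),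
           power_bounded T ->
           spectrum T `&` circle `<=` [set 1] ->
           (exists zeta : R[i], [/\ circle zeta, zeta <> 1 &
              (sup_resolvent n [set zeta] T < +oo)%E]) ->
           ritt T) &
      (forall c : R, (sup_ratio R n <= c%:E)%E ->
         forall (X : completeNormedModType R[i]) (T : {linear X -> X}),
           power_bounded T ->
           (sup_dist_id n T < (2 * sin (pi / (c + 1)))%:E)%E ->
           ritt T)]
  /\
  (* (ii) *)
  (forall b : nat, (2 <= b)%N ->
     let nb k := (b ^ k)%N in
     let s : R := 2 * sin (pi / (b%:R + 1)) in
     let Qb : R := Num.max 1 s in
     [/\ (forall G : set R[i], closed_arc G -> G `<=` unit_arc_interior b%:R ->
            exists (X : completeNormedModType R[i]) (T : {linear X -> X}),
              [/\ normal_contraction T,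
                  spectrum T `<=` open_disc `|` [set 1],
                  (sup_resolvent nb G T < +oo)%E &
                  ~ ritt T]),
         (forall (X : completeNormedModType R[i]) (T : {linear X -> X}),
            power_bounded T ->
            spectrum T `<=` open_disc `|` [set 1] ->
            (sup_dist_id nb T < Qb%:E)%E ->
            ritt T),
         (forall Q : R, Qb < Q ->
            exists (X : completeNormedModType R[i]) (T : {linear X -> X}),
              [/\ power_bounded T,
                  spectrum T `<=` open_disc `|` [set 1],
                  (sup_dist_id nb T < Q%:E)%E &
                  ~ ritt T]),
         (forall (X : completeNormedModType R[i]) (T : {linear X -> X}),
            power_bounded T ->
            (sup_dist_id nb T < s%:E)%E ->
            ritt T) &
         (forall Q : R, s < Q ->
            exists (X : completeNormedModType R[i]) (T : {linear X -> X}),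
              [/\ power_bounded T, (sup_dist_id nb T < Q%:E)%E & ~ ritt T])])
  /\
  (* (iii) *)
  (sup_ratio R n = +oo%E ->
     (forall G : set R[i], closed_arc G -> G `<=` circle `\ 1 ->
        exists (X : completeNormedModType R[i]) (T : {linear X -> X}),
          [/\ normal_contraction T,
              spectrum T `<=` open_disc `|` [set 1],
              ~ ritt T &
              (sup_resolvent n G T < +oo)%E])
     /\
     (forall q : R, 1 < q ->
        exists (X : completeNormedModType R[i]) (T : {linear X -> X}),
          [/\ normal_contraction T,
              spectrum T `<=` open_disc `|` [set 1],
              ~ ritt T &
              (sup_dist_id n T <= q%:E)%E]))
  /\
  (* (iv) *)
  ((ritt_sampling R n <-> (sup_ratio R n < +oo)%E)
   /\
   ((sup_ratio R n < +oo)%E ->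
     forall (X : completeNormedModType R[i]) (T : {linear X -> X}),
       power_bounded T ->
       (ereal_sup [set ritt_diff T m | m in [set m : nat | (1 <= m)%N]]
        <= power_constant T * sup_ratio R n
           * ereal_sup [set ritt_diff T (n k) | k in [set: nat]])%E)).

Proof.
split; [|split; [|split]].
- split.
  + by move=> c' _ hc X T; exact: ritt_of_arc_resolvent.
  + by move=> hc X T hT sT [z [z1 zn hz]]; exact: (ritt_of_point_resolvent n_pos n_incr hc hT sT z1 zn hz).
  + by move=> c hc X T; exact: ritt_of_small_distance.
- move=> b b2 nb s Qb; split.
  + exact: base_resolvent_example.
  + by move=> X T; exact: base_threshold_disc.
  + exact: base_sharp_disc.
  + by move=> X T; exact: base_threshold.
  + exact: base_sharp.
- move=> hsup; split; first exact: gap_resolvent_example.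
  exact: gap_distance_example.
- split; last first.
    move=> hc X T hT; apply: ge_ereal_sup => _ [m m1 <-].
    exact: diff_sampling.
  split; last by move=> hc X T; exact: ritt_of_sampled_diff.
  move=> hs; rewrite ltey; apply/eqP => hsup.
  exact: (gap_not_sampling n_pos n_incr hsup hs).
Qed.
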